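(* Let $\mathcal C$ be one of the classes $\Sigma_{2,\le}$, $\texttt{b-}\Sigma_{2,\le}$, $\texttt{b-}\Sigma^{++}_{2,\le}$. Given a $\mathcal C$-sentence, one can compute in polynomial time an equivalent $\mathcal C$-sentence all of whose atoms involve polynomials of total degree at most four. In particular one can compute in polynomial time an equivalent $\mathcal C$-sentence whose atomic polynomials are given in the standard encoding as lists of (multi-index, coefficient) pairs.
   Context: $\mathcal L$ is the first-order language over the signature $\langle \mathbb Z,+,\times,<,\le\rangle$ with connectives $\land,\lor$ (negation, implication, equality as abbreviations), integer constants in binary, polynomials in atoms given as terms over $\langle\mathbb Z,+,\times\rangle$, interpreted over $\mathbb R$. A $\mathrm{QFF}_\le$-formula is a quantifier-free $\mathcal L$-formula not containing $<$. $I=[-1,1]$; $|X|\le y$ abbreviates $\bigwedge_j(-y\le x_j\le y)$ and $|X|>y$ its negation; $\exists X\in I^m.\forall Y\in I^n.\Phi_0$ abbreviates $\exists X\in\mathbb R^m.\forall Y\in\mathbb R^n.(|Y|>1\lor(|X|\le1\land\Phi_0))$. Classes: $\Sigma_{2,\le}$ = sentences $\exists X\in\mathbb R^m.\forall Y\in\mathbb R^n.\Phi_{0,\le}(X,Y)$; $\texttt{b-}\Sigma_{2,\le}$ = sentences $\exists X\in I^m.\forall Y\in I^n.\Phi_{0,\le}(X,Y)$; $\texttt{b-}\Sigma^{++}_{2,\le}$ = sentences $\exists X\in I^m.\forall Y\in I^n.(\Psi_{0,\le}(Y)\to\Phi_{0,\le}(X,Y))$; here $\Phi_{0,\le},\Psi_{0,\le}$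 are $\mathrm{QFF}_\le$-formulas. Standard encoding of $P\in\mathbb Z[x_1,\dots,x_n]$: a list of pairs $(\alpha_k,c_k)$ with $\alpha_k\in\mathbb N^n$ in unary and $c_k\in\mathbb Z$ in binary such that $P=\sum_kc_kx^{\alpha_k}$. *)

(* Defs.v *)
From Stdlib Require Import Reals ZArith.
From Stdlib Require List.
From mathcomp Require Import all_boot all_algebra.
From mathcomp Require Import mpoly.

Set Implicit Arguments.
Unset Strict Implicit.
Unset Printing Implicit Defensive.

Inductive term : Type :=
| TVar of nat
| TConst of Z
| TAdd of term & term
| TMul of term & term.

Inductive tatom : Type :=
| TLe of term & term
| TLt of term & term.

(* standard encoding of a polynomial: list of (multi-index, coefficient) *)
Definition stdpoly := seq (seq nat * Z).

Inductive satom : Type :=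
| SLe of stdpoly & stdpoly
| SLt of stdpoly & stdpoly.

(* quantifier-free formulas with connectives /\ and \/ over atoms A
   (negation/implication are abbreviations in the paper) *)
Inductive qf (A : Type) : Type :=
| QAtom of A
| QAnd of qf A & qf A
| QOr of qf A & qf A.
Arguments QAtom {A}.

(* sentences of the three shapes.  Variables 0..m-1 are X, m..m+n-1 are Y. *)
Inductive sentence (A : Type) : Type :=
| Sig2 (m n : nat) (phi : qf A)                  (* E X in R^m. A Y in R^n. phi *)
| BSig2 (m n : nat) (phi : qf A)                 (* E X in I^m. A Y in I^n. phi *)
| BSig2pp (m n : nat) (psi : qf A) (phi : qf A). (* E X in I^m. A Y in I^n. psi(Y) -> phi *)

Inductive cls : Type := CSigma2 | CbSigma2 | CbSigma2pp.

Fixpoint teval (v : nat -> R) (t : term) : R :=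
  match t with
  | TVar i => v i
  | TConst z => IZR z
  | TAdd s u => Rplus (teval v s) (teval v u)
  | TMul s u => Rmult (teval v s) (teval v u)
  end.

Definition tatom_holds (v : nat -> R) (a : tatom) : Prop :=
  match a with
  | TLe s t => Rle (teval v s) (teval v t)
  | TLt s t => Rlt (teval v s) (teval v t)
  end.

Fixpoint mon_eval_from (v : nat -> R) (i : nat) (alpha : seq nat) : R :=
  match alpha with
  | [::] => R1
  | a :: al => Rmult (pow (v i) a) (mon_eval_from v (S i) al)
  end.

Fixpoint std_eval (v : nat -> R) (p : stdpoly) : R :=
  match p with
  | [::] => R0
  | (alpha, c) :: q => Rplus (Rmult (IZR c) (mon_eval_from v 0 alpha)) (std_eval v q)
  end.

Definition satom_holds (v : nat -> R) (a : satom) : Prop :=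
  match a with
  | SLe p q => Rle (std_eval v p) (std_eval v q)
  | SLt p q => Rlt (std_eval v p) (std_eval v q)
  end.

Fixpoint qf_holds (A : Type) (ah : (nat -> R) -> A -> Prop) (v : nat -> R)
    (f : qf A) : Prop :=
  match f with
  | QAtom a => ah v a
  | QAnd f1 f2 => qf_holds ah v f1 /\ qf_holds ah v f2
  | QOr f1 f2 => qf_holds ah v f1 \/ qf_holds ah v f2
  end.

Definition valXY (m : nat) (x y : nat -> R) : nat -> R :=
  fun i => if (i < m)%N then x i else y (i - m)%N.

Definition in_box (k : nat) (z : nat -> R) : Prop :=
  forall j, (j < k)%N -> Rle (Ropp R1) (z j) /\ Rle (z j) R1.

(* truth of a sentence, unfolding the paper's abbreviations literally *)
Definition sentence_true (A : Type) (ah : (nat -> R) -> A -> Prop)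
    (s : sentence A) : Prop :=
  match s with
  | Sig2 m n phi =>
      exists x : nat -> R, forall y : nat -> R, qf_holds ah (valXY m x y) phi
  | BSig2 m n phi =>
      exists x : nat -> R, forall y : nat -> R,
        ~ in_box n y \/ (in_box m x /\ qf_holds ah (valXY m x y) phi)
  | BSig2pp m n psi phi =>
      exists x : nat -> R, forall y : nat -> R,
        ~ in_box n y \/
        (in_box m x /\
         (qf_holds ah (valXY m x y) psi -> qf_holds ah (valXY m x y) phi))
  end.

Fixpoint qf_all (A : Type) (P : A -> Prop) (f : qf A) : Prop :=
  match f with
  | QAtom a => P a
  | QAnd f1 f2 => qf_all P f1 /\ qf_all P f2
  | QOr f1 f2 => qf_all P f1 /\ qf_all P f2
  end.

Fixpoint term_vars (t : term) : seq nat :=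
  match t with
  | TVar i => [:: i]
  | TConst _ => [::]
  | TAdd s u => term_vars s ++ term_vars u
  | TMul s u => term_vars s ++ term_vars u
  end.

Definition tatom_ok (lo hi : nat) (a : tatom) : Prop :=
  match a with
  | TLe s t => forall i, i \in term_vars s ++ term_vars t -> (lo <= i < hi)%N
  | TLt _ _ => False
  end.

Definition stdpoly_ok (lo hi : nat) (p : stdpoly) : Prop :=
  forall ac : seq nat * Z, List.In ac p ->
    size ac.1 = hi /\ forall i, (i < lo)%N -> nth 0%N ac.1 i = 0%N.

Definition satom_ok (lo hi : nat) (a : satom) : Prop :=
  match a with
  | SLe p q => stdpoly_ok lo hi p /\ stdpoly_ok lo hi q
  | SLt _ _ => False
  end.

(* s is a C-sentence: right shape, QFF_<= matrices, closed, and Psi only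
   mentions Y *)
Definition in_class (A : Type) (ok : nat -> nat -> A -> Prop) (C : cls)
    (s : sentence A) : Prop :=
  match C, s with
  | CSigma2, Sig2 m n phi => qf_all (ok 0%N (m + n)%N) phi
  | CbSigma2, BSig2 m n phi => qf_all (ok 0%N (m + n)%N) phi
  | CbSigma2pp, BSig2pp m n psi phi =>
      qf_all (ok m (m + n)%N) psi /\ qf_all (ok 0%N (m + n)%N) phi
  | _, _ => False
  end.

Definition nvars (A : Type) (s : sentence A) : nat :=
  match s with
  | Sig2 m n _ | BSig2 m n _ | BSig2pp m n _ _ => (m + n)%N
  end.

Definition sentence_atoms_all (A : Type) (P : A -> Prop) (s : sentence A) : Prop :=
  match s with
  | Sig2 _ _ phi | BSig2 _ _ phi => qf_all P phi
  | BSig2pp _ _ psi phi => qf_all P psi /\ qf_all P phi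
  end.

Definition int_of_Z (z : Z) : int :=
  match z with
  | Z0 => Posz 0
  | Zpos p => Posz (Pos.to_nat p)
  | Zneg p => GRing.opp (Posz (Pos.to_nat p))
  end.

Fixpoint term_mpoly (k : nat) (t : term) : {mpoly int[k]} :=
  match t with
  | TVar i => match @insub nat (fun j => (j < k)%N) 'I_k i with
              | Some j => 'X_j
              | None => 0%R
              end
  | TConst z => (int_of_Z z)%:MP
  | TAdd s u => (term_mpoly k s + term_mpoly k u)%R
  | TMul s u => (term_mpoly k s * term_mpoly k u)%R
  end.

(* total degree <= d  (msize p = 1 + total degree, msize 0 = 0) *)
Definition term_deg_le (k d : nat) (t : term) : Prop :=
  (msize (term_mpoly k t) <= d.+1)%N.

Definition tatom_deg_le (k d : nat) (a : tatom) : Prop :=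
  match a with
  | TLe s t | TLt s t => term_deg_le k d s /\ term_deg_le k d t
  end.

Definition enc_unary (n : nat) : seq bool := nseq n true ++ [:: false].

(* binary digits of a positive, each digit prefixed by a 1, ended by 0 *)
Fixpoint enc_pos_digits (p : positive) : seq bool :=
  match p with
  | xH => [:: true; true]
  | xO q => [:: true; false] ++ enc_pos_digits q
  | xI q => [:: true; true] ++ enc_pos_digits q
  end.

Definition enc_pos (p : positive) : seq bool := enc_pos_digits p ++ [:: false].

Definition enc_Z (z : Z) : seq bool :=
  match z with
  | Z0 => [:: false; false]
  | Zpos p => [:: false; true] ++ enc_pos p
  | Zneg p => [:: true] ++ enc_pos p
  end.

Fixpoint enc_term (t : term) : seq bool :=
  match t with
  | TVar i => [:: false; false] ++ enc_unary i
  | TConst z => [:: false; true] ++ enc_Z z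
  | TAdd s u => [:: true; false] ++ enc_term s ++ enc_term u
  | TMul s u => [:: true; true] ++ enc_term s ++ enc_term u
  end.

Definition enc_tatom (a : tatom) : seq bool :=
  match a with
  | TLe s t => [:: false] ++ enc_term s ++ enc_term t
  | TLt s t => [:: true] ++ enc_term s ++ enc_term t
  end.

Fixpoint enc_list (T : Type) (e : T -> seq bool) (l : seq T) : seq bool :=
  match l with
  | [::] => [:: false]
  | x :: r => [:: true] ++ e x ++ enc_list e r
  end.

Definition enc_stdpoly (p : stdpoly) : seq bool :=
  enc_list (fun ac => enc_list enc_unary ac.1 ++ enc_Z ac.2) p.

Definition enc_satom (a : satom) : seq bool :=
  match a with
  | SLe p q => [:: false] ++ enc_stdpoly p ++ enc_stdpoly q
  | SLt p q => [:: true] ++ enc_stdpoly p ++ enc_stdpoly q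
  end.

Fixpoint enc_qf (A : Type) (e : A -> seq bool) (f : qf A) : seq bool :=
  match f with
  | QAtom a => [:: false] ++ e a
  | QAnd f1 f2 => [:: true; false] ++ enc_qf e f1 ++ enc_qf e f2
  | QOr f1 f2 => [:: true; true] ++ enc_qf e f1 ++ enc_qf e f2
  end.

Definition enc_sentence (A : Type) (e : A -> seq bool) (s : sentence A) : seq bool :=
  match s with
  | Sig2 m n phi => [:: false; false] ++ enc_unary m ++ enc_unary n ++ enc_qf e phi
  | BSig2 m n phi => [:: false; true] ++ enc_unary m ++ enc_unary n ++ enc_qf e phi
  | BSig2pp m n psi phi =>
      [:: true] ++ enc_unary m ++ enc_unary n ++ enc_qf e psi ++ enc_qf e phi
  end.

(* Polynomial-time computability: deterministic one-tape Turing        *)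
(* machines over the tape alphabet {blank, 0, 1} (option bool)         *)

Inductive move : Type := MLeft | MRight | MStay.

(* finitely many states 'I_k.+2; state 0 is initial, state 1 is halting *)
Record TM : Type := {
  tm_k : nat;
  tm_delta : 'I_tm_k.+2 -> option bool -> 'I_tm_k.+2 * option bool * move
}.

Definition tm_start (M : TM) : 'I_(tm_k M).+2 := @Ordinal (tm_k M).+2 0 isT.
Definition tm_halt (M : TM) : 'I_(tm_k M).+2 := @Ordinal (tm_k M).+2 1 isT.

(* configuration: state, tape left of the head (nearest first), scanned
   symbol, tape right of the head; all other cells are blank *)
Record config (M : TM) : Type := Config {
  c_state : 'I_(tm_k M).+2;
  c_left : seq (option bool);
  c_head : option bool;
  c_right : seq (option bool)
}.

Definition tm_step (M : TM) (c : config M) : config M :=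
  if c_state c == tm_halt M then c else
  let: (q', w, mv) := tm_delta (c_state c) (c_head c) in
  match mv with
  | MStay => Config q' (c_left c) w (c_right c)
  | MLeft => match c_left c with
             | [::] => Config q' [::] None (w :: c_right c)
             | x :: l => Config q' l x (w :: c_right c)
             end
  | MRight => match c_right c with
              | [::] => Config q' (w :: c_left c) None [::]
              | x :: r => Config q' (w :: c_left c) x r
              end
  end.

Fixpoint tm_run (M : TM) (t : nat) (c : config M) : config M :=
  match t with
  | 0 => c
  | S t' => tm_run t' (tm_step c)
  end.

Definition tm_init (M : TM) (w : seq bool) : config M :=
  match w with
  | [::] => Config (tm_start M) [::] None [::]
  | b :: w' => Config (tm_start M) [::] (Some b) (map Some w')
  end.

Fixpoint read_word (s : seq (option bool)) : seq bool :=
  match s with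
  | Some b :: r => b :: read_word r
  | _ => [::]
  end.

Definition tm_output (M : TM) (c : config M) : seq bool :=
  read_word (c_head c :: c_right c).

Definition poly_time_computable (g : seq bool -> seq bool) : Prop :=
  exists (M : TM) (c d : nat), forall w : seq bool,
    exists t : nat, (t <= c * (size w) ^ d + c)%N /\
      c_state (tm_run t (tm_init M w)) = tm_halt M /\
      tm_output (tm_run t (tm_init M w)) = g w.

(* Main.v *)
From HB Require Import structures.
Require Import Defs.
From Stdlib Require Import Reals ZArith.
From mathcomp Require Import all_boot all_algebra.
From mathcomp Require Import mpoly.
From Stdlib Require Import Lia Lra Classical FunctionalExtensionality.
From mathcomp Require Import zify ssrZ.

(** Every node [v] of every atom gets a fresh universally quantified variable
    [z_v], intended to equal [s * val v] for a universally quantified scale [s].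
    An equation defining [z_v] cannot be assumed, because its negation is a
    strict inequality; instead an atom [t <= u] of [Phi] becomes the disjunction
    of [z_t <= z_u + s^2] with closed escape clauses: an equation is off by at
    least [delta], or [|z_v| >= 1], or [s] is outside ]0, 1[, or [delta <= 0], or
    the chain [s = u_0, ..., u_L = delta] does not satisfy
    [u_(i+1) < (s / 4) * u_i].  If no clause holds, [delta] is so small that
    [|z_v - s * val v| <= delta * (4 / s)^N] is negligible against [s^2], so
    [t <= u] implies the disjunction.  Conversely exact values of the [z_v] make
    every clause false, and [val t <= val u + s] for all small [s] gives
    [t <= u].  In [Psi] the equations can be assumed exactly.  All atoms have
    degree at most two.

    The translation replaces atoms in place, so it is computed by one pass over
    the prefix encoding that keeps a stack of the variables whose defining terms
    are still to be read.  The pass is written in a small language for machines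
    with several stacks, which is simulated on one tape. *)

Set Implicit Arguments.
Unset Strict Implicit.
Unset Printing Implicit Defensive.

Import GRing.Theory.

Definition upd (T : eqType) (U : Type) (f : T -> U) (x : T) (y : U) : T -> U :=
  fun z => if z == x then y else f z.

Lemma upd_same (T : eqType) (U : Type) (f : T -> U) x y : upd f x y x = y.
Proof. by rewrite /upd eqxx. Qed.

Lemma upd_other (T : eqType) (U : Type) (f : T -> U) x y z :
  z != x -> upd f x y z = f z.
Proof. by rewrite /upd => /negbTE ->. Qed.

Lemma upd_id (T : eqType) (U : Type) (f : T -> U) x : upd f x (f x) = f.
Proof. by apply: functional_extensionality => z; rewrite /upd; case: eqP => // ->. Qed.

(** * Structured programs for one-tape machines *)

Definition cursor : Type := (int -> option bool) * int.

Definition scan (k : cursor) : option bool := k.1 k.2.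

Definition shift (mv : move) (p : int) : int :=
  match mv with MLeft => p - 1 | MRight => p + 1 | MStay => p end%R.

Definition write_move (k : cursor) (a : option bool) (mv : move) : cursor :=
  (upd k.1 k.2 a, shift mv k.2).

(* Programs return a boolean: [TIf c a b] runs [a] or [b] according to the result
   of [c], and [TLoop c] repeats [c] until it returns [false]. *)
Inductive tprog : Type :=
| TBasic of (option bool -> bool * option bool * move)
| TIf of tprog & tprog & tprog
| TLoop of tprog.

Fixpoint tstate (c : tprog) : finType :=
  match c with
  | TBasic _ => unit
  | TIf c a b => (tstate c + (tstate a + tstate b))%type
  | TLoop c => tstate c
  end.

Fixpoint tstart (c : tprog) : tstate c :=
  match c with
  | TBasic _ => tt
  | TIf c a b => inl (tstart c)
  | TLoop c => tstart c
  end.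

Definition redirect (Q Q' : Type) (h : Q + bool -> Q' + bool)
    (r : (Q + bool) * option bool * move) : (Q' + bool) * option bool * move :=
  (h r.1.1, r.1.2, r.2).

Fixpoint tdelta (c : tprog) {struct c} :
    tstate c -> option bool -> (tstate c + bool) * option bool * move :=
  match c return tstate c -> option bool -> (tstate c + bool) * option bool * move with
  | TBasic f => fun _ x => let: (b, a, mv) := f x in (inr b, a, mv)
  | TIf c a b => fun q x =>
      match q with
      | inl q => redirect (fun r => match r with
          | inl q' => inl (inl q')
          | inr true => inl (inr (inl (tstart a)))
          | inr false => inl (inr (inr (tstart b)))
          end) (@tdelta c q x)
      | inr (inl q) => redirect (fun r => match r with
          | inl q' => inl (inr (inl q'))
          | inr r => inr r
          end) (@tdelta a q x)
      | inr (inr q) => redirect (fun r => match r with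
          | inl q' => inl (inr (inr q'))
          | inr r => inr r
          end) (@tdelta b q x)
      end
  | TLoop c => fun q x => redirect (fun r => match r with
          | inl q' => inl q'
          | inr true => inl (tstart c)
          | inr false => inr true
          end) (@tdelta c q x)
  end.

(* [trun q k n b k']: started in state [q] at [k], the program stops within [n]
   steps at [k'] with result [b]. *)
Inductive trun (c : tprog) : tstate c -> cursor -> nat -> bool -> cursor -> Prop :=
| trun_exit q k n b a mv : tdelta q (scan k) = (inr b, a, mv) ->
    trun q k n.+1 b (write_move k a mv)
| trun_step q q' k a mv n b k' : tdelta q (scan k) = (inl q', a, mv) ->
    trun q' (write_move k a mv) n b k' -> trun q k n.+1 b k'.

Definition texec (c : tprog) (k : cursor) (n : nat) (b : bool) (k' : cursor) : Prop :=
  trun (tstart c) k n b k'.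

Lemma trun_le c (q : tstate c) k n n' b k' :
  trun q k n b k' -> (n <= n')%N -> trun q k n' b k'.
Proof.
move=> run; elim: run n' => {q k n b k'}
  [q k n b a mv deltaE | q q' k a mv n b k' deltaE _ IH] [|n'] // le.
- exact: trun_exit deltaE.
- exact: trun_step deltaE (IH _ le).
Qed.

Lemma texec_le c k n n' b k' : texec c k n b k' -> (n <= n')%N -> texec c k n' b k'.
Proof. exact: trun_le. Qed.

Lemma texec_basic f k b a mv : f (scan k) = (b, a, mv) ->
  texec (TBasic f) k 1 b (write_move k a mv).
Proof. by move=> deltaE; apply: trun_exit; rewrite /= deltaE. Qed.

Lemma trun_if_left c a b (q : tstate a) k n r k' :
  trun q k n r k' -> @trun (TIf c a b) (inr (inl q)) k n r k'.
Proof.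
elim=> {q k n r k'} [q k n r x mv deltaE | q q' k x mv n r k' deltaE _ IH].
- by apply: trun_exit; rewrite /= deltaE.
- by apply: trun_step IH; rewrite /= deltaE.
Qed.

Lemma trun_if_right c a b (q : tstate b) k n r k' :
  trun q k n r k' -> @trun (TIf c a b) (inr (inr q)) k n r k'.
Proof.
elim=> {q k n r k'} [q k n r x mv deltaE | q q' k x mv n r k' deltaE _ IH].
- by apply: trun_exit; rewrite /= deltaE.
- by apply: trun_step IH; rewrite /= deltaE.
Qed.

Lemma trun_if c a b (q : tstate c) k n1 r k1 n2 r' k2 :
  trun q k n1 r k1 -> texec (if r then a else b) k1 n2 r' k2 ->
  @trun (TIf c a b) (inl q) k (n1 + n2) r' k2.
Proof.
elim=> {q k n1 r k1} [q k n r x mv deltaE | q q' k x mv n r k1 deltaE _ IH] run.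
- have {}run : @trun (TIf c a b) (inr (if r then inl (tstart a) else inr (tstart b)))
      (write_move k x mv) (n + n2) r' k2.
    apply: trun_le (leq_addl _ _).
    by case: r run {deltaE} => run; [exact: trun_if_left | exact: trun_if_right].
  by apply: trun_step run; rewrite /= deltaE; case: (r).
- by apply: trun_step (IH run); rewrite /= deltaE.
Qed.

Lemma trun_loop_stop c (q : tstate c) k n r k' :
  trun q k n r k' -> r = false -> @trun (TLoop c) q k n true k'.
Proof.
elim=> {q k n r k'} [q k n r x mv deltaE | q q' k x mv n r k' deltaE _ IH] rE.
- by apply: trun_exit; rewrite /= deltaE rE.
- by apply: trun_step (IH rE); rewrite /= deltaE.
Qed.

Lemma trun_loop_again c (q : tstate c) k n1 r k1 n2 k2 :
  trun q k n1 r k1 -> r = true -> texec (TLoop c) k1 n2 true k2 ->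
  @trun (TLoop c) q k (n1 + n2) true k2.
Proof.
elim=> {q k n1 r k1} [q k n r x mv deltaE | q q' k x mv n r k1 deltaE _ IH] rE run.
- by apply: trun_step (trun_le run (leq_addl _ _)); rewrite /= deltaE rE.
- by apply: trun_step (IH rE run); rewrite /= deltaE.
Qed.

Lemma texec_if c a b k n1 r k1 n2 r' k2 :
  texec c k n1 r k1 -> texec (if r then a else b) k1 n2 r' k2 ->
  texec (TIf c a b) k (n1 + n2) r' k2.
Proof. exact: trun_if. Qed.

Lemma texec_loop_stop c k n k' : texec c k n false k' -> texec (TLoop c) k n true k'.
Proof. by move=> run; apply: trun_loop_stop run erefl. Qed.

Lemma texec_loop_again c k n1 k1 n2 k2 :
  texec c k n1 true k1 -> texec (TLoop c) k1 n2 true k2 ->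
  texec (TLoop c) k (n1 + n2) true k2.
Proof. by move=> run; apply: trun_loop_again run erefl. Qed.

Definition TSeq (a b : tprog) : tprog := TIf a b b.

Lemma texec_seq a b k n1 r k1 n2 r' k2 :
  texec a k n1 r k1 -> texec b k1 n2 r' k2 -> texec (TSeq a b) k (n1 + n2) r' k2.
Proof. by move=> run_a run_b; apply: texec_if run_a _; case: r. Qed.

Section MachineOfProgram.

Local Open Scope ring_scope.

Definition machine_state (c : tprog) (r : tstate c + bool) : 'I_(#|tstate c|).+2 :=
  match r with
  | inl q => rshift 2 (enum_rank q)
  | inr _ => @Ordinal (#|tstate c|).+2 1 isT
  end.

Definition machine (c : tprog) : TM :=
  {| tm_k := #|tstate c|;
     tm_delta := fun i x =>
       match @split 2 #|tstate c| i with
       | inl _ => (machine_state (inl (tstart c)), x, MStay)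
       | inr j => let: (r, a, mv) := tdelta (enum_val j) x in (machine_state r, a, mv)
       end |}.

Definition represents (M : TM) (cf : config M) (k : cursor) : Prop :=
  [/\ c_head cf = scan k,
      forall i : nat, nth None (c_left cf) i = k.1 (k.2 - i.+1%:Z) &
      forall i : nat, nth None (c_right cf) i = k.1 (k.2 + i.+1%:Z)].

Lemma tm_stepE (M : TM) (cf : config M) q a mv :
  c_state cf != tm_halt M -> tm_delta (c_state cf) (c_head cf) = (q, a, mv) ->
  let l := c_left cf in let r := c_right cf in
  tm_step cf = match mv with
    | MLeft => Config q (behead l) (head None l) (a :: r)
    | MRight => Config q (a :: l) (head None r) (behead r)
    | MStay => Config q l a r
    end.
Proof.
rewrite /tm_step => /negbTE -> ->.
by case: mv => //; [case: (c_left cf) | case: (c_right cf)].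
Qed.

Lemma represents_step (M : TM) (cf : config M) k q a mv :
  represents cf k -> c_state cf != tm_halt M ->
  tm_delta (c_state cf) (c_head cf) = (q, a, mv) ->
  represents (tm_step cf) (write_move k a mv) /\ c_state (tm_step cf) = q.
Proof.
case: k => T p [/= headE leftE rightE] running deltaE.
rewrite (tm_stepE running deltaE) /write_move /=.
have off (i : int) : i <> p -> upd T p a i = T i by move=> ne; rewrite upd_other //; exact/eqP.
have on (i : int) : i = p -> upd T p a i = a by move=> ->; exact: upd_same.
case: mv {deltaE} => /=; split=> //; split; rewrite /represents /scan /=.
- by rewrite -nth0 leftE off //; lia.
- by move=> i; rewrite nth_behead leftE off; [congr T; lia | lia].
- by case=> [|i] /=; [rewrite on //; lia | rewrite rightE off; [congr T; lia | lia]].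
- by rewrite -nth0 rightE off //; lia.
- by case=> [|i] /=; [rewrite on //; lia | rewrite leftE off; [congr T; lia | lia]].
- by move=> i; rewrite nth_behead rightE off; [congr T; lia | lia].
- by rewrite on.
- by move=> i; rewrite leftE off //; lia.
- by move=> i; rewrite rightE off //; lia.
Qed.

Lemma tm_run_halted (M : TM) n (cf : config M) : c_state cf = tm_halt M -> tm_run n cf = cf.
Proof. by elim: n => //= n IH halted; rewrite /tm_step halted eqxx IH. Qed.

Lemma machine_trun c (q : tstate c) k n b k' (cf : config (machine c)) :
  trun q k n b k' -> represents cf k -> c_state cf = machine_state (inl q) ->
  represents (tm_run n cf) k' /\ c_state (tm_run n cf) = tm_halt (machine c).
Proof.
move=> run; elim: run cf => {q k n b k'}
  [q k n b a mv qE | q q' k a mv n b k' qE _ IH] cf rep stateE.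
all: have running : c_state cf != tm_halt (machine c) by rewrite stateE.
- have deltaE : tm_delta (c_state cf) (c_head cf) = (tm_halt (machine c), a, mv).
    by case: rep => -> _ _; rewrite stateE /= (unsplitK (inr _)) enum_rankK qE.
  have [rep' stateE'] := represents_step rep running deltaE.
  by rewrite /= tm_run_halted.
- have deltaE : tm_delta (c_state cf) (c_head cf) = (machine_state (inl q'), a, mv).
    by case: rep => -> _ _; rewrite stateE /= (unsplitK (inr _)) enum_rankK qE.
  have [rep' stateE'] := represents_step rep running deltaE.
  exact: IH.
Qed.

Definition input_tape (w : seq bool) : int -> option bool :=
  fun i => if i is Posz n.+1 then nth None (map Some w) n else None.

Lemma machine_texec c w n b k :
  texec c (input_tape w, 1) n b k ->
  let cf := tm_run n.+1 (tm_init (machine c) w) in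
  represents cf k /\ c_state cf = tm_halt (machine c).
Proof.
move=> run; set cf0 := tm_init _ w.
have rep : represents cf0 (input_tape w, 1).
  have left0 (i : nat) : input_tape w (1 - i.+1%:Z) = None.
    have -> : 1 - i.+1%:Z = - i%:Z by lia.
    by case: i.
  have rightS (i : nat) : input_tape w (1 + i.+1%:Z) = nth None (map Some w) i.+1 by [].
  by rewrite /cf0; case: w left0 rightS {run cf0} => [|x w] left0 rightS; split=> // i;
    rewrite /= ?left0 ?rightS ?nth_nil.
have stateE : c_state cf0 = tm_start (machine c) by rewrite /cf0; case: (w).
have deltaE : tm_delta (c_state cf0) (c_head cf0)
    = (machine_state (inl (tstart c)), c_head cf0, MStay).
  by rewrite stateE /=; case: splitP => // j.
have running : c_state cf0 != tm_halt (machine c) by rewrite stateE.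
have [rep1 stateE1] := represents_step rep running deltaE.
rewrite /=; apply: machine_trun run _ stateE1.
by case: rep rep1 => -> _ _; rewrite /write_move /scan /= upd_id.
Qed.

Lemma tm_output_represents (M : TM) (cf : config M) k w :
  represents cf k ->
  (forall i, (i <= size w)%N -> k.1 (k.2 + i%:Z) = nth None (map Some w) i) ->
  tm_output cf = w.
Proof.
rewrite /tm_output; case=> headE _ rightE cells.
have {headE rightE cells} : forall i, (i <= size w)%N ->
    nth None (c_head cf :: c_right cf) i = nth None (map Some w) i.
  case=> [|i] le_i /=; first by rewrite headE -(cells 0%N) // addr0.
  by rewrite rightE cells.
elim: w (c_head cf :: c_right cf) => [|b w IH] [|[b'|] s] cells //=.
- by have := cells 0%N isT.
- by have := cells 0%N isT.
- by have [->] := cells 0%N isT; congr (_ :: _); apply: IH => i le_i; exact: (cells i.+1).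
- by have := cells 0%N isT.
Qed.

End MachineOfProgram.

(** * Polynomially bounded running times *)

Definition poly_bounded (t : nat -> nat) : Prop :=
  exists k d, forall n, t n <= k * n.+1 ^ d.

Lemma poly_bounded_le t u : poly_bounded u -> (forall n, t n <= u n) -> poly_bounded t.
Proof. by move=> [k [d u_le]] tu; exists k, d => n; apply: leq_trans (tu n) _. Qed.

Lemma poly_bounded_const c : poly_bounded (fun _ => c).
Proof. by exists c, 0 => n; rewrite muln1. Qed.

Lemma poly_bounded_id : poly_bounded id.
Proof. by exists 1, 1 => n; rewrite mul1n expn1. Qed.

Lemma poly_boundedD t u :
  poly_bounded t -> poly_bounded u -> poly_bounded (fun n => t n + u n).
Proof.
move=> [k [d t_le]] [l [e u_le]]; exists (k + l), (maxn d e) => n; rewrite mulnDl.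
by apply: leq_add; [apply: leq_trans (t_le n) _ | apply: leq_trans (u_le n) _];
  rewrite leq_mul2l leq_pexp2l ?leq_maxl ?leq_maxr ?orbT.
Qed.

Lemma poly_boundedM t u :
  poly_bounded t -> poly_bounded u -> poly_bounded (fun n => t n * u n).
Proof.
move=> [k [d t_le]] [l [e u_le]]; exists (k * l), (d + e) => n.
by rewrite expnD mulnACA; apply: leq_mul.
Qed.

Lemma poly_bounded_comp t u :
  poly_bounded t -> poly_bounded u -> poly_bounded (fun n => t (u n)).
Proof.
move=> [k [d t_le]] [l [e u_le]]; exists (k * l.+1 ^ d), (e * d) => n.
rewrite -mulnA expnM -expnMn; apply: leq_trans (t_le _) _; rewrite leq_mul2l.
case: d {t_le} => [|d]; first by rewrite leqnn orbT.
rewrite leq_exp2r // mulSn -add1n leq_add ?expn_gt0 ?orbT //.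
Qed.

Ltac prove_poly_bounded :=
  repeat first
    [ assumption | exact: poly_bounded_const | exact: poly_bounded_id
    | apply: poly_boundedD | apply: poly_boundedM ].

(** * Stacks on a tape *)

Definition memory (I : Type) : Type := I -> seq bool.

Definition tret (b : bool) : tprog := TBasic (fun x => (b, x, MStay)).

Definition twrite (a : option bool) : tprog := TBasic (fun _ => (true, a, MStay)).

Definition tnonblank : tprog := TBasic (fun x => (isSome x, x, MStay)).

Fixpoint tgo (mv : move) (n : nat) : tprog :=
  match n with
  | 0 => tret true
  | n'.+1 => TSeq (TBasic (fun x => (true, x, mv))) (tgo mv n')
  end.

Lemma texec_test (test : option bool -> bool) mv (T : int -> option bool) p :
  texec (TBasic (fun x => (test x, x, mv))) (T, p) 1 (test (T p)) (T, shift mv p).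
Proof. by rewrite -{3}(upd_id T p); exact: (@texec_basic _ (T, p) _ (T p) mv). Qed.

Lemma texec_ret b k : texec (tret b) k 1 b k.
Proof. by case: k => T p; exact: (texec_test (fun=> b) MStay). Qed.

Lemma texec_write a (T : int -> option bool) p :
  texec (twrite a) (T, p) 1 true (upd T p a, p).
Proof. exact: (@texec_basic _ (T, p) true a MStay). Qed.

Lemma texec_nonblank (T : int -> option bool) p :
  texec tnonblank (T, p) 1 (isSome (T p)) (T, p).
Proof. exact: (texec_test isSome MStay). Qed.

Lemma texec_go mv n (T : int -> option bool) p :
  texec (tgo mv n) (T, p) n.+1 true (T, iter n (shift mv) p).
Proof.
elim: n p => [|n IH] p; first exact: texec_ret.
rewrite iterSr -[n.+2]add1n; exact: texec_seq (texec_test xpredT mv T p) (IH _).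
Qed.

Lemma iter_shift_left n p : iter n (shift MLeft) p = (p - n%:Z)%R.
Proof. by elim: n => [|n IH]; [rewrite subr0 | rewrite iterS IH /=; lia]. Qed.

Lemma iter_shift_right n p : iter n (shift MRight) p = (p + n%:Z)%R.
Proof. by elim: n => [|n IH]; [rewrite addr0 | rewrite iterS IH /=; lia]. Qed.

Module Stack.

Section Stacks.

Variables (I : finType) (out : I).

Implicit Types (i j : I) (m : memory I) (T : int -> option bool).

(* Stack [out] occupies the cells 1, 2, ... to the right of the home cell 0; the
   other stacks are interleaved to the left of it, with period [#|I|]. Cell 0 of
   every stack is blank, so that walking down a stack stops there. *)
Definition offset j : nat := if j == out then 0 else (enum_rank j).+1.

Definition cell j (e : nat) : int :=
  (if j == out then e%:Z else - (offset j + #|I| * e)%N%:Z)%R.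

Definition column (s : seq bool) : seq (option bool) := None :: map Some (rev s).

Definition stores m T : Prop := forall j e, T (cell j e) = nth None (column (m j)) e.

Definition stride_out j : tprog := if j == out then tgo MRight 1 else tgo MLeft #|I|.
Definition stride_in j : tprog := if j == out then tgo MLeft 1 else tgo MRight #|I|.
Definition seek_top j : tprog := TLoop (TSeq (stride_out j) tnonblank).
Definition go_home j : tprog :=
  TSeq (TLoop (TSeq (stride_in j) tnonblank)) (tgo MRight (offset j)).
Definition return_home j (b : bool) : tprog := TSeq (go_home j) (tret b).

Definition push j (b : bool) : tprog :=
  TSeq (tgo MLeft (offset j))
    (TSeq (seek_top j) (TSeq (twrite (Some b)) (return_home j true))).

(* On an empty stack, [pop] returns [false] and changes nothing. *)
Definition pop j : tprog :=
  TSeq (tgo MLeft (offset j)) (TSeq (stride_out j)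
    (TIf tnonblank
      (TSeq (seek_top j) (TSeq (stride_in j)
        (TIf (TBasic (fun x => (x == Some true, None, MStay)))
          (return_home j true) (return_home j false))))
      (return_home j false))).

Definition nonempty j : tprog :=
  TSeq (tgo MLeft (offset j)) (TSeq (stride_out j)
    (TIf tnonblank (return_home j true) (return_home j false))).

Lemma offset_le j : (offset j <= #|I|)%N.
Proof. by rewrite /offset; case: ifP => // _; exact: ltn_ord. Qed.

Lemma cell0 j : cell j 0 = (- (offset j)%:Z)%R.
Proof. by rewrite /cell /offset; case: (j == out) => //; lia. Qed.

Lemma cell_inj j e j' e' : cell j e = cell j' e' -> j = j' /\ e = e'.
Proof.
have lt_rank i : (enum_rank i < #|I|)%N by exact: ltn_ord.
have [lt_j lt_j'] := (lt_rank j, lt_rank j').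
rewrite /cell /offset; case: eqP => [->|_]; case: eqP => [->|_]; try lia.
  by case.
move=> eq_cell; have eq_rank : enum_rank j = enum_rank j'.
  have eq_sum : (enum_rank j + #|I| * e = enum_rank j' + #|I| * e')%N by lia.
  apply: val_inj => /=.
  by rewrite -(modn_small lt_j) -(modn_small lt_j') -(modnMDl e) -(modnMDl e' (enum_rank j'));
     congr modn; lia.
by split; [exact: enum_rank_inj | move: eq_cell; rewrite eq_rank; nia].
Qed.

Lemma texec_home_cell0 j T :
  texec (tgo MLeft (offset j)) (T, 0%R) #|I|.+1 true (T, cell j 0).
Proof.
have -> : cell j 0 = iter (offset j) (shift MLeft) 0%R by rewrite cell0 iter_shift_left sub0r.
by apply: texec_le (texec_go _ _ _ _) _; exact: offset_le.
Qed.

Lemma texec_cell0_home j T :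
  texec (tgo MRight (offset j)) (T, cell j 0) #|I|.+1 true (T, 0%R).
Proof.
have -> : 0%R = iter (offset j) (shift MRight) (cell j 0).
  by rewrite iter_shift_right cell0 addNr.
by apply: texec_le (texec_go _ _ _ _) _; exact: offset_le.
Qed.

Lemma texec_stride_out j e T :
  texec (stride_out j) (T, cell j e) #|I|.+2 true (T, cell j e.+1).
Proof.
have -> : cell j e.+1 = if j == out then iter 1 (shift MRight) (cell j e)
                        else iter #|I| (shift MLeft) (cell j e).
  by rewrite iter_shift_left iter_shift_right /cell; case: ifP => _; lia.
by rewrite /stride_out; case: ifP => _; apply: texec_le (texec_go _ _ _ _) _.
Qed.

Lemma texec_stride_in j e T :
  texec (stride_in j) (T, cell j e.+1) #|I|.+2 true (T, cell j e).
Proof.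
have -> : cell j e = if j == out then iter 1 (shift MLeft) (cell j e.+1)
                     else iter #|I| (shift MRight) (cell j e.+1).
  by rewrite iter_shift_left iter_shift_right /cell; case: ifP => _; lia.
by rewrite /stride_in; case: ifP => _; apply: texec_le (texec_go _ _ _ _) _.
Qed.

Lemma texec_seek_top j T e d :
  (forall x, (x < d)%N -> T (cell j (e + x).+1)) -> T (cell j (e + d).+1) = None ->
  texec (seek_top j) (T, cell j e) (d.+1 * #|I|.+3) true (T, cell j (e + d).+1).
Proof.
have step x : texec (TSeq (stride_out j) tnonblank) (T, cell j x) #|I|.+3
    (isSome (T (cell j x.+1))) (T, cell j x.+1).
  rewrite -[X in texec _ _ X]addn1.
  exact: texec_seq (texec_stride_out _ _ _) (texec_nonblank _ _).
elim: d e => [|d IH] e nonblank blank; have := step e.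
- by rewrite addn0 mul1n in blank * => run; rewrite blank in run; exact: texec_loop_stop.
- have := nonblank 0%N isT; rewrite addn0 mulSn -addSnnS => -> run.
  apply: texec_loop_again run (IH e.+1 _ _); last by rewrite addSnnS.
  by move=> x lt_xd; rewrite addSnnS; apply: nonblank; lia.
Qed.

Lemma texec_go_home j T e :
  (forall x, (x < e)%N -> T (cell j x.+1)) -> T (cell j 0) = None ->
  texec (go_home j) (T, cell j e.+1) (e.+2 * #|I|.+3) true (T, 0%R).
Proof.
move=> nonblank blank; apply: (@texec_le _ _ (e.+1 * #|I|.+3 + #|I|.+1)); last nia.
apply: texec_seq (texec_cell0_home _ _).
have step x : texec (TSeq (stride_in j) tnonblank) (T, cell j x.+1) #|I|.+3
    (isSome (T (cell j x))) (T, cell j x).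
  rewrite -[X in texec _ _ X]addn1.
  exact: texec_seq (texec_stride_in _ _ _) (texec_nonblank _ _).
elim: e nonblank => [|e IH] nonblank.
- by have := step 0; rewrite blank mul1n; exact: texec_loop_stop.
- have := step e.+1; rewrite nonblank // mulSn => run.
  by apply: texec_loop_again run (IH _) => x lt_xe; apply: nonblank; lia.
Qed.

Lemma texec_return_home j T e b :
  (forall x, (x < e)%N -> T (cell j x.+1)) -> T (cell j 0) = None ->
  texec (return_home j b) (T, cell j e.+1) (e.+3 * #|I|.+3) b (T, 0%R).
Proof.
move=> nonblank blank; apply: (@texec_le _ _ (e.+2 * #|I|.+3 + 1)); last nia.
exact: texec_seq (texec_go_home nonblank blank) (texec_ret _ _).
Qed.

Lemma stores_nonblank m T j e : stores m T -> (e < size (m j))%N -> T (cell j e.+1).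
Proof. by move=> mT lt_e; rewrite mT /= (nth_map false) ?size_rev. Qed.

Lemma stores_blank m T j e : stores m T -> (size (m j) < e)%N -> T (cell j e) = None.
Proof. by move=> mT lt_e; rewrite mT nth_default //= size_map size_rev. Qed.

Lemma stores_top m T j b s : stores m T -> m j = b :: s -> T (cell j (size s).+1) = Some b.
Proof.
by move=> -> -> /=; rewrite rev_cons map_rcons nth_rcons size_map size_rev ltnn eqxx.
Qed.

Lemma nth_column_cons b s e :
  e != (size s).+1 -> nth None (column (b :: s)) e = nth None (column s) e.
Proof.
case: e => // e; rewrite eqSS /= rev_cons map_rcons nth_rcons size_map size_rev.
by case: ltngtP => // gt _; rewrite nth_default // size_map size_rev ltnW.
Qed.

Lemma stores_upd m T j s e a : stores m T ->
  (forall x, nth None (column s) x = if x == e then a else nth None (column (m j)) x) ->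
  stores (upd m j s) (upd T (cell j e) a).
Proof.
move=> mT col i x; rewrite /upd; case: (eqVneq i j) => [->|ne_ij].
- rewrite col; case: (eqVneq x e) => [->|ne_xe]; first by rewrite eqxx.
  by rewrite mT; case: eqP => // /cell_inj [_ eq_xe]; rewrite eq_xe eqxx in ne_xe.
- by rewrite mT; case: eqP => // /cell_inj [eq_ij _]; rewrite eq_ij eqxx in ne_ij.
Qed.

Lemma stores_push m T j b : stores m T ->
  stores (upd m j (b :: m j)) (upd T (cell j (size (m j)).+1) (Some b)).
Proof.
move=> mT; apply: stores_upd mT _ => x; case: eqP => [->|/eqP ne_x].
- by rewrite /= rev_cons map_rcons nth_rcons size_map size_rev ltnn eqxx.
- exact: nth_column_cons.
Qed.

Lemma stores_pop m T j b s : stores m T -> m j = b :: s ->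
  stores (upd m j s) (upd T (cell j (size s).+1) None).
Proof.
move=> mT mj; apply: stores_upd mT _ => x; case: eqP => [->|/eqP ne_x].
- by rewrite nth_default //= size_map size_rev.
- by rewrite mj nth_column_cons.
Qed.

Definition height m : nat := \max_j size (m j).

Lemma size_le_height m j : (size (m j) <= height m)%N.
Proof. exact: leq_bigmax. Qed.

Lemma height_upd m j s n : (size s <= height m + n)%N -> (height (upd m j s) <= height m + n)%N.
Proof.
move=> le_s; apply/bigmax_leqP => i _; rewrite /upd; case: ifP => // _.
exact: leq_trans (size_le_height m i) (leq_addr _ _).
Qed.

Definition step_cost (h : nat) : nat := ((2 * h + 9) * #|I|.+3)%N.

Lemma step_cost_le h h' : (h <= h')%N -> (step_cost h <= step_cost h')%N.
Proof. by move=> le_h; rewrite leq_mul2r leq_add2r leq_mul2l le_h orbT. Qed.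

(* [runs c m n b m']: from memory [m], the program stops with memory [m'] and
   result [b] after [n] stack operations, each of which pushes at most one bit and
   takes at most [step_cost (height m + n)] tape steps. *)
Definition runs (c : tprog) m (n : nat) (b : bool) (m' : memory I) : Prop :=
  (height m' <= height m + n)%N /\
  forall T, stores m T -> exists2 T',
    texec c (T, 0%R) (n * step_cost (height m + n)) b (T', 0%R) & stores m' T'.

Lemma runs_le c m n n' b m' : runs c m n b m' -> (n <= n')%N -> runs c m n' b m'.
Proof.
move=> [height_le run] le_n; split=> [|T /run [T' ex mT']].
  by apply: leq_trans height_le _; lia.
exists T' => //; apply: texec_le ex _; apply: leq_mul => //.
by apply: step_cost_le; lia.
Qed.

Lemma runs_ret b m : runs (tret b) m 1 b m.
Proof.
split=> [|T mT]; first exact: leq_addr.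
by exists T => //; apply: texec_le (texec_ret _ _) _; rewrite /step_cost; nia.
Qed.

Lemma runs_nonempty j m : runs (nonempty j) m 1 (m j != [::]) m.
Proof.
split=> [|T mT]; first exact: leq_addr.
exists T => //; apply: (@texec_le _ _ (#|I|.+1 + (#|I|.+2 + (1 + 3 * #|I|.+3)))).
  apply: texec_seq (texec_home_cell0 _ _) _; apply: texec_seq (texec_stride_out _ _ _) _.
  apply: texec_if (texec_nonblank _ _) _.
  have -> : isSome (T (cell j 1)) = (m j != [::]).
    case contentE: (m j) => [|x s]; first by rewrite (stores_blank mT) // contentE.
    by apply: stores_nonblank mT _; rewrite contentE.
  by case: (m j != [::]); apply: texec_return_home; rewrite // mT.
by rewrite /step_cost; nia.
Qed.

Lemma runs_push j b m : runs (push j b) m 1 true (upd m j (b :: m j)).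
Proof.
split=> [|T mT]; first by apply: height_upd; rewrite /= addn1 ltnS size_le_height.
have mT' := stores_push j b mT; eexists; last exact: mT'.
have lt_h := size_le_height m j; set e := size (m j) in lt_h mT' *.
apply: (@texec_le _ _ (#|I|.+1 + (e.+1 * #|I|.+3 + (1 + e.+3 * #|I|.+3)))).
  apply: texec_seq (texec_home_cell0 _ _) _.
  have seek := @texec_seek_top j T 0 e (fun x => stores_nonblank mT).
  apply: texec_seq (seek _) _; first by apply: stores_blank mT _.
  apply: texec_seq (texec_write _ _ _) _; apply: texec_return_home.
  - by move=> x lt_x; apply: stores_nonblank mT' _; rewrite upd_same /= ltnS ltnW.
  - by rewrite mT'.
by rewrite /step_cost; nia.
Qed.

Lemma runs_pop j m : runs (pop j) m 1 (head false (m j)) (upd m j (behead (m j))).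
Proof.
split=> [|T mT].
  by apply: height_upd; rewrite size_behead; have := size_le_height m j; lia.
case contentE: (m j) => [|x s] /=; last first.
  have mT' := stores_pop mT contentE; exists (upd T (cell j (size s).+1) None) => //.
  have lt_h := size_le_height m j; rewrite contentE /= in lt_h.
  apply: (@texec_le _ _ (#|I|.+1 + (#|I|.+2 + (1 + ((size s).+1 * #|I|.+3 +
    (#|I|.+2 + (1 + (size s).+3 * #|I|.+3))))))); last by rewrite /step_cost; nia.
  apply: texec_seq (texec_home_cell0 _ _) _; apply: texec_seq (texec_stride_out _ _ _) _.
  apply: texec_if (texec_nonblank _ _) _; rewrite (stores_nonblank mT) ?contentE //.
  have seek := @texec_seek_top j T 1 (size s); rewrite add1n in seek.
  apply: texec_seq (seek _ _) _.
  - by move=> y lt_y; apply: stores_nonblank mT _; rewrite contentE.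
  - by apply: stores_blank mT _; rewrite contentE.
  apply: texec_seq (texec_stride_in _ _ _) _; apply: texec_if (texec_basic _) _ => //=.
  rewrite (stores_top mT contentE) /write_move /=.
  have home b : texec (return_home j b) (upd T (cell j (size s).+1) None, cell j (size s).+1)
      ((size s).+3 * #|I|.+3) b (upd T (cell j (size s).+1) None, 0%R).
    apply: texec_return_home; last by rewrite mT'.
    by move=> y lt_y; apply: stores_nonblank mT' _; rewrite upd_same.
  by case: (x); exact: home.
have -> : upd m j [::] = m by rewrite -{2}(upd_id m j) contentE.
exists T => //; apply: (@texec_le _ _ (#|I|.+1 + (#|I|.+2 + (1 + 3 * #|I|.+3)))).
  apply: texec_seq (texec_home_cell0 _ _) _; apply: texec_seq (texec_stride_out _ _ _) _.
  apply: texec_if (texec_nonblank _ _) _; rewrite (stores_blank mT) ?contentE //.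
  by apply: texec_return_home; rewrite // mT.
by rewrite /step_cost; nia.
Qed.

Lemma runs_if c a b m n r m1 n1 r1 m2 :
  runs c m n r m1 -> runs (if r then a else b) m1 n1 r1 m2 ->
  runs (TIf c a b) m (n + n1) r1 m2.
Proof.
move=> [height1 run1] [height2 run2]; split=> [|T /run1 [T1 ex1 /run2 [T2 ex2 mT2]]]; first lia.
exists T2 => //; apply: texec_le (texec_if ex1 ex2) _; rewrite mulnDl leq_add //.
  by rewrite leq_mul2l step_cost_le ?orbT //; lia.
by rewrite leq_mul2l step_cost_le ?orbT //; lia.
Qed.

Lemma runs_seq a b m n r m1 n1 r1 m2 :
  runs a m n r m1 -> runs b m1 n1 r1 m2 -> runs (TSeq a b) m (n + n1) r1 m2.
Proof. by move=> run_a run_b; apply: runs_if run_a _; case: r. Qed.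

Lemma runs_loop_stop c m n m' : runs c m n false m' -> runs (TLoop c) m n true m'.
Proof.
move=> [height_le run]; split=> // T /run [T' ex mT'].
by exists T' => //; exact: texec_loop_stop.
Qed.

Lemma runs_loop_again c m n m1 n1 m2 :
  runs c m n true m1 -> runs (TLoop c) m1 n1 true m2 ->
  runs (TLoop c) m (n + n1) true m2.
Proof.
move=> [height1 run1] [height2 run2]; split=> [|T /run1 [T1 ex1 /run2 [T2 ex2 mT2]]]; first lia.
exists T2 => //; apply: texec_le (texec_loop_again ex1 ex2) _; rewrite mulnDl leq_add //.
  by rewrite leq_mul2l step_cost_le ?orbT //; lia.
by rewrite leq_mul2l step_cost_le ?orbT //; lia.
Qed.

Lemma runs_loop c (M : nat -> memory I) n t m' :
  (forall k, (k < n)%N -> runs c (M k) t true (M k.+1)) -> runs c (M n) t false m' ->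
  runs (TLoop c) (M 0) (n.+1 * t) true m'.
Proof.
elim: n M => [|n IH] M again stop; first by rewrite mul1n; exact: runs_loop_stop.
rewrite mulSn; apply: runs_loop_again (again 0 isT) (IH (fun k => M k.+1) _ stop) => k.
exact: (again k.+1).
Qed.

Definition while_nonempty j (c : tprog) : tprog :=
  TLoop (TIf (nonempty j) (TSeq c (tret true)) (tret false)).

Lemma runs_while_nonempty j c (M : nat -> memory I) n t :
  (forall k, (k < n)%N -> M k j != [::] /\ exists b, runs c (M k) t b (M k.+1)) ->
  M n j = [::] -> runs (while_nonempty j c) (M 0) (n.+1 * t.+2) true (M n).
Proof.
move=> body stop; apply: runs_loop => [k /body [ne [b run]]|].
  apply: (@runs_le _ _ (1 + (t + 1))); last by rewrite addn1.
  by apply: runs_if (runs_nonempty _ _) _; rewrite ne; apply: runs_seq run (runs_ret _ _).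
apply: (@runs_le _ _ (1 + 1)) => //; apply: runs_if (runs_nonempty _ _) _.
by rewrite stop; exact: runs_ret.
Qed.

Lemma runs_eq c m n b m1 m2 : runs c m n b m1 -> m1 =1 m2 -> runs c m n b m2.
Proof. by move=> run /functional_extensionality <-. Qed.

Definition push_seq j (bs : seq bool) : tprog :=
  foldr (fun b c => TSeq (push j b) c) (tret true) bs.

Lemma runs_push_seq j bs m : runs (push_seq j bs) m (size bs).+1 true (upd m j (rev bs ++ m j)).
Proof.
elim: bs m => [|b bs IH] m; first by rewrite upd_id; exact: runs_ret.
rewrite -[(size _).+1]add1n; apply: runs_eq (runs_seq (runs_push _ _ _) (IH _)) _ => i.
by rewrite /upd eqxx rev_cons cat_rcons; case: eqP.
Qed.

Definition push_all (ds : seq I) (b : bool) : tprog :=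
  foldr (fun d c => TSeq (push d b) c) (tret true) ds.

Definition pushed (ds : seq I) (s : seq bool) m : memory I :=
  fun j => if j \in ds then s ++ m j else m j.

Lemma runs_push_all ds b m : uniq ds ->
  runs (push_all ds b) m (size ds).+1 true (pushed ds [:: b] m).
Proof.
elim: ds m => [|d ds IH] m; first by move=> _; exact: runs_ret.
move=> /andP [notin /IH {}IH]; rewrite -[(size _).+1]add1n.
apply: runs_eq (runs_seq (runs_push _ _ _) (IH _)) _ => j.
by rewrite /pushed inE /upd; case: eqP => [->|] //=; rewrite (negbTE notin).
Qed.

Definition drain j (ds : seq I) : tprog :=
  while_nonempty j (TIf (pop j) (push_all ds true) (push_all ds false)).

Lemma runs_drain j ds m : uniq ds -> j \notin ds ->
  runs (drain j ds) m ((size (m j)).+1 * (size ds + 4)) true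
    (pushed ds (rev (m j)) (upd m j [::])).
Proof.
move=> uds notin; set s := m j.
pose M k := pushed ds (rev (take k s)) (upd m j (drop k s)).
have Mj k : M k j = drop k s by rewrite /M /pushed (negbTE notin) upd_same.
have M0 : M 0 = m.
  apply: functional_extensionality => i; rewrite /M /pushed /upd take0 drop0.
  by case: ifP => _; case: eqP => // ->.
have Msize : M (size s) = pushed ds (rev s) (upd m j [::]) by rewrite /M take_size drop_size.
rewrite -Msize -{1}M0; have -> : (size ds + 4 = (size ds).+2.+2)%N by rewrite addnC.
apply: runs_while_nonempty => [k lt_k|]; last by rewrite Mj drop_size.
rewrite Mj (drop_nth false lt_k); split=> //; exists true.
rewrite -[(size ds).+2]add1n; apply: runs_if (runs_pop _ _) _.
rewrite Mj (drop_nth false lt_k) /=.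
have push_bit b : runs (push_all ds b) (upd (M k) j (drop k.+1 s)) (size ds).+1 true
    (pushed ds [:: b] (upd (M k) j (drop k.+1 s))) by exact: runs_push_all.
have -> : (if nth false s k then push_all ds true else push_all ds false)
        = push_all ds (nth false s k) by case: nth.
apply: runs_eq (push_bit _) _ => i.
rewrite /M /pushed /upd (take_nth false lt_k) rev_rcons.
case: (eqVneq i j) => [->|_]; first by rewrite (negbTE notin).
by case: (i \in ds).
Qed.

Definition clear j : tprog := drain j [::].

Lemma runs_clear j m : runs (clear j) m ((size (m j)).+1 * 4) true (upd m j [::]).
Proof. exact: (@runs_drain j [::] m). Qed.

Definition copy j tmp (ds : seq I) : tprog := TSeq (drain j [:: tmp]) (drain tmp (j :: ds)).

Lemma runs_copy j tmp ds m : uniq [:: tmp, j & ds] -> m tmp = [::] ->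
  runs (copy j tmp ds) m ((size (m j)).+1 * (size ds + 10)) true (pushed ds (m j) m).
Proof.
rewrite /= inE negb_or => /and3P [/andP [ne_tj tmp_notin] j_notin uds] empty.
have ne_jt : j != tmp by rewrite eq_sym.
have := @runs_drain j [:: tmp] m isT; rewrite inE => /(_ ne_jt).
set m1 := pushed _ _ _ => run1.
have m1t : m1 tmp = rev (m j) by rewrite /m1 /pushed inE eqxx upd_other // empty cats0.
have := @runs_drain tmp (j :: ds) m1; rewrite /= j_notin uds inE negb_or ne_tj tmp_notin m1t revK.
move=> /(_ isT isT) run2; apply: runs_le (runs_eq (runs_seq run1 run2) _) _; last first.
  by rewrite size_rev /=; nia.
move=> i; rewrite /pushed inE /upd.
case: (eqVneq i tmp) => [->|ne_it]; first by rewrite (negbTE ne_tj) (negbTE tmp_notin).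
rewrite /m1 /pushed inE (negbTE ne_it) /upd.
by case: (eqVneq i j) => [->|] //=; rewrite (negbTE j_notin) cats0.
Qed.

Definition read_unary j dst : tprog := TLoop (TIf (pop j) (push dst true) (tret false)).

Lemma runs_read_unary j dst m : j != dst ->
  let n := index false (m j) in
  runs (read_unary j dst) m (2 * (size (m j)).+1) true
    (upd (upd m j (drop n.+1 (m j))) dst (nseq n true ++ m dst)).
Proof.
move=> ne_jd n; set s := m j; have ne_dj : dst != j by rewrite eq_sym.
have le_n : (n <= size s)%N by exact: index_size.
pose M k := upd (upd m j (drop k s)) dst (nseq k true ++ m dst).
have Mj k : M k j = drop k s by rewrite /M upd_other ?upd_same.
have M0 : M 0 = m by rewrite /M drop0 !upd_id.
have pop_bit k : runs (pop j) (M k) 1 (nth false s k) (upd (M k) j (drop k.+1 s)).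
  by have := runs_pop j (M k); rewrite Mj -nth0 nth_drop addn0 -drop1 drop_drop add1n.
rewrite -{1}M0; apply: (@runs_le _ _ (n.+1 * 2)); first last.
  by rewrite mulnC leq_mul2l ltnS.
apply: runs_loop => [k lt_kn|].
- have bit : nth false s k by have := before_find false lt_kn; rewrite /= eqbF_neg => /negbFE.
  apply: (@runs_le _ _ (1 + 1)) => //; apply: runs_if (pop_bit _) _; rewrite bit.
  apply: runs_eq (runs_push _ _ _) _ => i; rewrite /M /upd.
  by case: (eqVneq i dst) => [_|_]; [rewrite (negbTE ne_dj) eqxx | case: eqP].
- have bit : nth false s n = false.
    case: (ltnP n (size s)) => n_s; last by rewrite nth_default.
    by apply/eqP; rewrite nth_index // -index_mem.
  apply: (@runs_le _ _ (1 + 1)) => //; apply: runs_if (pop_bit _) _; rewrite bit.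
  apply: runs_eq (runs_ret _ _) _ => i; rewrite /M /upd.
  by case: (eqVneq i j) => [->|] //; rewrite (negbTE ne_jd).
Qed.

Definition input_memory (w : seq bool) : memory I := fun j => if j == out then rev w else [::].

Lemma stores_input w : stores (input_memory w) (input_tape w).
Proof.
move=> j e; rewrite /column /input_memory /cell /offset; case: (j == out).
  by rewrite revK; case: e.
have -> : input_tape w (- ((enum_rank j).+1 + #|I| * e)%N%:Z)%R = None by rewrite addSn.
by case: e => // e; rewrite /= nth_nil.
Qed.

Lemma height_input w : (height (input_memory w) <= size w)%N.
Proof. by apply/bigmax_leqP => j _; rewrite /input_memory; case: ifP; rewrite ?size_rev. Qed.

Lemma poly_bounded_monomial t : poly_bounded t ->
  exists c d, forall n, (t n <= c * n ^ d + c)%N.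
Proof.
move=> [k [d t_le]]; exists (k * 2 ^ d)%N, d => n; apply: leq_trans (t_le n) _.
case: n => [|n]; first by rewrite exp1n; have := expn_gt0 2 d; nia.
rewrite -mulnA -expnMn; apply: leq_trans (leq_addr _ _); rewrite leq_mul2l.
by case: d {t_le} => [|d]; rewrite ?orbT // leq_exp2r ?orbT //; apply/orP; right; lia.
Qed.

Theorem stack_program_poly_time c (t : nat -> nat) (g : seq bool -> seq bool) :
  poly_bounded t ->
  (forall w, exists b m, runs c (input_memory w) (t (size w)) b m /\ rev (m out) = g w) ->
  poly_time_computable g.
Proof.
move=> pt run; pose prog := TSeq (tgo MLeft 1) (TSeq c (tgo MRight 1)).
have [k [d bound]] : exists k d, forall n,
    ((2 + (t n * step_cost (n + t n) + 2)).+1 <= k * n ^ d + k)%N.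
  apply: (poly_bounded_monomial (t := fun n => (2 + (t n * step_cost (n + t n) + 2)).+1)).
  by apply: poly_bounded_le (fun n => leqnn (1 + _)); rewrite /step_cost; prove_poly_bounded.
exists (machine prog), k, d => w; have [b [m [[_ exec] <-]]] := run w.
have [T ex mT] := exec _ (stores_input w).
have {}ex : texec prog (input_tape w, 1%R) (2 + (t (size w) * step_cost (size w + t (size w)) + 2))
    true (T, 1%R).
  apply: texec_seq (texec_go MLeft 1 _ _) _; apply: texec_seq (texec_go MRight 1 T 0%R).
  apply: texec_le ex _; rewrite leq_mul2l step_cost_le ?orbT // leq_add2r.
  exact: height_input.
have [rep halted] := machine_texec ex.
eexists; split; first exact: (bound (size w)); split=> //.
apply: tm_output_represents rep _ => i _ /=.
by have := mT out i.+1; rewrite /cell eqxx /= -[i.+1]add1n.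
Qed.

End Stacks.

End Stack.

Import Stack.

(** * Formulas and sparse polynomials *)

Fixpoint qf_bind (A B : Type) (g : A -> qf B) (f : qf A) : qf B :=
  match f with
  | QAtom a => g a
  | QAnd f1 f2 => QAnd (qf_bind g f1) (qf_bind g f2)
  | QOr f1 f2 => QOr (qf_bind g f1) (qf_bind g f2)
  end.

Definition qf_map (A B : Type) (h : A -> B) : qf A -> qf B := qf_bind (fun a => QAtom (h a)).

Lemma qf_holds_bind (A B : Type) (ah : (nat -> R) -> B -> Prop) v (g : A -> qf B) f :
  qf_holds ah v (qf_bind g f) = qf_holds (fun v a => qf_holds ah v (g a)) v f.
Proof. by elim: f => //= f1 -> f2 ->. Qed.

Lemma qf_all_bind (A B : Type) (P : B -> Prop) (g : A -> qf B) f :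
  qf_all P (qf_bind g f) = qf_all (fun a => qf_all P (g a)) f.
Proof. by elim: f => //= f1 -> f2 ->. Qed.

Lemma qf_all_imp (A : Type) (P Q : A -> Prop) f :
  qf_all (fun a => P a -> Q a) f -> qf_all P f -> qf_all Q f.
Proof. by elim: f => [a|f1 IH1 f2 IH2 [] ? ? []|f1 IH1 f2 IH2 [] ? ? []] /=; auto. Qed.

Lemma qf_all_true (A : Type) (P : A -> Prop) f : (forall a, P a) -> qf_all P f.
Proof. by move=> all_P; elim: f => /=. Qed.

Lemma qf_holds_imp (A : Type) (ah ah' : (nat -> R) -> A -> Prop) v w f :
  qf_all (fun a => ah v a -> ah' w a) f -> qf_holds ah v f -> qf_holds ah' w f.
Proof. by elim: f => [a|f1 IH1 f2 IH2 [] ? ? []|f1 IH1 f2 IH2 [] ? ? []] /=; auto. Qed.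

Lemma qf_holds_iff (A : Type) (ah ah' : (nat -> R) -> A -> Prop) v w f :
  qf_all (fun a => ah v a <-> ah' w a) f -> qf_holds ah v f <-> qf_holds ah' w f.
Proof.
by move=> iff; split; apply: qf_holds_imp;
  apply: qf_all_imp iff; apply: qf_all_true => a [].
Qed.

(* Both lists of atoms are nonempty: [a] comes last. *)
Definition qf_disj (A : Type) (l : seq A) (a : A) : qf A :=
  foldr (fun b f => QOr (QAtom b) f) (QAtom a) l.

Definition qf_conj (A : Type) (l : seq A) (a : A) : qf A :=
  foldr (fun b f => QAnd (QAtom b) f) (QAtom a) l.

Section Lists.

Variables (A : eqType) (l : seq A) (a : A).

Lemma qf_disj_holds (ah : (nat -> R) -> A -> Prop) v :
  qf_holds ah v (qf_disj l a) <-> exists2 b, b \in a :: l & ah v b.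
Proof.
elim: l => [|b l' IH] /=.
  by split=> [holds_a|[b]]; [exists a; rewrite ?mem_head | rewrite inE => /eqP ->].
rewrite IH; split=> [[holds_b|[c c_in holds_c]]|[c]].
- by exists b; rewrite // !inE eqxx orbT.
- by exists c; move: c_in; rewrite // !inE => /orP [->|->]; rewrite ?orbT.
- rewrite !inE => /or3P [c_a|/eqP ->|c_in] holds_c; [right|by left|right].
  + by exists c; rewrite // inE c_a.
  + by exists c; rewrite // inE c_in orbT.
Qed.

Lemma qf_conj_all (P : A -> Prop) :
  qf_all P (qf_conj l a) <-> forall b, b \in a :: l -> P b.
Proof.
elim: l => [|b l' IH] /=.
  by split=> [Pa b|all_P]; [rewrite inE => /eqP -> | apply: all_P; rewrite mem_head].
rewrite IH; split=> [[Pb all_P] c|all_P].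
- rewrite !inE => /or3P [c_a|/eqP -> //|c_in]; apply: all_P; rewrite inE ?c_a //.
  by rewrite c_in orbT.
- split=> [|c]; first by apply: all_P; rewrite !inE eqxx orbT.
  by rewrite inE => /orP [c_a|c_in]; apply: all_P; rewrite !inE ?c_a ?c_in ?orbT.
Qed.

Lemma qf_conj_holds (ah : (nat -> R) -> A -> Prop) v :
  qf_holds ah v (qf_conj l a) <-> forall b, b \in a :: l -> ah v b.
Proof.
suff <- : qf_all (ah v) (qf_conj l a) = qf_holds ah v (qf_conj l a) by exact: qf_conj_all.
by elim: l => //= b l' ->.
Qed.

Lemma qf_disj_all (P : A -> Prop) :
  qf_all P (qf_disj l a) <-> forall b, b \in a :: l -> P b.
Proof.
suff -> : qf_all P (qf_disj l a) = qf_all P (qf_conj l a) by exact: qf_conj_all.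
by elim: l => //= b l' ->.
Qed.

End Lists.

(* A polynomial is a list of monomials (coefficient, list of factors), and an
   atom (p, q) stands for p <= q. *)
Definition lmon (V : Type) : Type := Z * seq V.
Definition lpoly (V : Type) : Type := seq (lmon V).
Definition latom (V : Type) : Type := lpoly V * lpoly V.

Definition lmon_map (V W : Type) (h : V -> W) (m : lmon V) : lmon W := (m.1, map h m.2).

Definition lpoly_map (V W : Type) (h : V -> W) (p : lpoly V) : lpoly W := map (lmon_map h) p.

Definition latom_map (V W : Type) (h : V -> W) (a : latom V) : latom W :=
  (lpoly_map h a.1, lpoly_map h a.2).

Definition lmon_eval (v : nat -> R) (m : lmon nat) : R :=
  Rmult (IZR m.1) (foldr (fun i r => Rmult (v i) r) R1 m.2).

Definition lpoly_eval (v : nat -> R) (p : lpoly nat) : R :=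
  foldr (fun m r => Rplus (lmon_eval v m) r) R0 p.

Definition latom_holds (v : nat -> R) (a : latom nat) : Prop :=
  Rle (lpoly_eval v a.1) (lpoly_eval v a.2).

(** * Terms as circuits *)

(* [EDigit b e] stands for 2 e + b. *)
Inductive expr : Type :=
| EVar of nat
| EZero
| ENeg of expr
| EDigit of bool & expr
| EAdd of expr & expr
| EMul of expr & expr.

Fixpoint expr_of_pos (p : positive) : expr :=
  match p with
  | xH => EDigit true EZero
  | xO q => EDigit false (expr_of_pos q)
  | xI q => EDigit true (expr_of_pos q)
  end.

Fixpoint expr_of_term (t : term) : expr :=
  match t with
  | TVar i => EVar i
  | TConst Z0 => EZero
  | TConst (Zpos p) => expr_of_pos p
  | TConst (Zneg p) => ENeg (expr_of_pos p)
  | TAdd t u => EAdd (expr_of_term t) (expr_of_term u)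
  | TMul t u => EMul (expr_of_term t) (expr_of_term u)
  end.

Fixpoint expr_vars (e : expr) : seq nat :=
  match e with
  | EVar i => [:: i]
  | EZero => [::]
  | ENeg e | EDigit _ e => expr_vars e
  | EAdd a b | EMul a b => expr_vars a ++ expr_vars b
  end.

Fixpoint expr_wires (e : expr) : nat :=
  match e with
  | EVar _ | EZero => 0
  | ENeg e | EDigit _ e => (expr_wires e).+1
  | EAdd a b | EMul a b => (expr_wires a + expr_wires b).+2
  end.

(* A gate (l, r, z) is the equation l = r, which defines the wire z. *)
Definition gate (V : Type) : Type := lpoly V * lpoly V * V.

Section Gates.

Variable V : Type.

Implicit Types (s d z x y : V) (g : gate V).

Definition mon (xs : seq V) : lmon V := (Zpos xH, xs).

(* Wires hold the values multiplied by the scale [s], which makes the equation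
   of a product homogeneous. *)
Definition var_gate s z x : gate V := ([:: mon [:: z]], [:: mon [:: s; x]], z).
Definition zero_gate z : gate V := ([:: mon [:: z]], [::], z).
Definition neg_gate z x : gate V := ([:: mon [:: z]], [:: (Zneg xH, [:: x])], z).
Definition digit_gate s (b : bool) z x : gate V :=
  ([:: mon [:: z]], (Zpos (xO xH), [:: x]) :: (if b then [:: mon [:: s]] else [::]), z).
Definition add_gate z x y : gate V := ([:: mon [:: z]], [:: mon [:: x]; mon [:: y]], z).
Definition mul_gate s z x y : gate V := ([:: mon [:: s; z]], [:: mon [:: x; y]], z).

(* |l - r| >= d or |z| >= 1 *)
Definition gate_escapes d g : seq (latom V) :=
  let: (l, r, z) := g in
  [:: (mon [:: d] :: l, r); (mon [:: d] :: r, l);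
      ([:: mon [::]], [:: mon [:: z]]); ([:: mon [:: z]; mon [::]], [::])].

Definition gate_equations g : seq (latom V) :=
  let: (l, r, z) := g in [:: (l, r); (r, l)].

(* x <= y + s^2, s >= 1, d <= 0 *)
Definition phi_head s d x y : seq (latom V) :=
  [:: ([:: mon [:: x]], [:: mon [:: y]; mon [:: s; s]]);
      ([:: mon [::]], [:: mon [:: s]]); ([:: mon [:: d]], [::])].

(* s <= 0 *)
Definition phi_last s : latom V := ([:: mon [:: s]], [::]).

(* 4 y >= s x *)
Definition chain_atom s x y : latom V := ([:: mon [:: s; x]], [:: (Zpos (xO (xO xH)), [:: y])]).

Definition psi_head x y : latom V := ([:: mon [:: x]], [:: mon [:: y]]).

Definition psi_last : latom V := ([::], [::]).

End Gates.

Arguments psi_last {V}.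

Definition gate_map (V W : Type) (h : V -> W) (g : gate V) : gate W :=
  (lpoly_map h g.1.1, lpoly_map h g.1.2, h g.2).

(* [z] is the output wire of [e], and its other wires are allocated from [f] on:
   [f + 1] for the first operand of a binary operation, [f] for the second one. *)
Fixpoint expr_gates (s z f : nat) (e : expr) : seq (gate nat) :=
  match e with
  | EVar i => [:: var_gate s z i]
  | EZero => [:: zero_gate z]
  | ENeg a => neg_gate z f :: expr_gates s f f.+1 a
  | EDigit b a => digit_gate s b z f :: expr_gates s f f.+1 a
  | EAdd a b => add_gate z f.+1 f ::
      expr_gates s f.+1 f.+2 a ++ expr_gates s f (f.+2 + expr_wires a) b
  | EMul a b => mul_gate s z f.+1 f ::
      expr_gates s f.+1 f.+2 a ++ expr_gates s f (f.+2 + expr_wires a) b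
  end.

Definition atom_lhs (a : tatom) : expr :=
  match a with TLe t u | TLt t u => expr_of_term t end.

Definition atom_rhs (a : tatom) : expr :=
  match a with TLe t u | TLt t u => expr_of_term u end.

Definition atom_wires (a : tatom) : nat :=
  (expr_wires (atom_lhs a) + expr_wires (atom_rhs a)).+2.

Definition atom_gates (s f : nat) (a : tatom) : seq (gate nat) :=
  expr_gates s f.+1 f.+2 (atom_lhs a) ++
  expr_gates s f (f.+2 + expr_wires (atom_lhs a)) (atom_rhs a).

Definition chain_atoms (s L : nat) : seq (latom nat) :=
  [seq chain_atom s (s + i) (s + i).+1 | i <- iota 0 L].

Definition phi_atom (s L f : nat) (a : tatom) : qf (latom nat) :=
  qf_disj (phi_head s (s + L) f.+1 f ++ chain_atoms s L ++
           flatten [seq gate_escapes (s + L) g | g <- atom_gates s f a]) (phi_last s).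

Definition psi_atom (s f : nat) (a : tatom) : qf (latom nat) :=
  qf_conj (psi_head f.+1 f :: flatten [seq gate_equations g | g <- atom_gates s f a]) psi_last.

Fixpoint qf_wires (f : qf tatom) : nat :=
  match f with
  | QAtom a => atom_wires a
  | QAnd f1 f2 | QOr f1 f2 => qf_wires f1 + qf_wires f2
  end.

(* pairs every atom with the first of the wires allocated to it *)
Fixpoint qf_place (f : nat) (phi : qf tatom) : qf (nat * tatom) :=
  match phi with
  | QAtom a => QAtom (f, a)
  | QAnd p q => QAnd (qf_place f p) (qf_place (f + qf_wires p) q)
  | QOr p q => QOr (qf_place f p) (qf_place (f + qf_wires p) q)
  end.

Definition red_qf (psi : bool) (s L f : nat) (phi : qf tatom) : qf (latom nat) :=
  qf_bind (fun fa => if psi then psi_atom s fa.1 fa.2 else phi_atom s L fa.1 fa.2)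
    (qf_place f phi).

(* With [k] the number of variables of the sentence, [k] is the scale, [k + L]
   the last variable of the chain, and the wires follow. *)
Definition red_sentence (L : nat) (s : sentence tatom) : sentence (latom nat) :=
  match s with
  | Sig2 m n phi => Sig2 m (n + (L + L).+1) (red_qf false (m + n) L (m + n + L).+1 phi)
  | BSig2 m n phi => BSig2 m (n + (L + L).+1) (red_qf false (m + n) L (m + n + L).+1 phi)
  | BSig2pp m n psi phi =>
      BSig2pp m (n + (L + L).+1) (red_qf true (m + n) L (m + n + L).+1 psi)
        (red_qf false (m + n) L ((m + n + L).+1 + qf_wires psi) phi)
  end.

Definition sentence_wires (s : sentence tatom) : nat :=
  match s with
  | Sig2 _ _ phi | BSig2 _ _ phi => qf_wires phi
  | BSig2pp _ _ psi phi => qf_wires psi + qf_wires phi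
  end.

Lemma expr_of_term_vars t : expr_vars (expr_of_term t) = term_vars t.
Proof.
elim: t => [i|[|p|p]|t IHt u IHu|t IHt u IHu] //=; rewrite ?IHt ?IHu //.
all: by elim: p.
Qed.

Lemma qf_all_place (P : tatom -> Prop) f phi :
  qf_all (fun fa => P fa.2) (qf_place f phi) = qf_all P phi.
Proof. by elim: phi f => //= p IHp q IHq f; rewrite IHp IHq. Qed.

Lemma qf_holds_place (ah : (nat -> R) -> tatom -> Prop) v f phi :
  qf_holds (fun v fa => ah v fa.2) v (qf_place f phi) = qf_holds ah v phi.
Proof. by elim: phi f => //= p IHp q IHq f; rewrite IHp IHq. Qed.

Lemma qf_place_bounds f phi lo hi : (lo <= f)%N -> (f + qf_wires phi <= hi)%N ->
  qf_all (fun fa => (lo <= fa.1)%N /\ (fa.1 + atom_wires fa.2 <= hi)%N) (qf_place f phi).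
Proof.
elim: phi f => [a|p IHp q IHq|p IHp q IHq] f //= lo_f f_hi.
all: by split; [apply: IHp | apply: IHq]; lia.
Qed.

(** * Correctness of the reduction over the reals *)

Section RealSemantics.

Local Open Scope R_scope.

Implicit Types (v w : nat -> R) (e : expr) (a : tatom) (phi psi : qf tatom).

Fixpoint expr_eval v e : R :=
  match e with
  | EVar i => v i
  | EZero => 0
  | ENeg a => - expr_eval v a
  | EDigit b a => 2 * expr_eval v a + (if b then 1 else 0)
  | EAdd a b => expr_eval v a + expr_eval v b
  | EMul a b => expr_eval v a * expr_eval v b
  end.

Lemma expr_of_pos_eval v p : expr_eval v (expr_of_pos p) = IZR (Zpos p).
Proof.
by elim: p => [q|q|] /= => [->|->|]; rewrite ?(Pos2Z.inj_xI q) ?(Pos2Z.inj_xO q) ?plus_IZR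
  ?mult_IZR; lra.
Qed.

Lemma expr_of_term_eval v t : expr_eval v (expr_of_term t) = teval v t.
Proof.
by elim: t => [i|[|p|p]|t IHt u IHu|t IHt u IHu] //=; rewrite ?IHt ?IHu ?expr_of_pos_eval.
Qed.

(* the values of the wires below the output of [e], in the order of allocation *)
Fixpoint wire_values v e : seq R :=
  match e with
  | EVar _ | EZero => [::]
  | ENeg a | EDigit _ a => expr_eval v a :: wire_values v a
  | EAdd a b | EMul a b =>
      [:: expr_eval v b, expr_eval v a & wire_values v a ++ wire_values v b]
  end.

Definition atom_values v a : seq R :=
  [:: expr_eval v (atom_rhs a), expr_eval v (atom_lhs a) &
      wire_values v (atom_lhs a) ++ wire_values v (atom_rhs a)].

Fixpoint qf_values v phi : seq R :=
  match phi with
  | QAtom a => atom_values v a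
  | QAnd p q | QOr p q => qf_values v p ++ qf_values v q
  end.

Lemma size_wire_values v e : size (wire_values v e) = expr_wires e.
Proof. by elim: e => //= [e ->|b e ->|a IHa b IHb|a IHa b IHb] //; rewrite size_cat IHa IHb. Qed.

Lemma size_qf_values v phi : size (qf_values v phi) = qf_wires phi.
Proof.
elim: phi => [a|p IHp q IHq|p IHp q IHq] /=; rewrite size_cat ?IHp ?IHq //.
by rewrite !size_wire_values.
Qed.

Definition holds_scaled v (c : R) (f : nat) (l : seq R) : Prop :=
  forall i, (i < size l)%N -> v (f + i)%N = c * nth 0 l i.

Lemma holds_scaled_cons v c f x l :
  holds_scaled v c f (x :: l) -> v f = c * x /\ holds_scaled v c f.+1 l.
Proof.
move=> held; split; first by have := held 0%N isT; rewrite addn0.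
by move=> i lt_i; rewrite addSnnS; apply: (held i.+1).
Qed.

Lemma holds_scaled_cat v c f l1 l2 : holds_scaled v c f (l1 ++ l2) ->
  holds_scaled v c f l1 /\ holds_scaled v c (f + size l1) l2.
Proof.
move=> held; split=> i lt_i.
- by rewrite held ?nth_cat ?lt_i // size_cat; lia.
- rewrite -addnA held ?nth_cat ?size_cat; last lia.
  by case: ifP; [lia | rewrite addKn].
Qed.

Lemma qf_values_place v c f phi : holds_scaled v c f (qf_values v phi) ->
  qf_all (fun fa => holds_scaled v c fa.1 (atom_values v fa.2)) (qf_place f phi).
Proof.
elim: phi f => [a|p IHp q IHq|p IHp q IHq] f //= /holds_scaled_cat [held_p held_q].
all: by rewrite size_qf_values in held_q; split; [apply: IHp | apply: IHq].
Qed.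

Definition gate_exact v (g : gate nat) : Prop := lpoly_eval v g.1.1 = lpoly_eval v g.1.2.

Definition gate_near v (d : R) (g : gate nat) : Prop :=
  - d < lpoly_eval v g.1.1 - lpoly_eval v g.1.2 < d /\ -1 < v g.2 < 1.

Lemma gate_equationsP v g :
  (forall b, b \in gate_equations g -> latom_holds v b) <-> gate_exact v g.
Proof.
case: g => [[l r] z]; rewrite /gate_exact /latom_holds /=; split=> [holds|eq_lr b].
- by apply: Rle_antisym; [apply: (holds (l, r)) | apply: (holds (r, l))]; rewrite !inE eqxx ?orbT.
- by rewrite !inE => /orP [] /eqP -> /=; lra.
Qed.

Lemma gate_escapesP v d g :
  (forall b, b \in gate_escapes d g -> ~ latom_holds v b) <-> gate_near v (v d) g.
Proof.
case: g => [[l r] z]; rewrite /gate_near /=; split=> [no_escape|near b].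
- have escape i lt_i := no_escape _ (@mem_nth _ ([::], [::]) _ i lt_i).
  have := escape 0%N isT; have := escape 1%N isT; have := escape 2%N isT; have := escape 3%N isT.
  by rewrite /latom_holds /= /lmon_eval /=; lra.
- by rewrite !inE => /or4P [] /eqP ->; rewrite /latom_holds /= /lmon_eval /=; lra.
Qed.

Lemma expr_gates_exact v s z f e :
  v z = v s * expr_eval v e -> holds_scaled v (v s) f (wire_values v e) ->
  forall g, g \in expr_gates s z f e -> gate_exact v g.
Proof.
elim: e z f => [i||e IH|b e IH|a IHa b IHb|a IHa b IHb] z f vz /=.
- by move=> _ g; rewrite inE => /eqP ->; rewrite /gate_exact /= /lmon_eval /= vz /=; lra.
- by move=> _ g; rewrite inE => /eqP ->; rewrite /gate_exact /= /lmon_eval /= vz /=; lra.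
- move=> /holds_scaled_cons [vf held] g; rewrite inE => /predU1P [->|]; last exact: IH.
  by rewrite /gate_exact /= /lmon_eval /= vz vf /=; lra.
- move=> /holds_scaled_cons [vf held] g; rewrite inE => /predU1P [->|]; last exact: IH.
  by rewrite /gate_exact /= /lmon_eval /= vz vf /=; case: (b); rewrite /= /lmon_eval /=; lra.
all: move=> /holds_scaled_cons [vf /holds_scaled_cons [vf1 /holds_scaled_cat [held_a held_b]]] g.
all: rewrite size_wire_values in held_b.
all: rewrite inE mem_cat => /predU1P [->|/orP []]; [|exact: IHa|exact: IHb].
all: by rewrite /gate_exact /= /lmon_eval /= vz vf vf1 /=; lra.
Qed.

Lemma expr_gates_value v s z f e : v s <> 0 ->
  (forall g, g \in expr_gates s z f e -> gate_exact v g) -> v z = v s * expr_eval v e.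
Proof.
move=> s_neq0; elim: e z f => [i||e IH|b e IH|a IHa b IHb|a IHa b IHb] z f /= exact_gates.
all: have := exact_gates _ (mem_head _ _); rewrite /gate_exact /= /lmon_eval /=.
- by lra.
- by lra.
- by rewrite (IH f f.+1) => [|g g_in]; [lra | apply: exact_gates; rewrite inE g_in orbT].
- rewrite (IH f f.+1) => [|g g_in]; last by apply: exact_gates; rewrite inE g_in orbT.
  by case: (b); rewrite /= /lmon_eval /=; lra.
all: rewrite (IHa f.+1 f.+2) => [|g g_in];
  last by apply: exact_gates; rewrite inE mem_cat g_in orbT.
all: rewrite (IHb f (f.+2 + expr_wires a)%N) => [|g g_in];
  last by apply: exact_gates; rewrite inE mem_cat g_in !orbT.
- by lra.
- by move=> gate_eq; apply: (Rmult_eq_reg_l (v s)) => //; lra.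
Qed.

Lemma expr_gates_output s z f e : exists2 g, g \in expr_gates s z f e & g.2 = z.
Proof. by case: e => * /=; eexists; do ?exact: mem_head. Qed.

Definition near (d x y : R) : Prop := - d <= x - y <= d.

Lemma near_le d d' x y : d <= d' -> near d x y -> near d' x y.
Proof. by rewrite /near; lra. Qed.

(* error of a wire above [k] gates that are off by at most [d], for the scale [c] *)
Definition wire_error (c d : R) (k : nat) : R := d * (4 / c) ^ k.

Section WireError.

Variables c d : R.
Hypotheses (c_bounds : 0 < c < 1) (d_gt0 : 0 < d).

Let ratio_ge4 : 4 <= 4 / c.
Proof.
have eq4 : 4 / c * c = 4 by field; lra.
by apply: (Rmult_le_reg_r c); lra.
Qed.

Lemma wire_error_le k l : (k <= l)%N -> wire_error c d k <= wire_error c d l.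
Proof. by move=> le_kl; apply: Rmult_le_compat_l; [lra | apply: Rle_pow; [lra | lia]]. Qed.

Lemma wire_error_ge k : d <= wire_error c d k.
Proof. by have := wire_error_le (leq0n k); rewrite {1}/wire_error /=; lra. Qed.

Lemma wire_errorS k : c * wire_error c d k.+1 = 4 * wire_error c d k.
Proof. by rewrite /wire_error /=; field; lra. Qed.

Lemma wire_errorS_ge k : 4 * wire_error c d k <= wire_error c d k.+1.
Proof. by rewrite -wire_errorS; have := wire_error_ge k.+1; nra. Qed.

Lemma mul_gate_error k x y z p q :
  wire_error c d k <= 1 -> -1 < x < 1 -> -1 < y < 1 ->
  near d (c * z) (x * y) -> near (wire_error c d k) x (c * p) ->
  near (wire_error c d k) y (c * q) -> near (wire_error c d k.+1) z (c * (p * q)).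
Proof.
have := wire_error_ge k; have := wire_errorS k; rewrite /near.
move: (wire_error c d k) (wire_error c d k.+1) => err err' errS d_le err_le
  x_bounds y_bounds near_z near_x near_y.
have product u t b b' : - b <= u <= b -> - b' <= t <= b' -> - (b * b') <= u * t <= b * b'.
  by move=> u_le t_le; split; nra.
have left_error : - (err * 1) <= (x - c * p) * y <= err * 1 by apply: product; lra.
have right_error : - (2 * err) <= c * p * (y - c * q) <= 2 * err by apply: product; lra.
have total : - (c * err') <= c * (z - c * (p * q)) <= c * err' by rewrite errS; lra.
by split; apply: (Rmult_le_reg_l c); lra.
Qed.

End WireError.

Lemma expr_gates_near v s z f e d N :
  0 < v s < 1 -> 0 < d -> wire_error (v s) d N <= 1 -> (expr_wires e < N)%N ->
  (forall g, g \in expr_gates s z f e -> gate_near v d g) ->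
  near (wire_error (v s) d (expr_wires e).+1) (v z) (v s * expr_eval v e).
Proof.
move=> s_bounds d_gt0 errN; have errS := wire_errorS_ge s_bounds d_gt0.
have err_le := wire_error_le s_bounds d_gt0; have err_ge := wire_error_ge s_bounds d_gt0.
elim: e z f => [i||e IH|b e IH|a IHa b IHb|a IHa b IHb] z f /= ltN near_gates.
all: have [gate_z _] := near_gates _ (mem_head _ _); move: gate_z; rewrite /= /lmon_eval /=.
- by have := err_ge 1%N; rewrite /near; lra.
- by have := err_ge 1%N; rewrite /near; lra.
- have := IH f f.+1 (ltnW ltN) (fun g g_in => near_gates g (@mem_behead _ (_ :: _) g g_in)).
  by have := errS (expr_wires e).+1; have := err_ge (expr_wires e).+1; rewrite /near; lra.
- have := IH f f.+1 (ltnW ltN) (fun g g_in => near_gates g (@mem_behead _ (_ :: _) g g_in)).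
  have := errS (expr_wires e).+1; have := err_ge (expr_wires e).+1; rewrite /near.
  by case: (b); rewrite /= /lmon_eval /=; lra.
all: set k := (expr_wires a + expr_wires b).+1.
all: have near_a g (g_in : g \in expr_gates s f.+1 f.+2 a) : gate_near v d g
  by apply: near_gates; rewrite inE mem_cat g_in orbT.
all: have near_b g (g_in : g \in expr_gates s f (f.+2 + expr_wires a) b) : gate_near v d g
  by apply: near_gates; rewrite inE mem_cat g_in !orbT.
all: have [le_a le_b] : ((expr_wires a).+1 <= k)%N /\ ((expr_wires b).+1 <= k)%N by rewrite /k; lia.
all: have err_a := near_le (err_le _ _ le_a) (IHa f.+1 f.+2 ltac:(lia) near_a).
all: have err_b := near_le (err_le _ _ le_b) (IHb f (f.+2 + expr_wires a)%N ltac:(lia) near_b).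
all: move=> gate_z; apply: near_le (err_le k.+1 k.+2 (leqnSn _)) _.
- by have := errS k; have := err_ge k; move: gate_z err_a err_b; rewrite /near; lra.
- have [ga ga_in ga_out] := expr_gates_output s f.+1 f.+2 a.
  have [gb gb_in gb_out] := expr_gates_output s f (f.+2 + expr_wires a) b.
  have [[_ bound_a] [_ bound_b]] := (near_a _ ga_in, near_b _ gb_in).
  rewrite ga_out in bound_a; rewrite gb_out in bound_b.
  apply: mul_gate_error bound_a bound_b _ err_a err_b => //; last by rewrite /near; lra.
  by apply: Rle_trans (err_le k N _) errN; rewrite /k; lia.
Qed.

Definition atom_excess v a : R := expr_eval v (atom_lhs a) - expr_eval v (atom_rhs a).

Definition chain_decreasing v (s L : nat) : Prop :=
  forall i, (i < L)%N -> 4 * v (s + i).+1 < v s * v (s + i)%N.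

Lemma phi_atomP v s L f a : ~ qf_holds latom_holds v (phi_atom s L f a) <->
  [/\ 0 < v s < 1, 0 < v (s + L)%N, chain_decreasing v s L, v f + v s * v s < v f.+1 &
      forall g, g \in atom_gates s f a -> gate_near v (v (s + L)%N) g].
Proof.
rewrite /phi_atom qf_disj_holds; split=> [none|[s_bounds d_gt0 chain gap near_gates] [b]].
- have fails b (b_in : b \in _) holds_b := none (ex_intro2 _ _ b b_in holds_b).
  have in_head b : b \in phi_head s (s + L)%N f.+1 f -> ~ latom_holds v b.
    by move=> b_in; apply: fails; rewrite inE mem_cat b_in orbT.
  have head_fails i lt_i := in_head _ (@mem_nth _ ([::], [::]) _ i lt_i).
  have := head_fails 0%N isT; have := head_fails 1%N isT; have := head_fails 2%N isT.
  have := fails _ (mem_head _ _).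
  rewrite /latom_holds /= /lmon_eval /= => s_gt0 d_gt0 s_lt1 gap; split; try lra.
  + move=> i lt_i; have : ~ latom_holds v (chain_atom s (s + i)%N (s + i).+1).
      apply: fails; rewrite inE !mem_cat.
      rewrite (map_f (fun i => chain_atom s (s + i)%N (s + i).+1)) ?orbT //.
      by rewrite mem_iota.
    by rewrite /latom_holds /= /lmon_eval /=; lra.
  + move=> g g_in; apply/gate_escapesP => b b_in; apply: fails.
    by rewrite inE !mem_cat; apply/or4P/Or44/flatten_mapP; exists g.
- rewrite inE !mem_cat => /or4P [/eqP ->||/mapP [i]|/flatten_mapP [g /near_gates]].
  + by rewrite /latom_holds /= /lmon_eval /=; lra.
  + by rewrite !inE => /or3P [] /eqP ->; rewrite /latom_holds /= /lmon_eval /=; lra.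
  + by rewrite mem_iota => /chain ? ->; rewrite /latom_holds /= /lmon_eval /=; lra.
  + by move/gate_escapesP; apply.
Qed.

Lemma psi_atomP v s f a : qf_holds latom_holds v (psi_atom s f a) <->
  v f.+1 <= v f /\ forall g, g \in atom_gates s f a -> gate_exact v g.
Proof.
rewrite /psi_atom qf_conj_holds; split=> [holds|[le_f exact_gates] b].
- split=> [|g g_in].
    have := holds (psi_head f.+1 f); rewrite !inE eqxx orbT => /(_ isT).
    by rewrite /latom_holds /= /lmon_eval /=; lra.
  apply/gate_equationsP => b b_in; apply: holds; rewrite !inE.
  by apply/or3P/Or33/flatten_mapP; exists g.
- rewrite !inE => /or3P [/eqP ->|/eqP ->|/flatten_mapP [g /exact_gates /gate_equationsP]].
  + exact: Rle_refl.
  + by rewrite /latom_holds /= /lmon_eval /=; lra.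
  + exact.
Qed.

Lemma atom_gates_exact v s f a : holds_scaled v (v s) f (atom_values v a) ->
  [/\ v f.+1 = v s * expr_eval v (atom_lhs a), v f = v s * expr_eval v (atom_rhs a) &
      forall g, g \in atom_gates s f a -> gate_exact v g].
Proof.
move=> /holds_scaled_cons [vf /holds_scaled_cons [vf1 /holds_scaled_cat [held_l held_r]]].
rewrite size_wire_values in held_r; split=> // g; rewrite mem_cat => /orP [].
- exact: expr_gates_exact vf1 held_l g.
- exact: expr_gates_exact vf held_r g.
Qed.

Lemma chain_bound v s L : 0 < v s -> chain_decreasing v s L ->
  v (s + L)%N <= v s * (v s / 4) ^ L.
Proof.
move=> s_gt0 chain; elim: L chain => [|L IH] chain; first by rewrite addn0 /=; lra.
have le_L : v (s + L)%N <= v s * (v s / 4) ^ L.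
  by apply: IH => i lt_i; apply: chain; lia.
have := chain L (ltnSn L); rewrite addnS /= => lt_S.
have : v s * v (s + L)%N <= v s * (v s * (v s / 4) ^ L) by apply: Rmult_le_compat_l; lra.
by lra.
Qed.

Lemma wire_error_small c d k L : 0 < c < 1 -> d <= c * (c / 4) ^ L -> (k < L)%N ->
  wire_error c d k <= c * (c / 4).
Proof.
move=> c_bounds d_le lt_kL.
have ratio_gt0 : 0 < 4 / c by apply: Rdiv_lt_0_compat; lra.
have cancel : (c / 4) ^ k * (4 / c) ^ k = 1.
  have inverse : c / 4 * (4 / c) = 1 by field; lra.
  by rewrite -Rpow_mult_distr inverse pow1.
have tail_le : (c / 4) ^ (L - k) <= c / 4.
  have -> : (L - k = (L - k.+1).+1)%N by lia.
  have := pow_incr (c / 4) 1 (L - k.+1) ltac:(lra); rewrite pow1 /= => le1.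
  by have := Rmult_le_compat_l (c / 4) _ _ ltac:(lra) le1; lra.
apply: (Rle_trans _ (c * (c / 4) ^ L * (4 / c) ^ k)).
  by apply: Rmult_le_compat_r d_le; apply: pow_le; lra.
have -> : (L = k + (L - k))%N by lia.
rewrite pow_add.
have -> : c * ((c / 4) ^ k * (c / 4) ^ (L - k)) * (4 / c) ^ k
    = c * (c / 4) ^ (L - k) * ((c / 4) ^ k * (4 / c) ^ k) by ring.
by rewrite cancel Rmult_1_r; apply: Rmult_le_compat_l; lra.
Qed.

(* The wires are so accurate that z_lhs <= z_rhs + s^2 cannot fail. *)
Lemma phi_atom_sound v s L f a : (atom_wires a <= L)%N ->
  v s <= 0 \/ atom_excess v a <= 0 -> qf_holds latom_holds v (phi_atom s L f a).
Proof.
move=> wires_le le0; apply: NNPP => /phi_atomP [s_bounds d_gt0 chain gap near_gates].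
have {le0} le_lr : atom_excess v a <= 0 by case: le0 => //; lra.
have d_le := chain_bound (proj1 s_bounds) chain.
have small k := @wire_error_small (v s) (v (s + L)%N) k L s_bounds d_le.
rewrite /atom_wires in wires_le; rewrite /atom_gates in near_gates; rewrite /atom_excess in le_lr.
move: (atom_lhs a) (atom_rhs a) wires_le near_gates le_lr => l r wires_le near_gates le_lr.
have errN : wire_error (v s) (v (s + L)%N) (expr_wires l + expr_wires r).+1 <= 1.
  by have := small _ wires_le; nra.
have near_l :
    near (wire_error (v s) (v (s + L)%N) (expr_wires l).+1) (v f.+1) (v s * expr_eval v l).
  apply: (@expr_gates_near v s f.+1 f.+2 l) errN _ _ => // [|g g_in]; first lia.
  by apply: near_gates; rewrite mem_cat g_in.
have near_r : near (wire_error (v s) (v (s + L)%N) (expr_wires r).+1) (v f) (v s * expr_eval v r).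
  apply: (@expr_gates_near v s f (f.+2 + expr_wires l)) errN _ _ => // [|g g_in]; first lia.
  by apply: near_gates; rewrite mem_cat g_in orbT.
have small_l := small (expr_wires l).+1 ltac:(lia).
have small_r := small (expr_wires r).+1 ltac:(lia).
have : v s * expr_eval v l <= v s * expr_eval v r by apply: Rmult_le_compat_l; lra.
by move: near_l near_r; rewrite /near; nra.
Qed.

Definition regular_tail v (s L : nat) : Prop :=
  [/\ 0 < v s, 0 < v (s + L)%N, chain_decreasing v s L & forall i, (s <= i)%N -> -1 < v i < 1].

Lemma expr_gates_ge s z f e k : (k <= z)%N -> (k <= f)%N ->
  forall g, g \in expr_gates s z f e -> (k <= g.2)%N.
Proof.
elim: e z f => [i||e IH|b e IH|a IHa b IHb|a IHa b IHb] z f k_z k_f g /=.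
1,2: by rewrite inE => /eqP ->.
1,2: by rewrite inE => /predU1P [->|] //; apply: IH; lia.
all: by rewrite inE mem_cat => /predU1P [->|/orP []] //; [apply: IHa | apply: IHb]; lia.
Qed.

Lemma phi_atom_relaxed v s L f a :
  regular_tail v s L -> (s <= f)%N -> holds_scaled v (v s) f (atom_values v a) ->
  qf_holds latom_holds v (phi_atom s L f a) -> atom_excess v a <= v s.
Proof.
move=> [s_gt0 d_gt0 chain tail] s_f /atom_gates_exact [vf1 vf exact_gates] holds.
apply: Rnot_lt_le => gap; move: holds; apply: (proj2 (phi_atomP v s L f a)).
have s_bounds := tail s (leqnn s); split=> //; first lra.
- rewrite vf vf1; have : v s * v s < v s * atom_excess v a by apply: Rmult_lt_compat_l.
  by rewrite /atom_excess; lra.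
- move=> [[l r] z] g_in; have := exact_gates _ g_in; rewrite /gate_near /gate_exact /=.
  have z_bounds : -1 < v z < 1.
    by apply: tail; move: g_in; rewrite mem_cat => /orP [] /expr_gates_ge; apply; lia.
  by lra.
Qed.

Lemma psi_atom_sound v s f a :
  0 < v s -> qf_holds latom_holds v (psi_atom s f a) -> atom_excess v a <= 0.
Proof.
move=> s_gt0 /psi_atomP [le_f exact_gates]; have s_neq0 : v s <> 0 by lra.
have vf1 : v f.+1 = v s * expr_eval v (atom_lhs a).
  apply: (@expr_gates_value v s f.+1 f.+2) => // g g_in.
  by apply: exact_gates; rewrite mem_cat g_in.
have vf : v f = v s * expr_eval v (atom_rhs a).
  apply: (@expr_gates_value v s f (f.+2 + expr_wires (atom_lhs a))%N) => // g g_in.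
  by apply: exact_gates; rewrite mem_cat g_in orbT.
rewrite vf vf1 in le_f; rewrite /atom_excess.
suff : expr_eval v (atom_lhs a) <= expr_eval v (atom_rhs a) by lra.
exact: Rmult_le_reg_l le_f.
Qed.

Lemma psi_atom_complete v s f a :
  0 < v s -> holds_scaled v (v s) f (atom_values v a) -> atom_excess v a <= 0 ->
  qf_holds latom_holds v (psi_atom s f a).
Proof.
move=> s_gt0 /atom_gates_exact [vf1 vf exact_gates] le0; apply/psi_atomP; split=> //.
by rewrite vf vf1; apply: Rmult_le_compat_l; move: le0; rewrite /atom_excess; lra.
Qed.

Lemma tatom_ok_holds lo hi v a : tatom_ok lo hi a -> tatom_holds v a <-> atom_excess v a <= 0.
Proof. by case: a => // t u _; rewrite /atom_excess /= !expr_of_term_eval; lra. Qed.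

Lemma qf_holds_excess lo hi v phi : qf_all (tatom_ok lo hi) phi ->
  qf_holds tatom_holds v phi <-> qf_holds (fun v a => atom_excess v a <= 0) v phi.
Proof.
move=> ok; apply: qf_holds_iff; apply: qf_all_imp ok; apply: qf_all_true => a.
exact: tatom_ok_holds.
Qed.

Lemma red_phi_sound lo hi v s L f phi : qf_all (tatom_ok lo hi) phi -> (qf_wires phi <= L)%N ->
  v s <= 0 \/ qf_holds tatom_holds v phi -> qf_holds latom_holds v (red_qf false s L f phi).
Proof.
move=> ok wires_le; rewrite (qf_holds_excess v ok) => le0.
have {le0} : qf_holds (fun v a => v s <= 0 \/ atom_excess v a <= 0) v phi.
  case: le0 => [s_le0|]; last by apply: qf_holds_imp; apply: qf_all_true => a; right.
  by elim: (phi) => /= [a|p ? q ?|p ? q ?]; [left|split|left].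
rewrite -(qf_holds_place _ v f) /red_qf qf_holds_bind; apply: qf_holds_imp.
apply: qf_all_imp (qf_place_bounds (leqnn f) (leqnn _)).
by apply: qf_all_true => fa [f_le le_f]; apply: phi_atom_sound; lia.
Qed.

Lemma red_phi_relaxed v s L f phi :
  regular_tail v s L -> (s <= f)%N -> holds_scaled v (v s) f (qf_values v phi) ->
  qf_holds latom_holds v (red_qf false s L f phi) ->
  qf_holds (fun v a => atom_excess v a <= v s) v phi.
Proof.
move=> regular s_f /qf_values_place held.
rewrite /red_qf qf_holds_bind -(qf_holds_place _ v f); apply: qf_holds_imp.
apply: qf_all_imp held; apply: qf_all_imp (qf_place_bounds (leqnn f) (leqnn _)).
by apply: qf_all_true => fa [f_le _]; apply: phi_atom_relaxed => //; lia.
Qed.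

Lemma red_psi_sound lo hi v s L f psi : qf_all (tatom_ok lo hi) psi -> 0 < v s ->
  qf_holds latom_holds v (red_qf true s L f psi) -> qf_holds tatom_holds v psi.
Proof.
move=> ok s_gt0; rewrite (qf_holds_excess v ok) /red_qf qf_holds_bind -(qf_holds_place _ v f).
by apply: qf_holds_imp; apply: qf_all_true => fa; apply: psi_atom_sound.
Qed.

Lemma red_psi_complete lo hi v s L f psi : qf_all (tatom_ok lo hi) psi -> 0 < v s ->
  holds_scaled v (v s) f (qf_values v psi) -> qf_holds tatom_holds v psi ->
  qf_holds latom_holds v (red_qf true s L f psi).
Proof.
move=> ok s_gt0 /qf_values_place held.
rewrite (qf_holds_excess v ok) /red_qf qf_holds_bind -(qf_holds_place _ v f).
apply: qf_holds_imp; apply: qf_all_imp held; apply: qf_all_true => fa.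
exact: psi_atom_complete.
Qed.

Lemma qf_holds_limit (A : Type) (x : (nat -> R) -> A -> R) v (p : qf A) :
  (forall eps, 0 < eps -> exists2 c, 0 < c < eps & qf_holds (fun v b => x v b <= c) v p) ->
  qf_holds (fun v b => x v b <= 0) v p.
Proof.
move=> limit; apply: NNPP => fails.
suff [eps eps_gt0 none] : exists2 eps, 0 < eps &
    forall c, 0 < c < eps -> ~ qf_holds (fun v b => x v b <= c) v p.
  by have [c /none] := limit _ eps_gt0.
elim: p fails {limit} => [b|p IHp q IHq|p IHp q IHq] /= fails.
- by exists (x v b); [|move=> c c_bounds]; lra.
- case: (not_and_or _ _ fails) => [/IHp|/IHq] [eps eps_gt0 none];
    by exists eps => // c /none no_c [].
- have [/IHp [eps eps_gt0 none] /IHq [eps' eps'_gt0 none']] := not_or_and _ _ fails.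
  exists (Rmin eps eps'); first exact: Rmin_pos.
  move=> c c_bounds; have := Rmin_l eps eps'; have := Rmin_r eps eps' => le_r le_l.
  by case; [apply: none | apply: none']; lra.
Qed.

Definition agree_below (k : nat) v w : Prop := forall i, (i < k)%N -> v i = w i.

Lemma wire_values_ext v w e : (forall i, i \in expr_vars e -> v i = w i) ->
  expr_eval v e = expr_eval w e /\ wire_values v e = wire_values w e.
Proof.
elim: e => [i||e IH|b e IH|a IHa b IHb|a IHa b IHb] //= eq_vw.
1: by split=> //; apply: eq_vw; rewrite mem_head.
1,2: by have [-> ->] := IH eq_vw.
all: have [|-> ->] := IHa; first by move=> i i_in; apply: eq_vw; rewrite mem_cat i_in.
all: have [|-> ->] := IHb; first by move=> i i_in; apply: eq_vw; rewrite mem_cat i_in orbT.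
all: by [].
Qed.

Lemma atom_values_ext lo k v w a : agree_below k v w -> tatom_ok lo k a ->
  atom_excess v a = atom_excess w a /\ atom_values v a = atom_values w a.
Proof.
case: a => // t u agree ok; rewrite /atom_excess /atom_values /=.
have [|-> ->] := @wire_values_ext v w (expr_of_term t).
  by rewrite expr_of_term_vars => i i_in; apply: agree; have := ok i; rewrite mem_cat i_in; lia.
have [|-> ->] // := @wire_values_ext v w (expr_of_term u).
by rewrite expr_of_term_vars => i i_in; apply: agree; have := ok i; rewrite mem_cat i_in orbT; lia.
Qed.

Lemma qf_values_ext lo k v w phi : agree_below k v w -> qf_all (tatom_ok lo k) phi ->
  qf_values v phi = qf_values w phi.
Proof.
move=> agree.
elim: phi => [a /(atom_values_ext agree) [] //|p IHp q IHq|p IHp q IHq] /= [ok_p ok_q].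
all: by rewrite IHp // IHq.
Qed.

Lemma qf_holds_tatom_ext lo k v w phi : agree_below k v w -> qf_all (tatom_ok lo k) phi ->
  qf_holds tatom_holds v phi <-> qf_holds tatom_holds w phi.
Proof.
move=> agree ok; apply: qf_holds_iff; apply: qf_all_imp (ok); apply: qf_all_true => a ok_a.
by rewrite !(tatom_ok_holds _ ok_a) (proj1 (atom_values_ext agree ok_a)).
Qed.

Definition extension v (s L : nat) (c : R) (l : seq R) : nat -> R :=
  fun i => if (i < s)%N then v i
           else if (i <= s + L)%N then c * (c / 8) ^ (i - s)
           else c * nth 0 l (i - (s + L).+1).

Lemma regular_extension v s L c l M : 0 < c <= / 2 -> c * M < 1 ->
  (forall i, - M <= nth 0 l i <= M) ->
  extension v s L c l s = c /\ regular_tail (extension v s L c l) s L.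
Proof.
move=> c_bounds cM l_bounds; set w := extension v s L c l.
have chain i : (i <= L)%N -> w (s + i)%N = c * (c / 8) ^ i.
  move=> le_i; rewrite /w /extension; case: ifP; first lia.
  by case: ifP; [rewrite addKn | lia].
have ws : w s = c by rewrite -[s in LHS]addn0 chain //= Rmult_1_r.
have pow_bounds k : 0 < (c / 8) ^ k <= 1.
  split; first by apply: pow_lt; lra.
  by rewrite -(pow1 k); apply: pow_incr; lra.
split=> //; split; rewrite ?ws //; first lra.
- by rewrite chain //; apply: Rmult_lt_0_compat; [lra | case: (pow_bounds L)].
- move=> i lt_i; rewrite ws -addnS !chain //; last exact: ltnW.
  have pow_gt0 := proj1 (pow_bounds i); rewrite /=.
  have : 0 < c * (c * (c / 8) ^ i) by do 2 (apply: Rmult_lt_0_compat; first lra); lra.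
  by lra.
- move=> i s_i; case: (leqP i (s + L)) => i_L.
    rewrite -(subnKC s_i) chain; last lia.
    by have := pow_bounds (i - s)%N; nra.
  have -> : w i = c * nth 0 l (i - (s + L).+1).
    by rewrite /w /extension; case: ifP; [lia | case: ifP => //; lia].
  by have := l_bounds (i - (s + L).+1)%N; nra.
Qed.

Lemma nth_bounded (l : seq R) : exists2 M, 0 < M & forall i, - M <= nth 0 l i <= M.
Proof.
elim: l => [|x l [M M_gt0 IH]]; first by exists 1; [lra | move=> i; rewrite nth_nil; lra].
exists (M + Rabs x); first by have := Rabs_pos x; lra.
have := Rle_abs x; have := Rle_abs (- x); have := Rabs_pos x; rewrite Rabs_Ropp => ? ? ?.
by case=> [|i] /=; [lra | have := IH i; lra].
Qed.

Lemma exists_small_scale eps M : 0 < eps -> 0 < M ->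
  exists2 c, 0 < c < eps & c <= / 2 /\ c * M < 1.
Proof.
move=> eps_gt0 M_gt0; have inv_gt0 : 0 < / (M + 1) by apply: Rinv_0_lt_compat; lra.
have inv_M : / (M + 1) * M < 1.
  by apply: (Rmult_lt_reg_l (M + 1)); [lra | rewrite -Rmult_assoc Rinv_r; lra].
have le_half := Rmin_l (/ 2) (Rmin (eps / 2) (/ (M + 1))).
have le_min := Rmin_r (/ 2) (Rmin (eps / 2) (/ (M + 1))).
have min_eps := Rmin_l (eps / 2) (/ (M + 1)); have min_inv := Rmin_r (eps / 2) (/ (M + 1)).
exists (Rmin (/ 2) (Rmin (eps / 2) (/ (M + 1)))).
  by split; [do 2 (apply: Rmin_pos; first lra) | ]; lra.
split; first exact: le_half.
by apply: Rle_lt_trans inv_M; apply: Rmult_le_compat_r; lra.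
Qed.

Lemma exists_regular_extension v s L l eps : 0 < eps ->
  exists2 w, agree_below s v w &
    [/\ 0 < w s < eps, regular_tail w s L & holds_scaled w (w s) (s + L).+1 l].
Proof.
move=> eps_gt0; have [M M_gt0 l_bounds] := nth_bounded l.
have [c c_bounds [c_le cM]] := exists_small_scale eps_gt0 M_gt0.
have [ws regular] := @regular_extension v s L c l M ltac:(lra) cM l_bounds.
exists (extension v s L c l); first by move=> i lt_i; rewrite /extension lt_i.
rewrite ws; split=> // i lt_i; rewrite /extension; case: ifP; first lia.
by case: ifP; [lia | rewrite addKn].
Qed.

(* Regular extensions of [v] with scale tending to 0 recover the matrix at [v]. *)
Lemma red_phi_limit lo v k L l phi : qf_all (tatom_ok lo k) phi ->
  (forall w, agree_below k v w -> regular_tail w k L -> holds_scaled w (w k) (k + L).+1 l ->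
     qf_holds latom_holds w (red_qf false k L ((k + L).+1 + size l) phi)) ->
  qf_holds tatom_holds v phi.
Proof.
move=> ok reduced; rewrite (qf_holds_excess v ok).
apply: qf_holds_limit => eps eps_gt0.
have [w agree [wk regular held]] :=
  @exists_regular_extension v k L (l ++ qf_values v phi) eps eps_gt0.
have [held_l held_phi] := holds_scaled_cat held.
exists (w k) => //; rewrite (qf_values_ext agree ok) in held_phi.
have := red_phi_relaxed regular _ held_phi (reduced w agree regular held_l).
move=> /(_ (leq_trans (leq_addr L k) (leq_trans (leqnSn _) (leq_addr _ _)))).
apply: qf_holds_imp; apply: qf_all_imp (ok); apply: qf_all_true => a ok_a.
by rewrite (proj1 (atom_values_ext agree ok_a)).
Qed.

Definition game (m : nat) (M : (nat -> R) -> Prop) : Prop :=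
  exists x, forall y, M (valXY m x y).

Definition bounded_game (m n : nat) (M : (nat -> R) -> Prop) : Prop :=
  exists x, forall y, ~ in_box n y \/ (in_box m x /\ M (valXY m x y)).

Lemma valXY_tail m n x y w : agree_below (m + n) (valXY m x y) w ->
  valXY m x (fun j => w (m + j)%N) = w.
Proof.
move=> agree; apply: functional_extensionality => i; rewrite /valXY; case: ifP => i_m.
  by rewrite -agree /valXY ?i_m //; lia.
by congr w; lia.
Qed.

Section Games.

Variables (m n k : nat) (M M' : (nat -> R) -> Prop).

Hypothesis M_imp : forall v, M v -> M' v.
Hypothesis M'_imp : forall v,
  (forall w, agree_below (m + n) v w ->
     (forall i, (m + n <= i)%N -> -1 < w i < 1) -> M' w) -> M v.

Lemma game_extend : game m M' <-> game m M.
Proof.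
split=> -[x win]; exists x => y; last exact: M_imp.
by apply: M'_imp => w agree _; rewrite -(valXY_tail agree).
Qed.

Lemma bounded_game_extend : bounded_game m (n + k) M' <-> bounded_game m n M.
Proof.
split=> -[x win]; exists x => y; last first.
  case: (classic (in_box (n + k) y)) => [y_box|]; last by left.
  case: (win y) => [[]|[x_box My]]; first by move=> j j_n; apply: y_box; exact: ltn_addr.
  by right; split=> //; exact: M_imp.
case: (classic (in_box n y)) => [y_box|]; [right | by left].
have extended w : agree_below (m + n) (valXY m x y) w ->
    (forall i, (m + n <= i)%N -> -1 < w i < 1) -> in_box m x /\ M' w.
  move=> agree tail; case: (win (fun j => w (m + j)%N)) => [[]|];
    last by rewrite (valXY_tail agree).
  move=> j _; case: (ltnP j n) => j_n; last by have := tail (m + j)%N ltac:(lia); lra.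
  rewrite -agree /valXY; last lia.
  by case: ifP; [lia | rewrite addKn => _; exact: y_box].
split; last by apply: M'_imp => w agree /(extended _ agree) [].
pose w i := if (i < m + n)%N then valXY m x y i else 0.
have [||//] := extended w; first by move=> i lt_i; rewrite /w lt_i.
by move=> i le_i; rewrite /w ltnNge le_i /=; lra.
Qed.

End Games.

Theorem red_sentence_true C s L : in_class tatom_ok C s -> (sentence_wires s <= L)%N ->
  sentence_true latom_holds (red_sentence L s) <-> sentence_true tatom_holds s.
Proof.
case: C s => [] [m n phi|m n phi|m n psi phi] //=.
- move=> ok wires_le; apply: (@game_extend m n (qf_holds tatom_holds ^~ phi)
    (qf_holds latom_holds ^~ (red_qf false (m + n) L (m + n + L).+1 phi))) => v holds.
    by apply: (red_phi_sound _ ok wires_le); right.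
  apply: (red_phi_limit (l := [::]) ok) => w agree regular _; rewrite addn0.
  by apply: holds agree _; case: regular.
- move=> ok wires_le; apply: (@bounded_game_extend m n _ (qf_holds tatom_holds ^~ phi)
    (qf_holds latom_holds ^~ (red_qf false (m + n) L (m + n + L).+1 phi))) => v holds.
    by apply: (red_phi_sound _ ok wires_le); right.
  apply: (red_phi_limit (l := [::]) ok) => w agree regular _; rewrite addn0.
  by apply: holds agree _; case: regular.
- move=> [ok_psi ok] wires_le.
  pose M v := qf_holds tatom_holds v psi -> qf_holds tatom_holds v phi.
  pose M' v := qf_holds latom_holds v (red_qf true (m + n) L (m + n + L).+1 psi) ->
    qf_holds latom_holds v (red_qf false (m + n) L ((m + n + L).+1 + qf_wires psi) phi).
  apply: (@bounded_game_extend m n (L + L).+1 M M') => v holds.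
  + move=> psi'; apply: (red_phi_sound _ ok); first lia.
    case: (Rle_lt_dec (v (m + n)%N) 0) => [|s_gt0]; [by left | right].
    exact: holds (red_psi_sound ok_psi s_gt0 psi').
  + move=> psi_v; apply: (red_phi_limit (l := qf_values v psi) ok) => w agree regular held.
    have [s_gt0 _ _ tail] := regular; rewrite size_qf_values; apply: holds => //.
    apply: (red_psi_complete _ ok_psi) => //; first by rewrite -(qf_values_ext agree ok_psi).
    exact/(qf_holds_tatom_ext agree ok_psi).
Qed.

End RealSemantics.

(** * Terms and standard encodings *)

Definition lmon_ok (lo hi : nat) (m : lmon nat) : bool :=
  (size m.2 <= 2) && all (fun i => lo <= i < hi) m.2.

Definition lpoly_ok (lo hi : nat) (p : lpoly nat) : bool := all (lmon_ok lo hi) p.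

Definition latom_ok (lo hi : nat) (a : latom nat) : Prop :=
  lpoly_ok lo hi a.1 && lpoly_ok lo hi a.2.

Definition gate_ok (lo hi : nat) (g : gate nat) : bool :=
  [&& lpoly_ok lo hi g.1.1, lpoly_ok lo hi g.1.2 & lo <= g.2 < hi].

Lemma expr_gates_ok lo hi s z f e :
  lo <= s < hi -> lo <= z < hi -> lo <= f -> f + expr_wires e <= hi ->
  (forall i, i \in expr_vars e -> lo <= i < hi) ->
  forall g, g \in expr_gates s z f e -> gate_ok lo hi g.
Proof.
move=> s_in.
elim: e z f => [i||e IH|b e IH|a IHa b IHb|a IHa b IHb] z f z_in lo_f f_hi vars_in g /=.
- rewrite inE => /eqP ->; have := vars_in i (mem_head _ _).
  by rewrite /gate_ok /lpoly_ok /lmon_ok /=; lia.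
- by rewrite inE => /eqP ->; rewrite /gate_ok /lpoly_ok /lmon_ok /=; lia.
- rewrite /= in f_hi; rewrite inE => /predU1P [->|]; last by apply: IH => //; lia.
  by rewrite /gate_ok /lpoly_ok /lmon_ok /=; lia.
- rewrite /= in f_hi; rewrite inE => /predU1P [->|]; last by apply: IH => //; lia.
  by rewrite /gate_ok /lpoly_ok /lmon_ok /=; case: (b); rewrite /= /lmon_ok /=; lia.
all: rewrite /= in f_hi; rewrite inE mem_cat => /predU1P [->|/orP []].
1,4: by rewrite /gate_ok /lpoly_ok /lmon_ok /=; lia.
1,3: by apply: IHa => //; [lia..|move=> i i_in; apply: vars_in; rewrite /= mem_cat i_in].
all: by apply: IHb => //; [lia..|move=> i i_in; apply: vars_in; rewrite /= mem_cat i_in orbT].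
Qed.

Lemma atom_gates_ok lo hi s f a :
  lo <= s < hi -> lo <= f -> f + atom_wires a <= hi -> tatom_ok lo s a ->
  forall g, g \in atom_gates s f a -> gate_ok lo hi g.
Proof.
case: a => // t u s_in lo_f; rewrite /atom_wires /= => f_hi ok g.
rewrite mem_cat => /orP [] g_in; apply: expr_gates_ok g_in => /=; try lia.
- by move=> i; rewrite expr_of_term_vars => i_in; have := ok i; rewrite mem_cat i_in; lia.
- by move=> i; rewrite expr_of_term_vars => i_in; have := ok i; rewrite mem_cat i_in orbT; lia.
Qed.

Lemma phi_atom_ok lo hi s L f a :
  lo <= s -> s + L < f -> f + atom_wires a <= hi -> tatom_ok lo s a ->
  qf_all (latom_ok lo hi) (phi_atom s L f a).
Proof.
move=> lo_s s_f f_hi ok; have wires_gt1 : 1 < atom_wires a by [].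
have gates_ok := @atom_gates_ok lo hi s f a ltac:(lia) ltac:(lia) f_hi ok.
apply/qf_disj_all => b; rewrite inE !mem_cat => /or4P [/eqP ->||/mapP [i]|/flatten_mapP [g]].
- by rewrite /latom_ok /lpoly_ok /lmon_ok /=; lia.
- by rewrite !inE => /or3P [] /eqP ->; rewrite /latom_ok /lpoly_ok /lmon_ok /=; lia.
- by rewrite mem_iota => i_in ->; rewrite /latom_ok /lpoly_ok /lmon_ok /=; lia.
- move=> /gates_ok; case: g => [[l r] z] /and3P [/= l_ok r_ok z_in].
  by rewrite !inE => /or4P [] /eqP ->;
    rewrite /latom_ok /= ?l_ok ?r_ok /= /lpoly_ok /= /lmon_ok /=; lia.
Qed.

Lemma psi_atom_ok lo hi s f a :
  lo <= s < f -> f + atom_wires a <= hi -> tatom_ok lo s a ->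
  qf_all (latom_ok lo hi) (psi_atom s f a).
Proof.
move=> s_in f_hi ok; have wires_gt1 : 1 < atom_wires a by [].
have gates_ok := @atom_gates_ok lo hi s f a ltac:(lia) ltac:(lia) f_hi ok.
apply/qf_conj_all => b; rewrite !inE => /or3P [/eqP -> //|/eqP ->|/flatten_mapP [g]].
- by rewrite /latom_ok /lpoly_ok /lmon_ok /=; lia.
- move=> /gates_ok; case: g => [[l r] z] /and3P [/= l_ok r_ok z_in].
  by rewrite !inE => /orP [] /eqP ->; rewrite /latom_ok /= l_ok r_ok.
Qed.

Lemma red_qf_ok lo hi psi s L f phi :
  lo <= s -> s + L < f -> f + qf_wires phi <= hi -> qf_all (tatom_ok lo s) phi ->
  qf_all (latom_ok lo hi) (red_qf psi s L f phi).
Proof.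
move=> lo_s s_f f_hi; rewrite /red_qf qf_all_bind -(qf_all_place _ f); apply: qf_all_imp.
apply: qf_all_imp (qf_place_bounds (leqnn f) f_hi); apply: qf_all_true => fa [f_le le_hi] ok.
by case: psi; [apply: psi_atom_ok | apply: phi_atom_ok] => //; lia.
Qed.

Lemma red_sentence_ok C s L : in_class tatom_ok C s -> sentence_wires s <= L ->
  in_class latom_ok C (red_sentence L s).
Proof.
case: C s => [] [m n phi|m n phi|m n psi phi] //=.
1,2: by move=> ok wires_le; apply: red_qf_ok => //; lia.
by move=> [ok_psi ok] wires_le; split; apply: red_qf_ok => //; lia.
Qed.

Definition lmon_term (m : lmon nat) : term :=
  foldr (fun i t => TMul (TVar i) t) (TConst m.1) m.2.

Definition lpoly_term (p : lpoly nat) : term :=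
  foldr (fun m t => TAdd (lmon_term m) t) (TConst Z0) p.

Definition latom_tatom (a : latom nat) : tatom := TLe (lpoly_term a.1) (lpoly_term a.2).

Definition exponents (hi : nat) (ix : seq nat) : seq nat :=
  [seq count_mem i ix | i <- iota 0 hi].

Definition lpoly_std (hi : nat) (p : lpoly nat) : stdpoly :=
  [seq (exponents hi m.2, m.1) | m <- p].

Definition latom_satom (hi : nat) (a : latom nat) : satom :=
  SLe (lpoly_std hi a.1) (lpoly_std hi a.2).

Lemma lpoly_term_eval v p : teval v (lpoly_term p) = lpoly_eval v p.
Proof.
elim: p => [|[c ix] p IH] //=; rewrite IH; congr Rplus.
elim: ix => [|i ix IHi] /=; rewrite /lmon_eval /= ?Rmult_1_r //.
by rewrite -/(lmon_term (c, ix)) IHi /lmon_eval /=; ring.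
Qed.

Lemma latom_tatom_holds v a : tatom_holds v (latom_tatom a) <-> latom_holds v a.
Proof. by rewrite /= !lpoly_term_eval. Qed.

Lemma lpoly_term_vars lo hi p i : lpoly_ok lo hi p ->
  i \in term_vars (lpoly_term p) -> lo <= i < hi.
Proof.
elim: p => [|[c ix] p IH] //= /andP [/andP [_ ix_in] /IH {}IH].
rewrite mem_cat => /orP [|/IH] //.
elim: ix ix_in => [|j ix IHx] //= /andP [j_in /IHx {}IHx].
by rewrite inE => /orP [/eqP -> //|/IHx].
Qed.

Lemma latom_tatom_ok lo hi a : latom_ok lo hi a -> tatom_ok lo hi (latom_tatom a).
Proof.
move=> /andP [ok1 ok2] i; rewrite mem_cat => /orP [].
- exact: lpoly_term_vars ok1.
- exact: lpoly_term_vars ok2.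
Qed.

Lemma msizeM_pred k (p q : {mpoly int[k]}) : msize (p * q)%R <= (msize p + msize q).-1.
Proof.
have [->|p0] := eqVneq p 0%R; first by rewrite mul0r msize0.
have [->|q0] := eqVneq q 0%R; first by rewrite mulr0 msize0.
by rewrite msizeM.
Qed.

Lemma lmon_term_msize k m : msize (term_mpoly k (lmon_term m)) <= (size m.2).+1.
Proof.
case: m => c; elim=> [|i ix IH] /=; first by rewrite msizeC; case: eqP.
have var_msize : msize (term_mpoly k (TVar i)) <= 2.
  by rewrite /=; case: insub => [j|]; rewrite ?msize0 // msizeX mdeg1.
by apply: leq_trans (msizeM_pred _ _) _; move: var_msize IH; rewrite /lmon_term /=; lia.
Qed.

Lemma lpoly_term_deg k lo hi p : lpoly_ok lo hi p -> term_deg_le k 4 (lpoly_term p).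
Proof.
rewrite /term_deg_le; elim: p => [|m p IH] /=; first by rewrite msizeC; case: eqP.
move=> /andP [/andP [size_le _] /IH {}IH].
apply: leq_trans (mmeasureD_le _ _ _) _; rewrite geq_max IH andbT.
by apply: leq_trans (lmon_term_msize k m) _; lia.
Qed.

Lemma latom_tatom_deg k lo hi a : latom_ok lo hi a -> tatom_deg_le k 4 (latom_tatom a).
Proof.
by move=> /andP [ok1 ok2]; split; [exact: lpoly_term_deg ok1 | exact: lpoly_term_deg ok2].
Qed.

Lemma mon_eval_from_incr v k n i (f : nat -> nat) :
  mon_eval_from v k [seq (i == j) + f j | j <- iota k n]
  = Rmult (if k <= i < k + n then v i else R1) (mon_eval_from v k [seq f j | j <- iota k n]).
Proof.
elim: n k => [|n IH] k /=; first by case: ifP => [|_]; [lia | rewrite Rmult_1_l].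
rewrite IH pow_add.
case: (eqVneq i k) => [->|ne_ik].
- have -> : (k < k < k.+1 + n) = false by lia.
  have -> : k <= k < k + n.+1 by lia.
  by rewrite /=; ring.
- have -> : (k < i < k.+1 + n) = (k <= i < k + n.+1) by lia.
  by rewrite /=; ring.
Qed.

Lemma exponents_eval v hi ix : all (fun i => i < hi) ix ->
  mon_eval_from v 0 (exponents hi ix) = foldr (fun i r => Rmult (v i) r) R1 ix.
Proof.
rewrite /exponents; elim: ix => [|i ix IH] /=.
  have eval0 k n : mon_eval_from v k [seq 0 | _ <- iota k n] = R1.
    by elim: n k => [|n IHn] k //=; rewrite IHn Rmult_1_l.
  by move=> _; apply: eval0.
move=> /andP [i_hi /IH <-].
by rewrite (mon_eval_from_incr v 0 hi i (fun j => count_mem j ix)) add0n i_hi.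
Qed.

Lemma lpoly_std_eval v lo hi p : lpoly_ok lo hi p -> std_eval v (lpoly_std hi p) = lpoly_eval v p.
Proof.
elim: p => [|[c ix] p IH] //= /andP [/andP [_ ix_in] /IH ->].
by rewrite exponents_eval //; apply: sub_all ix_in => i /andP [].
Qed.

Lemma latom_satom_holds v lo hi a : latom_ok lo hi a ->
  satom_holds v (latom_satom hi a) <-> latom_holds v a.
Proof. by move=> /andP [ok1 ok2]; rewrite /= (lpoly_std_eval _ ok1) (lpoly_std_eval _ ok2). Qed.

Lemma lpoly_std_ok lo hi p : lo <= hi -> lpoly_ok lo hi p -> stdpoly_ok lo hi (lpoly_std hi p).
Proof.
move=> le_lohi; elim: p => [|[c ix] p IH] //= /andP [/andP [_ ix_in] /IH {}IH] ac /= [<-|/IH //] /=.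
split=> [|i lt_i]; first by rewrite size_map size_iota.
rewrite (nth_map 0) ?size_iota ?nth_iota; try lia.
by apply/count_memPn; apply/negP => /(allP ix_in); lia.
Qed.

Lemma latom_satom_ok lo hi a : lo <= hi -> latom_ok lo hi a -> satom_ok lo hi (latom_satom hi a).
Proof. by move=> le_lohi /andP [ok1 ok2]; split; apply: lpoly_std_ok. Qed.

Definition sentence_map (A B : Type) (h : A -> B) (s : sentence A) : sentence B :=
  match s with
  | Sig2 m n phi => Sig2 m n (qf_map h phi)
  | BSig2 m n phi => BSig2 m n (qf_map h phi)
  | BSig2pp m n psi phi => BSig2pp m n (qf_map h psi) (qf_map h phi)
  end.

Section SentenceMap.

Variables (A B : Type) (h : A -> B).

Lemma enc_qf_map e phi : enc_qf e (qf_map h phi) = enc_qf (fun a => e (h a)) phi.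
Proof. by elim: phi => //= f -> g ->. Qed.

Lemma enc_sentence_map e s :
  enc_sentence e (sentence_map h s) = enc_sentence (fun a => e (h a)) s.
Proof. by case: s => *; rewrite /= !enc_qf_map. Qed.

Lemma sentence_atoms_all_map P s :
  sentence_atoms_all P (sentence_map h s) = sentence_atoms_all (fun a => P (h a)) s.
Proof. by case: s => *; rewrite /= /qf_map !qf_all_bind. Qed.

Lemma in_class_atoms ok C (s : sentence A) (P : A -> Prop) : in_class ok C s ->
  (forall lo a, lo <= nvars s -> ok lo (nvars s) a -> P a) -> sentence_atoms_all P s.
Proof.
move=> ok_s ok_P; have imp lo phi : lo <= nvars s -> qf_all (ok lo (nvars s)) phi -> qf_all P phi.
  by move=> le_lo; apply: qf_all_imp; apply: qf_all_true => a; exact: ok_P le_lo.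
case: C s ok_s {ok_P} imp => [] [m n phi|m n phi|m n psi phi] //=.
1,2: by move=> ok_phi imp; apply: imp ok_phi.
by move=> [ok_psi ok_phi] imp; split; [apply: imp ok_psi; lia | apply: imp ok_phi].
Qed.

Lemma in_class_map okA okB C s :
  (forall lo a, lo <= nvars s -> okA lo (nvars s) a -> okB lo (nvars s) (h a)) ->
  in_class okA C s -> in_class okB C (sentence_map h s).
Proof.
move=> ok_h; have imp lo phi : lo <= nvars s -> qf_all (okA lo (nvars s)) phi ->
    qf_all (okB lo (nvars s)) (qf_map h phi).
  by rewrite /qf_map qf_all_bind => le_lo; apply: qf_all_imp; apply: qf_all_true => a; exact: ok_h.
case: C s {ok_h} imp => [] [m n phi|m n phi|m n psi phi] //= imp.
1,2: exact: imp.
by move=> [ok_psi ok_phi]; split; [apply: imp ok_psi; lia | apply: imp ok_phi].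
Qed.

Lemma sentence_true_map ahA ahB s :
  sentence_atoms_all (fun a => forall v, ahB v (h a) <-> ahA v a) s ->
  sentence_true ahB (sentence_map h s) <-> sentence_true ahA s.
Proof.
have iff phi v : qf_all (fun a => forall v, ahB v (h a) <-> ahA v a) phi ->
    qf_holds ahB v (qf_map h phi) <-> qf_holds ahA v phi.
  move=> iff_h; rewrite /qf_map qf_holds_bind; apply: qf_holds_iff.
  by apply: qf_all_imp iff_h; apply: qf_all_true => a; exact.
case: s => [m n phi|m n phi|m n psi phi] /=.
- by move=> iff_phi; split=> -[x win]; exists x => y; have := win y; rewrite iff.
- by move=> iff_phi; split=> -[x win]; exists x => y; have := win y; rewrite iff.
- by move=> [iff_psi iff_phi]; split=> -[x win]; exists x => y; have := win y; rewrite !iff.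
Qed.

End SentenceMap.

Definition red_tatom (L : nat) (s : sentence tatom) : sentence tatom :=
  sentence_map latom_tatom (red_sentence L s).

Definition red_satom (L : nat) (s : sentence tatom) : sentence satom :=
  sentence_map (latom_satom (nvars (red_sentence L s))) (red_sentence L s).

Theorem red_tatom_correct C s L : in_class tatom_ok C s -> sentence_wires s <= L ->
  [/\ in_class tatom_ok C (red_tatom L s),
      sentence_atoms_all (tatom_deg_le (nvars (red_tatom L s)) 4) (red_tatom L s) &
      sentence_true tatom_holds (red_tatom L s) <-> sentence_true tatom_holds s].
Proof.
move=> ok_s wires_le; have ok := red_sentence_ok ok_s wires_le; split.
- by apply: in_class_map ok => lo a _; exact: latom_tatom_ok.
- by rewrite sentence_atoms_all_map; apply: in_class_atoms ok _ => lo a _; exact: latom_tatom_deg.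
- rewrite -(red_sentence_true ok_s wires_le); apply: sentence_true_map.
  by apply: in_class_atoms ok _ => lo a _ _ v; exact: latom_tatom_holds.
Qed.

Theorem red_satom_correct C s L : in_class tatom_ok C s -> sentence_wires s <= L ->
  in_class satom_ok C (red_satom L s) /\
  (sentence_true satom_holds (red_satom L s) <-> sentence_true tatom_holds s).
Proof.
move=> ok_s wires_le; have ok := red_sentence_ok ok_s wires_le; split.
- by apply: in_class_map ok => lo a; exact: latom_satom_ok.
- rewrite -(red_sentence_true ok_s wires_le); apply: sentence_true_map.
  by apply: in_class_atoms ok _ => lo a _ ok_a v; exact: latom_satom_holds ok_a.
Qed.

(** * The reduction as one pass over the encoding *)

(* Unread input, first variable not yet allocated, output wires of the
   subexpressions still to be read, whether binary digits are being read, number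
   of subformulas of Psi still to be read, and output. Reading past the end of
   the input yields zeros. *)
Record pass : Type := Pass {
  p_unread : seq bool;
  p_fresh : nat;
  p_pending : seq nat;
  p_digits : bool;
  p_psi : nat;
  p_written : seq bool
}.

Definition enc_links (A : Type) (enc : A -> seq bool) (disj : bool) (l : seq A) : seq bool :=
  flatten [seq [:: true; disj; false] ++ enc a | a <- l].

Lemma enc_links_cat (A : Type) (enc : A -> seq bool) disj l1 l2 :
  enc_links enc disj (l1 ++ l2) = enc_links enc disj l1 ++ enc_links enc disj l2.
Proof. by rewrite /enc_links map_cat flatten_cat. Qed.

Lemma enc_qf_disj (A : Type) (enc : A -> seq bool) l a :
  enc_qf enc (qf_disj l a) = enc_links enc true l ++ false :: enc a.
Proof. by elim: l => //= b l ->; rewrite /enc_links /= -catA. Qed.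

Lemma enc_qf_conj (A : Type) (enc : A -> seq bool) l a :
  enc_qf enc (qf_conj l a) = enc_links enc false l ++ false :: enc a.
Proof. by elim: l => //= b l ->; rewrite /enc_links /= -catA. Qed.

Lemma size_enc_unary i : size (enc_unary i) = i.+1.
Proof. by rewrite size_cat size_nseq addn1. Qed.

Lemma index_enc_unary i u : index false (enc_unary i ++ u) = i.
Proof. by rewrite /enc_unary -catA; elim: i => //= i ->. Qed.

Lemma drop_enc_unary i u : drop i.+1 (enc_unary i ++ u) = u.
Proof. by rewrite drop_size_cat // size_enc_unary. Qed.

Definition pending_size (P : seq nat) : nat := sumn [seq c.+1 | c <- P].

Section Pass.

Variables (enc : nat -> latom nat -> seq bool) (s L : nat).

Definition total_vars : nat := s + (L + L).+1.

Local Notation enc_links := (enc_links (enc total_vars)).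

Definition gate_atoms (psi : bool) (g : gate nat) : seq (latom nat) :=
  if psi then gate_equations g else gate_escapes (s + L) g.

Definition gate_bits (q : nat) (g : gate nat) : seq bool :=
  enc_links (q == 0) (gate_atoms (0 < q) g).

Definition head_bits (q f : nat) : seq bool :=
  enc_links (q == 0)
    (if 0 < q then [:: psi_head f.+1 f] else phi_head s (s + L) f.+1 f ++ chain_atoms s L).

Definition last_bits (q : nat) : seq bool :=
  false :: enc total_vars (if 0 < q then psi_last else phi_last s).

Definition term_step (c : nat) (t : pass) : pass :=
  let: Pass u f P d q w := t in
  let i := index false (drop 2 u) in
  if nth false u 0 then
    Pass (drop 2 u) f.+2 [:: f.+1, f & P] d q
      (w ++ gate_bits q (if nth false u 1 then mul_gate s c f.+1 f else add_gate c f.+1 f))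
  else if ~~ nth false u 1 then
    Pass (drop i.+1 (drop 2 u)) f P d q (w ++ gate_bits q (var_gate s c i))
  else if nth false u 2 then
    Pass (drop 3 u) f.+1 (f :: P) true q (w ++ gate_bits q (neg_gate c f))
  else if nth false u 3 then Pass (drop 4 u) f (c :: P) true q w
  else Pass (drop 4 u) f P d q (w ++ gate_bits q (zero_gate c)).

Definition digit_step (c : nat) (t : pass) : pass :=
  let: Pass u f P d q w := t in
  if nth false u 0 then
    Pass (drop 2 u) f.+1 (f :: P) true q (w ++ gate_bits q (digit_gate s (nth false u 1) c f))
  else Pass (drop 1 u) f P false q (w ++ gate_bits q (zero_gate c)).

Definition formula_step (t : pass) : pass :=
  let: Pass u f P d q w := t in
  if nth false u 0 then
    Pass (drop 2 u) f P d (if 0 < q then q.+1 else q) (w ++ [:: true; nth false u 1])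
  else Pass (drop 2 u) f.+2 [:: f.+1, f & P] d q (w ++ head_bits q f).

Definition finish_atom (t : pass) : pass :=
  let: Pass u f P d q w := t in
  if P is [::] then Pass u f [::] d q.-1 (w ++ last_bits q) else t.

Definition step (t : pass) : pass :=
  let: Pass u f P d q w := t in
  if u is [::] then t
  else if P is c :: P' then
    finish_atom ((if d then digit_step else term_step) c (Pass u f P' d q w))
  else formula_step t.

(* The weight 2 B + 3 of an unread bit pays for the wires pushed by a step. *)
Definition pass_bounded (B : nat) (t : pass) : Prop :=
  [/\ total_vars <= B, p_fresh t + 2 * size (p_unread t) <= B,
      p_psi t + size (p_unread t) <= B &
      pending_size (p_pending t) + (2 * B + 3) * size (p_unread t)
        <= (2 * B + 3) * B.+1].

Definition consumes (t t' : pass) : Prop :=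
  [/\ size (p_unread t') < size (p_unread t),
      p_fresh t' + 2 * size (p_unread t') <= p_fresh t + 2 * size (p_unread t) &
      p_psi t' + size (p_unread t') <= p_psi t + size (p_unread t)].

Lemma pass_bounded_consumes B t t' : pass_bounded B t -> consumes t t' ->
  pending_size (p_pending t') <= pending_size (p_pending t) + 2 * p_fresh t + 3 ->
  pass_bounded B t'.
Proof.
move=> [total fresh psi pend] [lt_u le_fresh le_psi le_pend]; split=> //; try lia.
have : (2 * B + 3) * (size (p_unread t')).+1 <= (2 * B + 3) * size (p_unread t).
  by rewrite leq_mul2l lt_u orbT.
by rewrite mulnS; lia.
Qed.

Lemma finish_atom_consumes t t' : consumes t t' -> consumes t (finish_atom t').
Proof. by case: t' => u f [|c P] d q w [/=]; split=> /=; lia. Qed.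

Lemma step_consumes t : p_unread t != [::] ->
  consumes t (step t) /\
  pending_size (p_pending (step t)) <= pending_size (p_pending t) + 2 * p_fresh t + 3.
Proof.
case: t => [[|x u] f [|c P] d q w] // _.
- rewrite /step /formula_step; case: ifP => _.
  + by split; [split|] => /=; rewrite ?size_drop /=; case: (0 < q); lia.
  + by split; [split|] => /=; rewrite /pending_size /= ?size_drop /=; lia.
- rewrite /step; set t' := (if d then _ else _) c (Pass (x :: u) f P d q w).
  suff [le le'] : consumes (Pass (x :: u) f (c :: P) d q w) t' /\
      pending_size (p_pending t') <= c.+1 + pending_size P + 2 * f + 3.
    split; first exact: finish_atom_consumes.
    by case: t' le le' => ? ? [].
  rewrite /t'; case: d {t'}; rewrite /digit_step /term_step; do ! case: ifP => _.
  all: by split; [split|] => /=; rewrite /pending_size /= ?size_drop /=; lia.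
Qed.

Lemma iter_step_done n t : p_unread t = [::] -> iter n step t = t.
Proof. by case: t => u f P d q w /= ->; elim: n => //= n ->. Qed.

Lemma iter_step_bounded B n t : pass_bounded B t -> pass_bounded B (iter n step t).
Proof.
elim: n => //= n IH /IH bound; case: (eqVneq (p_unread (iter n step t)) [::]) => [done|ne].
  by have -> : step (iter n step t) = iter n step t := iter_step_done 1 done.
by have [le le'] := step_consumes ne; exact: pass_bounded_consumes le le'.
Qed.

Definition reaches (t t' : pass) : Prop := exists n, iter n step t = t'.

Lemma reaches_trans t1 t2 t3 : reaches t1 t2 -> reaches t2 t3 -> reaches t1 t3.
Proof. by move=> [n <-] [k <-]; exists (k + n); rewrite iterD. Qed.

Lemma reaches_step t t' t'' : step t = t' -> reaches t' t'' -> reaches t t''.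
Proof. by move=> <-; apply: reaches_trans; exists 1. Qed.

Lemma reaches_refl t : reaches t t.
Proof. by exists 0. Qed.

Definition gates_bits (q : nat) (l : seq (gate nat)) : seq bool := flatten (map (gate_bits q) l).

Lemma gates_bits_cat q l1 l2 : gates_bits q (l1 ++ l2) = gates_bits q l1 ++ gates_bits q l2.
Proof. by rewrite /gates_bits map_cat flatten_cat. Qed.

Lemma gates_bits_links q l :
  gates_bits q l = enc_links (q == 0) (flatten [seq gate_atoms (0 < q) g | g <- l]).
Proof. by elim: l => //= g l IH; rewrite enc_links_cat -IH. Qed.

Lemma digits_reaches p c u f P q w :
  reaches (Pass (enc_pos p ++ u) f (c :: P) true q w)
    (finish_atom (Pass u (f + expr_wires (expr_of_pos p)) P false q
       (w ++ gates_bits q (expr_gates s c f (expr_of_pos p))))).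
Proof.
rewrite /enc_pos -catA; elim: p c f w => [p IH|p IH|] c f w.
1,2: apply: reaches_step; first by rewrite /step /= ?drop0.
1,2: by rewrite /= -addSnnS /gates_bits /= catA; exact: IH.
apply: reaches_step; first by rewrite /step /= ?drop0.
apply: reaches_step; first by rewrite /step /= ?drop0.
by rewrite /= addn1 /gates_bits /= cats0 catA; exact: reaches_refl.
Qed.

Lemma term_reaches t c u f P q w :
  reaches (Pass (enc_term t ++ u) f (c :: P) false q w)
    (finish_atom (Pass u (f + expr_wires (expr_of_term t)) P false q
       (w ++ gates_bits q (expr_gates s c f (expr_of_term t))))).
Proof.
elim: t c u f P w => [i|z|a IHa b IHb|a IHa b IHb] c u f P w.
- apply: reaches_step; first by rewrite /step /= ?drop0 index_enc_unary drop_enc_unary.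
  by rewrite addn0 /gates_bits /= cats0; exact: reaches_refl.
- case: z => [|p|p].
  + apply: reaches_step; first by rewrite /step /= ?drop0.
    by rewrite addn0 /gates_bits /= cats0; exact: reaches_refl.
  + by apply: reaches_step (digits_reaches _ _ _ _ _ _ _); rewrite /step /= ?drop0.
  + apply: reaches_step; first by rewrite /step /= ?drop0.
    have := digits_reaches p f u f.+1 P q (w ++ gate_bits q (neg_gate c f)).
    by rewrite addSnnS -catA.
all: apply: reaches_step; first by rewrite /step /= ?drop0 -catA.
all: apply: reaches_trans (IHa _ _ _ _ _) _; rewrite [finish_atom (Pass _ _ (_ :: _) _ _ _)]/=.
all: apply: reaches_trans (IHb _ _ _ _ _) _; rewrite /= -!addSnnS addnA.
all: rewrite /gates_bits /= map_cat flatten_cat !catA; exact: reaches_refl.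
Qed.

Definition red_atom (psi : bool) (f : nat) (a : tatom) : qf (latom nat) :=
  if psi then psi_atom s f a else phi_atom s L f a.

Lemma atom_reaches a u f q w :
  reaches (Pass (false :: enc_tatom a ++ u) f [::] false q w)
    (Pass u (f + atom_wires a) [::] false q.-1
       (w ++ enc_qf (enc total_vars) (red_atom (0 < q) f a))).
Proof.
have both b l r : atom_lhs a = expr_of_term l -> atom_rhs a = expr_of_term r ->
    reaches (Pass [:: false, b & enc_term l ++ enc_term r ++ u] f [::] false q w)
      (Pass u (f + atom_wires a) [::] false q.-1
        (w ++ enc_qf (enc total_vars) (red_atom (0 < q) f a))).
  move=> eq_l eq_r; apply: reaches_step; first by rewrite /step /= ?drop0.
  apply: reaches_trans (term_reaches _ _ _ _ _ _ _) _.
  apply: reaches_trans (term_reaches _ _ _ _ _ _ _) _.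
  rewrite -eq_l -eq_r /= -!catA [gates_bits q _ ++ _]catA -gates_bits_cat -/(atom_gates s f a).
  have -> : f.+2 + expr_wires (atom_lhs a) + expr_wires (atom_rhs a) = f + atom_wires a.
    by rewrite /atom_wires; lia.
  rewrite gates_bits_links /head_bits /last_bits /red_atom.
  case: posnP => _; first by rewrite enc_qf_disj !enc_links_cat -!catA; exact: reaches_refl.
  by rewrite enc_qf_conj /= -!catA; exact: reaches_refl.
by case: a both => t u' both; rewrite /= -catA; apply: both.
Qed.

Lemma qf_reaches phi u f q w :
  reaches (Pass (enc_qf enc_tatom phi ++ u) f [::] false q w)
    (Pass u (f + qf_wires phi) [::] false q.-1
       (w ++ enc_qf (enc total_vars) (red_qf (0 < q) s L f phi))).
Proof.
elim: phi u f q w => [a|p IHp r IHr|p IHp r IHr] u f q w; first exact: atom_reaches.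
all: have [psi0 q0] : (0 < (if 0 < q then q.+1 else q)) = (0 < q) /\
    (if 0 < q then q.+1 else q).-1 = q by case: (q).
all: apply: reaches_step; first by rewrite /step /= ?drop0 -catA.
all: apply: reaches_trans (IHp _ _ _ _) _; rewrite q0.
all: apply: reaches_trans (IHr _ _ _ _) _; rewrite psi0 /= addnA -!catA; exact: reaches_refl.
Qed.

Lemma iter_step_end B n t : pass_bounded B t -> size (p_unread t) <= n ->
  p_unread (iter n step t) = [::].
Proof.
elim: n t => [|n IH] t bound le_n; first by case: (p_unread t) le_n.
case: (eqVneq (p_unread t) [::]) => [done|ne]; first by rewrite iter_step_done.
have [le le'] := step_consumes ne; have [lt_u _ _] := le.
by rewrite iterSr; apply: IH; [exact: pass_bounded_consumes le le' | lia].
Qed.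

Lemma iter_step_reaches B n t t' : pass_bounded B t -> size (p_unread t) <= n ->
  reaches t t' -> p_unread t' = [::] -> iter n step t = t'.
Proof.
move=> bound le_n [k eq_t'] done'; have done := iter_step_end bound le_n.
by rewrite -(iter_step_done k done) -iterD addnC iterD eq_t' iter_step_done.
Qed.

End Pass.

Section Translation.

Variable enc : nat -> latom nat -> seq bool.

Implicit Types (w u : seq bool).

Definition header_tag w : seq bool :=
  if head false w then [:: true] else [:: false; nth false w 1].

Definition after_tag w : seq bool := drop (if head false w then 1 else 2) w.
Definition exists_dim w : nat := index false (after_tag w).
Definition after_exists_dim w : seq bool := drop (exists_dim w).+1 (after_tag w).
Definition forall_dim w : nat := index false (after_exists_dim w).
Definition matrix_bits w : seq bool := drop (forall_dim w).+1 (after_exists_dim w).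

Definition start w : pass :=
  Pass (matrix_bits w) (exists_dim w + forall_dim w + size w).+1 [::] false (head false w)
    (header_tag w ++ enc_unary (exists_dim w) ++
     enc_unary (forall_dim w + (size w + size w).+1)).

Definition translate w : seq bool :=
  p_written (iter (size w) (step enc (exists_dim w + forall_dim w) (size w)) (start w)).

Lemma header_sizes w : [/\ size (after_tag w) <= size w, size (after_exists_dim w) <= size w,
  exists_dim w <= size w, forall_dim w <= size w & size (matrix_bits w) <= size w].
Proof.
have le_tag : size (after_tag w) <= size w by rewrite size_drop leq_subr.
have le_exists : size (after_exists_dim w) <= size w by rewrite size_drop; lia.
split=> //; last by rewrite size_drop; lia.
- exact: leq_trans (index_size false (after_tag w)) le_tag.
- exact: leq_trans (index_size false (after_exists_dim w)) le_exists.
Qed.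

Lemma start_bounded w :
  pass_bounded (exists_dim w + forall_dim w) (size w) (5 * size w + 2) (start w).
Proof.
have [_ _ le_m le_n le_u] := header_sizes w.
split=> /=; rewrite /total_vars; try lia.
by rewrite /pending_size add0n leq_mul2l; apply/orP; right; lia.
Qed.

Lemma translate_reaches w t :
  reaches enc (exists_dim w + forall_dim w) (size w) (start w) t -> p_unread t = [::] ->
  translate w = p_written t.
Proof.
have [_ _ _ _ le_u] := header_sizes w => reach done.
by rewrite /translate (iter_step_reaches (start_bounded w) le_u reach done).
Qed.

Lemma start_header tag m n u (w := tag ++ enc_unary m ++ enc_unary n ++ u) :
  tag = header_tag tag ->
  exists_dim w + forall_dim w = m + n /\
  start w = Pass u (m + n + size w).+1 [::] false (head false tag)
    (tag ++ enc_unary m ++ enc_unary (n + (size w + size w).+1)).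
Proof.
move=> tagE; have [headE tagwE afterE] : [/\ head false w = head false tag, header_tag w = tag &
    after_tag w = enc_unary m ++ enc_unary n ++ u].
  by rewrite /w /header_tag /after_tag; move: tagE; rewrite /header_tag;
    case: tag {w} => [|[] [|b [|? ?]]] //= _; rewrite ?drop0.
have mE : exists_dim w = m by rewrite /exists_dim afterE index_enc_unary.
have after_mE : after_exists_dim w = enc_unary n ++ u.
  by rewrite /after_exists_dim mE afterE drop_enc_unary.
have nE : forall_dim w = n by rewrite /forall_dim after_mE index_enc_unary.
by rewrite /start /matrix_bits nE mE after_mE drop_enc_unary headE tagwE.
Qed.

Lemma translate_phi b m n phi
    (w := [:: false; b] ++ enc_unary m ++ enc_unary n ++ enc_qf enc_tatom phi)
    (L := size w) :
  translate w = [:: false; b] ++ enc_unary m ++ enc_unary (n + (L + L).+1) ++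
    enc_qf (enc (m + (n + (L + L).+1))) (red_qf false (m + n) L (m + n + L).+1 phi).
Proof.
have [dimsE startE] := @start_header [:: false; b] m n (enc_qf enc_tatom phi) erefl.
rewrite -/w in dimsE startE.
have := @qf_reaches enc (exists_dim w + forall_dim w) L phi [::] (m + n + L).+1 0
  ([:: false; b] ++ enc_unary m ++ enc_unary (n + (L + L).+1)).
rewrite cats0 -startE => /translate_reaches -> //.
by rewrite dimsE /total_vars /= -addnA -!catA.
Qed.

Lemma translate_sentence s (w := enc_sentence enc_tatom s) (L := size w) :
  translate w = enc_sentence (enc (nvars (red_sentence L s))) (red_sentence L s).
Proof.
rewrite {}/L {}/w; case: s => [m n phi|m n phi|m n psi phi]; [exact: translate_phi..|].
set w := enc_sentence _ _; set L := size w.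
have [dimsE startE] :=
  @start_header [:: true] m n (enc_qf enc_tatom psi ++ enc_qf enc_tatom phi) erefl.
rewrite -/w in dimsE startE.
pose header := [:: true] ++ enc_unary m ++ enc_unary (n + (L + L).+1).
have := @qf_reaches enc (exists_dim w + forall_dim w) L psi (enc_qf enc_tatom phi)
  (m + n + L).+1 1 header.
rewrite -startE => reach_phi.
have := @qf_reaches enc (exists_dim w + forall_dim w) L phi [::]
  ((m + n + L).+1 + qf_wires psi) 0.
rewrite cats0 => reach_end.
rewrite (translate_reaches (reaches_trans reach_phi (reach_end _))) //.
by rewrite dimsE /total_vars /header /= -addnA -!catA.
Qed.

End Translation.

Lemma expr_of_pos_wires_le p : expr_wires (expr_of_pos p) <= size (enc_pos_digits p).
Proof. by elim: p => [q|q|] //=; lia. Qed.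

Lemma expr_of_term_wires_le t : expr_wires (expr_of_term t) <= size (enc_term t).
Proof.
elim: t => [i|[|p|p]|a IHa b IHb|a IHa b IHb] //=; rewrite /enc_pos ?size_cat; try lia.
all: by have := expr_of_pos_wires_le p; rewrite ?size_cat; lia.
Qed.

Lemma qf_wires_le phi : qf_wires phi <= size (enc_qf enc_tatom phi).
Proof.
elim: phi => [a|p IHp q IHq|p IHp q IHq] /=; rewrite ?size_cat; try lia.
by case: a => t u; rewrite /atom_wires /= size_cat; have := expr_of_term_wires_le t;
  have := expr_of_term_wires_le u; lia.
Qed.

Lemma sentence_wires_le s : sentence_wires s <= size (enc_sentence enc_tatom s).
Proof.
case: s => [m n phi|m n phi|m n psi phi] /=; rewrite !size_cat; have := qf_wires_le phi; try lia.
by have := qf_wires_le psi; lia.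
Qed.

(** * Counters and buffers *)

(* [Node] is the output wire of the gate being emitted, [Index] a variable index
   read from the input, [PsiLeft] the number of subformulas of Psi still to be
   read, and [Digits] is nonzero while binary digits are read. [Pos] and [Link]
   count the iterations of loops that emit exponents and chain atoms. *)
Inductive counter : Type :=
| Scale | InputLen | Fresh | Node | Index | PsiLeft | Digits | Pos | Link.

Definition counters : seq counter :=
  [:: Scale; InputLen; Fresh; Node; Index; PsiLeft; Digits; Pos; Link].

Definition counter_code (c : counter) : nat :=
  match c with
  | Scale => 0 | InputLen => 1 | Fresh => 2 | Node => 3 | Index => 4 | PsiLeft => 5
  | Digits => 6 | Pos => 7 | Link => 8
  end.

Lemma counter_codeK : cancel counter_code (nth Scale counters).
Proof. by case. Qed.

HB.instance Definition _ := Countable.copy counter (can_type counter_codeK).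

Lemma counters_enum : Finite.axiom counters.
Proof. by case. Qed.

HB.instance Definition _ := isFinite.Build counter counters_enum.

(* The counters are stacks in unary; [Tmp], [Left] and [Right] are scratch stacks. *)
Inductive reg : Type := Ctr of counter | Tmp | Left | Right | Input | Pending | Output.

Coercion Ctr : counter >-> reg.

Definition reg_code (r : reg) : counter + 'I_6 :=
  match r with
  | Ctr c => inl c
  | Tmp => inr (@Ordinal 6 0 isT) | Left => inr (@Ordinal 6 1 isT)
  | Right => inr (@Ordinal 6 2 isT) | Input => inr (@Ordinal 6 3 isT)
  | Pending => inr (@Ordinal 6 4 isT) | Output => inr (@Ordinal 6 5 isT)
  end.

Definition reg_decode (x : counter + 'I_6) : reg :=
  match x with
  | inl c => Ctr c
  | inr i => nth Tmp [:: Tmp; Left; Right; Input; Pending; Output] i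
  end.

Lemma reg_codeK : cancel reg_code reg_decode.
Proof. by case. Qed.

HB.instance Definition _ := Finite.copy reg (can_type reg_codeK).

Record state : Type := State {
  num : counter -> nat;
  unread : seq bool;
  pending : seq nat;
  written : seq bool
}.

Definition contents (x : state) : memory reg := fun r =>
  match r with
  | Ctr c => nseq (num x c) true
  | Input => unread x
  | Pending => flatten (map enc_unary (pending x))
  | Output => rev (written x)
  | Tmp | Left | Right => [::]
  end.

Definition bounded (N : nat) (x : state) : Prop :=
  [/\ forall c, num x c <= N, size (unread x) <= N & pending_size (pending x) <= N].

Lemma bounded_le N N' x : bounded N x -> N <= N' -> bounded N' x.
Proof. by move=> [num_le u_le p_le] le_N; split=> [c||]; apply: leq_trans le_N. Qed.

Lemma state_ext x y : num x =1 num y -> unread x = unread y -> pending x = pending y ->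
  written x = written y -> x = y.
Proof.
by case: x y => nx ux px wx [ny uy py wy] /= /functional_extensionality -> -> -> ->.
Qed.

Lemma size_pending x : size (contents x Pending) = pending_size (pending x).
Proof.
rewrite /= size_flatten /shape -map_comp; congr sumn.
by apply: eq_map => c /=; exact: size_enc_unary.
Qed.

Definition set_num (c : counter) (n : nat) (x : state) : state :=
  State (upd (num x) c n) (unread x) (pending x) (written x).

Definition put (bs : seq bool) (x : state) : state :=
  State (num x) (unread x) (pending x) (written x ++ bs).

Lemma put_cat x bs bs' : put bs' (put bs x) = put (bs ++ bs') x.
Proof. by rewrite /put catA. Qed.

Lemma contents_set_num c n x : upd (contents x) (Ctr c) (nseq n true) =1 contents (set_num c n x).
Proof.
move=> r; rewrite /upd; case: eqP => [->|ne] /=; first by rewrite upd_same.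
by case: r ne => //= d ne; rewrite upd_other //; apply/eqP => eq_dc; rewrite eq_dc in ne.
Qed.

Lemma contents_put bs x :
  upd (contents x) Output (rev bs ++ rev (written x)) =1 contents (put bs x).
Proof. by case=> [c||||||]; rewrite /upd //= rev_cat. Qed.

Lemma bounded_put N bs x : bounded N x -> bounded N (put bs x).
Proof. by []. Qed.

Lemma bounded_set_num N c n x : bounded N x -> n <= N -> bounded N (set_num c n x).
Proof.
move=> [num_le u_le p_le] n_le; split=> // d; rewrite /= /upd.
by case: eqP.
Qed.

(* The variable whose index is the sum of some counters and a constant. *)
Definition tvar : Type := seq counter * nat.

(* The order of the additions makes [inst e ([:: c], 0)] convertible to [e c]. *)
Definition inst (e : counter -> nat) (a : tvar) : nat := foldl (fun n c => n + e c) a.2 a.1.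

Lemma instE e a : inst e a = sumn (map e a.1) + a.2.
Proof.
case: a => cs n; rewrite /inst /=; elim: cs n => [|c cs IH] n //=.
by rewrite IH; lia.
Qed.

Lemma inst_le e a N : (forall c, e c <= N) -> inst e a <= size a.1 * N + a.2.
Proof.
move=> e_le; rewrite instE leq_add2r; elim: a.1 => //= c cs IH.
by rewrite mulSn leq_add.
Qed.

Lemma inst_upd e a c n : c \notin a.1 -> inst (upd e c n) a = inst e a.
Proof.
move=> notin; rewrite !instE; congr (sumn _ + _); apply/eq_in_map => d d_in.
by rewrite upd_other //; apply: contra notin => /eqP <-.
Qed.

Local Notation runs := (Stack.runs Output).
Local Notation push := (Stack.push Output).
Local Notation pop := (Stack.pop Output).
Local Notation nonempty := (Stack.nonempty Output).
Local Notation clear := (Stack.clear Output).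
Local Notation copy := (Stack.copy Output).
Local Notation push_seq := (Stack.push_seq Output).
Local Notation read_unary := (Stack.read_unary Output).

Definition unary_counters (N : nat) (e : counter -> nat) (m : memory reg) : Prop :=
  [/\ forall c, m (Ctr c) = nseq (e c) true, forall c, e c <= N & m Tmp = [::]].

Definition push_var (dst : reg) (a : tvar) : tprog :=
  foldr (fun c p => TSeq (copy (Ctr c) Tmp [:: dst]) p) (push_seq dst (nseq a.2 true)) a.1.

Definition push_var_time (a : tvar) (N : nat) : nat := size a.1 * (N.+1 * 11) + a.2.+1.

Definition is_buffer (r : reg) : bool := if r is (Ctr _ | Tmp) then false else true.

Lemma runs_push_var dst a N e m : is_buffer dst -> unary_counters N e m ->
  runs (push_var dst a) m (push_var_time a N) true (upd m dst (nseq (inst e a) true ++ m dst)).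
Proof.
case: a => cs n buf; rewrite instE /push_var /push_var_time /=.
elim: cs m => [|c cs IH] m [mc e_le tmp] /=.
  apply: runs_le (runs_eq (runs_push_seq _ _ _ _) _) _ => [r|]; last by rewrite size_nseq.
  by rewrite rev_nseq.
have dst_c : Ctr c == dst = false by case: (dst) buf.
have uniq_copy : uniq [:: Tmp; Ctr c; dst] by case: (dst) buf.
have run1 := runs_copy Output uniq_copy tmp; rewrite mc size_nseq in run1.
set m1 := pushed _ _ _ in run1.
have m1E : m1 = upd m dst (nseq (e c) true ++ m dst).
  apply: functional_extensionality => r; rewrite /m1 /pushed /upd inE.
  by case: eqP => [->|].
have counters1 : unary_counters N e m1.
  by rewrite m1E; split=> // [d|]; rewrite upd_other //; case: (dst) buf.
apply: runs_le (runs_eq (runs_seq run1 (IH m1 counters1)) _) _ => [r|].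
  rewrite m1E; case: (eqVneq r dst) => [->|ne]; last by rewrite !upd_other.
  by rewrite !upd_same catA -nseqD; congr (nseq _ _ ++ _); lia.
by rewrite /=; have := e_le c; nia.
Qed.

Definition cancel_units : tprog :=
  TLoop (TIf (nonempty Left)
           (TIf (nonempty Right) (TSeq (pop Left) (TSeq (pop Right) (tret true))) (tret false))
           (tret false)).

Lemma runs_cancel_units m a b : m Left = nseq a true -> m Right = nseq b true ->
  runs cancel_units m ((minn a b).+1 * 5) true
    (upd (upd m Left (nseq (a - b) true)) Right (nseq (b - a) true)).
Proof.
move=> left_a right_b; set n := minn a b.
pose M k := upd (upd m Left (nseq (a - k) true)) Right (nseq (b - k) true).
have M0 : M 0 = m.
  by apply: functional_extensionality => -[c||||||]; rewrite /M /upd //= subn0.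
have Mn : M n = upd (upd m Left (nseq (a - b) true)) Right (nseq (b - a) true).
  by congr (upd (upd m Left (nseq _ _)) Right (nseq _ _)); rewrite /n; lia.
rewrite -Mn -{1}M0; apply: runs_loop => [k lt_k|].
- have eq_a : a - k = (a - k.+1).+1 by rewrite /n in lt_k; lia.
  have eq_b : b - k = (b - k.+1).+1 by rewrite /n in lt_k; lia.
  apply: (@runs_le _ _ _ _ (1 + (1 + (1 + (1 + 1))))) => //.
  apply: runs_if (runs_nonempty _ _ _) _; rewrite {1}/M upd_other // upd_same eq_a.
  apply: runs_if (runs_nonempty _ _ _) _; rewrite {1}/M upd_same eq_b.
  apply: runs_seq (runs_pop _ _ _) _; apply: runs_seq (runs_pop _ _ _) _.
  apply: runs_eq (runs_ret _ _ _) _ => -[c||||||]; rewrite /M /upd //=.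
  + by rewrite eq_a.
  + by rewrite eq_b.
- apply: (@runs_le _ _ _ _ (1 + (1 + 1))) => //; apply: runs_if (runs_nonempty _ _ _) _.
  rewrite {1}/M upd_other // upd_same; case eq_a: (a - n) => [|a'].
    exact: runs_le (runs_ret _ _ _) _.
  have eq_b : b - n = 0 by rewrite /n in eq_a *; lia.
  apply: runs_if (runs_nonempty _ _ _) _; rewrite {1}/M upd_same eq_b.
  exact: runs_ret.
Qed.

Definition reset_buffers (b : bool) : tprog := TSeq (clear Left) (TSeq (clear Right) (tret b)).

Definition var_eq (a b : tvar) : tprog :=
  TSeq (push_var Left a) (TSeq (push_var Right b) (TSeq cancel_units
    (TIf (nonempty Left) (reset_buffers false)
      (TIf (nonempty Right) (reset_buffers false) (reset_buffers true))))).

Definition inst_bound (a : tvar) (N : nat) : nat := size a.1 * N + a.2.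

Definition var_eq_time (a b : tvar) (N : nat) : nat :=
  push_var_time a N + push_var_time b N + (inst_bound a N + inst_bound b N).+1 * 13 + 3.

Lemma poly_bounded_inst_bound a : poly_bounded (inst_bound a).
Proof. by rewrite /inst_bound; prove_poly_bounded. Qed.

Lemma poly_bounded_push_var_time a : poly_bounded (push_var_time a).
Proof.
apply: (poly_bounded_le (u := fun N => size a.1 * ((N + 1) * 11) + a.2.+1)) => [|N].
  by prove_poly_bounded.
by rewrite addn1.
Qed.

Lemma poly_bounded_var_eq_time a b : poly_bounded (var_eq_time a b).
Proof.
have [pa pb] := (poly_bounded_inst_bound a, poly_bounded_inst_bound b).
have [ta tb] := (poly_bounded_push_var_time a, poly_bounded_push_var_time b).
apply: (poly_bounded_le (u := fun N =>
  push_var_time a N + push_var_time b N + (inst_bound a N + inst_bound b N + 1) * 13 + 3)) => [|N].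
  by prove_poly_bounded.
by rewrite addn1.
Qed.

Lemma bounded_unary_counters N x : bounded N x -> unary_counters N (num x) (contents x).
Proof. by case. Qed.

Lemma runs_var_eq a b N x : bounded N x ->
  runs (var_eq a b) (contents x) (var_eq_time a b N) (inst (num x) a == inst (num x) b)
    (contents x).
Proof.
move=> bx; have cx := bounded_unary_counters bx; case: (cx) => _ num_le _.
have [le_a le_b] := (inst_le a num_le, inst_le b num_le).
set va := inst _ a in le_a *; set vb := inst _ b in le_b *.
have run_a := runs_push_var (dst := Left) a isT cx; rewrite cats0 -/va in run_a.
set m1 := upd _ _ _ in run_a.
have c1 : unary_counters N (num x) m1 by case: cx.
have run_b := runs_push_var (dst := Right) b isT c1; rewrite cats0 -/vb in run_b.
set m2 := upd _ _ _ in run_b.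
have run_cancel := @runs_cancel_units m2 va vb erefl erefl.
set m3 := upd _ _ _ in run_cancel.
have reset r : runs (reset_buffers r) m3 ((va + vb).+1 * 8 + 1) r (contents x).
  apply: runs_le (runs_seq (runs_clear _ _ _) (runs_seq (runs_clear _ _ _) _)) _.
    by apply: runs_eq (runs_ret _ _ _) _ => -[c||||||].
  by rewrite /= !size_nseq; lia.
have run_test : runs (TIf (nonempty Left) (reset_buffers false) (TIf (nonempty Right)
    (reset_buffers false) (reset_buffers true))) m3 ((va + vb).+1 * 8 + 3) (va == vb) (contents x).
  apply: (@runs_le _ _ _ _ (1 + (1 + ((va + vb).+1 * 8 + 1)))); last lia.
  apply: runs_if (runs_nonempty _ _ _) _; have -> : m3 Left = nseq (va - vb) true by [].
  case: (ltngtP va vb) => [lt|gt|eq].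
  - have -> : va - vb = 0 by lia.
    apply: runs_if (runs_nonempty _ _ _) _; have -> : m3 Right = nseq (vb - va) true by [].
    by rewrite -(prednK (n := vb - va)) ?subn_gt0 //=; exact: reset.
  - rewrite -(prednK (n := va - vb)) ?subn_gt0 //=.
    by apply: runs_le (reset false) _; lia.
  - have -> : va - vb = 0 by rewrite eq subnn.
    apply: runs_if (runs_nonempty _ _ _) _.
    have -> : m3 Right = nseq (vb - va) true by [].
    have -> : vb - va = 0 by rewrite eq subnn.
    exact: reset.
apply: runs_le (runs_seq run_a (runs_seq run_b (runs_seq run_cancel run_test))) _.
by rewrite /var_eq_time /inst_bound; lia.
Qed.

(** * Bit strings that can be written in polynomial time *)

Definition zero_on (idle : seq counter) (e : counter -> nat) : Prop :=
  forall c, c \in idle -> e c = 0.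

(* The program may use the [idle] counters, which are zero before and after it. *)
Definition emittable (idle : seq counter) (bits : (counter -> nat) -> seq bool) : Prop :=
  exists p t, poly_bounded t /\ forall N x, zero_on idle (num x) -> bounded N x ->
    runs p (contents x) (t N) true (contents (put (bits (num x)) x)).

Lemma emittable_ext idle b b' :
  (forall e, zero_on idle e -> b e = b' e) -> emittable idle b -> emittable idle b'.
Proof.
move=> eq_b [p [t [pt run]]]; exists p, t; split=> // N x zx bx.
by rewrite -eq_b //; exact: run.
Qed.

Lemma emittable_widen idle idle' b :
  {subset idle <= idle'} -> emittable idle b -> emittable idle' b.
Proof.
move=> sub [p [t [pt run]]]; exists p, t; split=> // N x zx.
by apply: run => c c_in; apply/zx/sub.
Qed.

Lemma emittable_const idle bs : emittable idle (fun=> bs).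
Proof.
exists (push_seq Output bs), (fun=> (size bs).+1); split; first exact: poly_bounded_const.
by move=> N x _ _; apply: runs_eq (runs_push_seq _ _ _ _) _ => r; rewrite contents_put.
Qed.

Lemma emittable_cat idle b b' : emittable idle b -> emittable idle b' ->
  emittable idle (fun e => b e ++ b' e).
Proof.
move=> [p [t [pt run]]] [p' [t' [pt' run']]].
exists (TSeq p p'), (fun N => t N + t' N); split; first exact: poly_boundedD.
move=> N x zx bx; rewrite -put_cat.
exact: runs_seq (run N x zx bx) (run' N (put (b (num x)) x) zx bx).
Qed.

Lemma emittable_flatten (A : eqType) idle (l : seq A) (b : A -> (counter -> nat) -> seq bool) :
  (forall a, a \in l -> emittable idle (b a)) ->
  emittable idle (fun e => flatten [seq b a e | a <- l]).
Proof.
elim: l => [|a l IH] em; first exact: emittable_const.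
apply: (emittable_cat (em a (mem_head a l))); apply: IH => a' a'_in.
by apply: em; rewrite inE a'_in orbT.
Qed.

Lemma emittable_var idle a : emittable idle (fun e => nseq (inst e a) true).
Proof.
exists (push_var Output a), (push_var_time a); split; first exact: poly_bounded_push_var_time.
move=> N x _ /bounded_unary_counters cx.
have run := runs_push_var (dst := Output) a isT cx.
apply: runs_eq run _ => r.
by rewrite -contents_put rev_nseq.
Qed.

Lemma emittable_enc_var idle a : emittable idle (fun e => enc_unary (inst e a)).
Proof. exact: emittable_cat (emittable_var _ _) (emittable_const _ _). Qed.

Lemma emittable_if_pos idle c b b' : emittable idle b -> emittable idle b' ->
  emittable idle (fun e => if 0 < e c then b e else b' e).
Proof.
move=> [p [t [pt run]]] [p' [t' [pt' run']]].
exists (TIf (nonempty (Ctr c)) p p'), (fun N => 1 + (t N + t' N)); split.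
  by prove_poly_bounded.
move=> N x zx bx; apply: runs_if (runs_nonempty _ _ _) _.
rewrite /= -size_eq0 size_nseq -lt0n.
case: ifP => _; first by apply: runs_le (run N x zx bx) _; rewrite leq_addr.
by apply: runs_le (run' N x zx bx) _; rewrite leq_addl.
Qed.

Lemma emittable_if_eq idle v v' b b' : emittable idle b -> emittable idle b' ->
  emittable idle (fun e => if inst e v == inst e v' then b e else b' e).
Proof.
move=> [p [t [pt run]]] [p' [t' [pt' run']]]; have pv := poly_bounded_var_eq_time v v'.
exists (TIf (var_eq v v') p p'), (fun N => var_eq_time v v' N + (t N + t' N)); split.
  by prove_poly_bounded.
move=> N x zx bx; apply: runs_if (runs_var_eq _ _ bx) _.
case: ifP => _; first by apply: runs_le (run N x zx bx) _; rewrite leq_addr.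
by apply: runs_le (run' N x zx bx) _; rewrite leq_addl.
Qed.

Lemma set_num_id c x : set_num c (num x c) x = x.
Proof. by apply: state_ext => // d; rewrite /= upd_id. Qed.

Lemma set_num_set_num c n n' x : set_num c n (set_num c n' x) = set_num c n x.
Proof. by apply: state_ext => // d; rewrite /= /upd; case: eqP. Qed.

Lemma set_num_put c n bs x : set_num c n (put bs x) = put bs (set_num c n x).
Proof. by []. Qed.

Lemma zero_on_set_num idle c n x : c \notin idle -> zero_on idle (num x) ->
  zero_on idle (num (set_num c n x)).
Proof.
by move=> c_idle zx d d_in; rewrite /= upd_other ?zx //; apply: contraNneq c_idle => <-.
Qed.

Lemma runs_push_counter (c : counter) x :
  runs (push c true) (contents x) 1 true (contents (set_num c (num x c).+1 x)).
Proof. by apply: runs_eq (runs_push _ _ _ _) _ => r; rewrite -contents_set_num. Qed.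

Lemma runs_clear_counter (c : counter) x :
  runs (clear c) (contents x) ((num x c).+1 * 4) true (contents (set_num c 0 x)).
Proof.
have := runs_clear Output (Ctr c) (contents x); rewrite /= size_nseq => run.
by apply: runs_eq run _; exact: (contents_set_num c 0).
Qed.

Lemma flatten_iota_recr (A : Type) (f : nat -> seq A) n :
  flatten [seq f i | i <- iota 0 n.+1] = flatten [seq f i | i <- iota 0 n] ++ f n.
Proof. by rewrite -addn1 iotaD map_cat flatten_cat /= cats0. Qed.

Definition for_loop (v : counter) (lim : tvar) (p : tprog) : tprog :=
  TSeq
    (TLoop (TIf (var_eq ([:: v], 0) lim) (tret false) (TSeq p (TSeq (push v true) (tret true)))))
    (clear v).

Lemma runs_for_loop N v lim p n t (X : nat -> state) :
  (forall k, k <= n -> [/\ bounded N (X k), num (X k) v = k & inst (num (X k)) lim = n]) ->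
  (forall k, k < n -> runs p (contents (X k)) t true (contents (set_num v k (X k.+1)))) ->
  runs (for_loop v lim p) (contents (X 0)) (n.+1 * (var_eq_time ([:: v], 0) lim N + (t + 6)))
    true (contents (set_num v 0 (X n))).
Proof.
move=> inv body; rewrite /for_loop; have num_v k : k <= n -> inst (num (X k)) ([:: v], 0) = k.
  by move=> /inv [].
set iteration := TIf _ _ _.
pose t' := var_eq_time ([:: v], 0) lim N + (t + 2).
have again k : k < n -> runs iteration (contents (X k)) t' true (contents (X k.+1)).
  move=> lt_k; have [bX _ lim_n] := inv k (ltnW lt_k); have [_ num_k _] := inv k.+1 lt_k.
  apply: runs_if (runs_var_eq _ _ bX) _; rewrite num_v ?(ltnW lt_k) // lim_n ltn_eqF //.
  apply: runs_seq (body k lt_k) (runs_seq (runs_push_counter _ _) _).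
  rewrite set_num_set_num [num _ v]/= upd_same -[in set_num _ _]num_k set_num_id.
  exact: runs_ret.
have [bXn num_n lim_n] := inv n (leqnn n).
have stop : runs iteration (contents (X n)) t' false (contents (X n)).
  apply: runs_le (runs_if (runs_var_eq _ _ bXn) (n1 := 1) (r1 := false) _) _.
    by rewrite num_v // lim_n eqxx; exact: runs_ret.
  by rewrite leq_add2l addn2.
have run_loop := @runs_loop _ _ _ (fun k => contents (X k)) n _ _ again stop.
apply: runs_le (runs_seq run_loop (runs_clear_counter v (X n))) _.
by rewrite num_n -mulnDr /t' -!addnA.
Qed.

Lemma emittable_for idle v lim b : v \notin idle -> v \notin lim.1 -> emittable idle b ->
  emittable (v :: idle) (fun e => flatten [seq b (upd e v i) | i <- iota 0 (inst e lim)]).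
Proof.
move=> v_idle v_lim [p [t [pt run]]]; pose B N := N + inst_bound lim N.
pose iteration_time N := var_eq_time ([:: v], 0) lim (B N) + (t (B N) + 6).
have pB : poly_bounded B by apply: poly_boundedD poly_bounded_id (poly_bounded_inst_bound _).
exists (for_loop v lim p), (fun N => (B N + 1) * iteration_time N); split=> [|N x zx bx].
  have ptB := poly_bounded_comp pt pB.
  have pvB := poly_bounded_comp (poly_bounded_var_eq_time ([:: v], 0) lim) pB.
  by rewrite /iteration_time; prove_poly_bounded.
have [num_le _ _] := bx; have le_lim := inst_le lim num_le; set n := inst _ _ in le_lim *.
have le_B : n <= B N by rewrite (leq_trans le_lim) // leq_addl.
pose bits k := flatten [seq b (upd (num x) v i) | i <- iota 0 k].
pose X k := put (bits k) (set_num v k x).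
have inv k : k <= n -> [/\ bounded (B N) (X k), num (X k) v = k & inst (num (X k)) lim = n].
  move=> le_k; split; [|exact: upd_same|exact: inst_upd].
  apply: bounded_set_num (leq_trans le_k le_B).
  by apply: bounded_le bx _; exact: leq_addr.
have body k : k < n ->
    runs p (contents (X k)) (t (B N)) true (contents (set_num v k (X k.+1))).
  move=> lt_k; rewrite /X set_num_put set_num_set_num /bits flatten_iota_recr -put_cat.
  apply: run; last by case: (inv k (ltnW lt_k)).
  apply: (zero_on_set_num _ v_idle) => c c_in.
  by apply: zx; rewrite inE c_in orbT.
have x0 : set_num v 0 x = x by rewrite -[RHS](set_num_id v) zx ?mem_head.
have XE k : set_num v 0 (X k) = put (bits k) x by rewrite set_num_put set_num_set_num x0.
have X0 : X 0 = x by rewrite -[RHS]x0 /X /put cats0.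
rewrite -XE -{1}X0; apply: runs_le (runs_for_loop inv body) _.
by rewrite leq_mul2r addn1 ltnS le_B orbT.
Qed.

(** * Printing atoms *)

(* The sentence has [total_var] variables, and [delta_var] is the last one of the chain. *)
Definition total_var : tvar := ([:: Scale; InputLen; InputLen], 1).
Definition delta_var : tvar := ([:: Scale; InputLen], 0).
Definition ctr_var (c : counter) : tvar := ([:: c], 0).
Definition next_var (x : tvar) : tvar := (x.1, x.2.+1).

Lemma inst_total e : inst e total_var = total_vars (e Scale) (e InputLen).
Proof. by rewrite /inst /total_vars /=; lia. Qed.

Definition lpoly_avoids (c : counter) (p : lpoly tvar) : bool :=
  all (fun m => all (fun x : tvar => c \notin x.1) m.2) p.

Definition latom_avoids (c : counter) (a : latom tvar) : bool :=
  lpoly_avoids c a.1 && lpoly_avoids c a.2.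

Definition printable (enc : nat -> latom nat -> seq bool) : Prop :=
  forall a, latom_avoids Pos a ->
    emittable [:: Pos] (fun e => enc (inst e total_var) (latom_map (inst e) a)).

Lemma emittable_enc_lmon_term idle m :
  emittable idle (fun e => enc_term (lmon_term (lmon_map (inst e) m))).
Proof.
case: m => c xs; elim: xs => [|x xs IH].
  exact: (emittable_const _ (enc_term (TConst c))).
apply: (emittable_cat (emittable_const _ [:: true; true])).
apply: (emittable_cat _ IH); apply: (emittable_cat (emittable_const _ [:: false; false])).
exact: emittable_enc_var.
Qed.

Lemma emittable_enc_lpoly_term idle p :
  emittable idle (fun e => enc_term (lpoly_term (lpoly_map (inst e) p))).
Proof.
elim: p => [|m p IH]; first exact: (emittable_const _ (enc_term (TConst Z0))).
apply: (emittable_cat (emittable_const _ [:: true; false])).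
exact: (emittable_cat (emittable_enc_lmon_term idle m) IH).
Qed.

Lemma printable_tatom : printable (fun=> enc_tatom \o latom_tatom).
Proof.
move=> a _; apply: (emittable_cat (emittable_const _ [:: false])).
exact: (emittable_cat (emittable_enc_lpoly_term _ a.1) (emittable_enc_lpoly_term _ a.2)).
Qed.

Lemma enc_exponents hi ix : enc_list enc_unary (exponents hi ix) =
  flatten [seq true :: enc_unary (count_mem i ix) | i <- iota 0 hi] ++ [:: false].
Proof.
rewrite /exponents; elim: (iota 0 hi) => //= i l ->.
by rewrite -catA.
Qed.

Lemma enc_count_mem (i : nat) ix : enc_unary (count_mem i ix) =
  flatten [seq if j == i then [:: true] else [::] | j <- ix] ++ [:: false].
Proof. by elim: ix => //= j ix; case: (j == i) => //= <-. Qed.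

Lemma emittable_enc_exponents xs : all (fun x : tvar => Pos \notin x.1) xs ->
  emittable [:: Pos] (fun e => enc_list enc_unary (exponents (inst e total_var) (map (inst e) xs))).
Proof.
move=> /allP avoid; pose bits (e : counter -> nat) := true :: flatten
  [seq if inst e x == inst e (ctr_var Pos) then [:: true] else [::] | x <- xs] ++ [:: false].
have em_bits : emittable [::] bits.
  apply: (emittable_cat (emittable_const _ [:: true])).
  apply: (emittable_cat _ (emittable_const _ [:: false])); apply: emittable_flatten => x _.
  by apply: emittable_if_eq; exact: emittable_const.
have em_loop := emittable_for (idle := [::]) (v := Pos) (lim := total_var) isT isT em_bits.
apply: emittable_ext (emittable_cat em_loop (emittable_const _ [:: false])) => e _.
rewrite enc_exponents; congr (flatten _ ++ _); apply: eq_map => i.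
rewrite enc_count_mem -map_comp /bits; congr (_ :: flatten _ ++ _); apply/eq_in_map => x x_in /=.
by rewrite inst_upd ?avoid // [inst _ (ctr_var _)]upd_same.
Qed.

Lemma emittable_enc_lpoly_std p : lpoly_avoids Pos p ->
  emittable [:: Pos] (fun e => enc_stdpoly (lpoly_std (inst e total_var) (lpoly_map (inst e) p))).
Proof.
elim: p => [|[c xs] p IH]; first by move=> _; exact: (emittable_const _ [:: false]).
move=> /andP [xs_ok /IH {}IH]; apply: (emittable_cat (emittable_const _ [:: true])).
apply: (emittable_cat _ IH).
exact: (emittable_cat (emittable_enc_exponents xs_ok) (emittable_const _ (enc_Z c))).
Qed.

Lemma printable_satom : printable (fun hi => enc_satom \o latom_satom hi).
Proof.
move=> a /andP [ok1 ok2]; apply: (emittable_cat (emittable_const _ [:: false])).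
exact: (emittable_cat (emittable_enc_lpoly_std ok1) (emittable_enc_lpoly_std ok2)).
Qed.

Definition loop_counters : seq counter := [:: Link; Pos].

Lemma zero_on_loop_counters e : e Link = 0 -> e Pos = 0 -> zero_on loop_counters e.
Proof. by move=> link0 pos0 c; rewrite !inE => /orP [] /eqP ->. Qed.

Lemma loop_counters_widen b : emittable [:: Pos] b -> emittable loop_counters b.
Proof. by apply: emittable_widen => c c_in; rewrite inE c_in orbT. Qed.

Section PrintedAtoms.

Variable enc : nat -> latom nat -> seq bool.

Hypothesis enc_printable : printable enc.

Definition gate_avoids (c : counter) (g : gate tvar) : bool :=
  [&& lpoly_avoids c g.1.1, lpoly_avoids c g.1.2 & c \notin g.2.1].

Lemma emittable_links disj l : all (latom_avoids Pos) l ->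
  emittable [:: Pos] (fun e =>
    enc_links (enc (total_vars (e Scale) (e InputLen))) disj (map (latom_map (inst e)) l)).
Proof.
move=> /allP ok; pose bits a e := [:: true; disj; false] ++
  enc (inst e total_var) (latom_map (inst e) a).
apply: (emittable_ext (b := fun e => flatten [seq bits a e | a <- l])) => [e _|].
  by rewrite /enc_links -map_comp -inst_total.
apply: emittable_flatten => a a_in; apply: (emittable_cat (emittable_const _ _)).
exact: enc_printable (ok a a_in).
Qed.

Lemma gate_escapes_map (h : tvar -> nat) d g :
  gate_escapes (h d) (gate_map h g) = map (latom_map h) (gate_escapes d g).
Proof. by case: g => [[l r] z]. Qed.

Lemma gate_equations_map (h : tvar -> nat) g :
  gate_equations (gate_map h g) = map (latom_map h) (gate_equations g).
Proof. by case: g => [[l r] z]. Qed.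

Lemma emittable_gate_bits g : gate_avoids Pos g ->
  emittable [:: Pos] (fun e =>
    gate_bits enc (e Scale) (e InputLen) (e PsiLeft) (gate_map (inst e) g)).
Proof.
case: g => [[l r] z] /and3P [/= l_ok r_ok z_ok].
have escapes_ok : all (latom_avoids Pos) (gate_escapes delta_var (l, r, z)).
  by rewrite /= /latom_avoids /= l_ok r_ok z_ok.
have equations_ok : all (latom_avoids Pos) (gate_equations (l, r, z)).
  by rewrite /= /latom_avoids /= l_ok r_ok.
apply: emittable_ext (emittable_if_pos PsiLeft (emittable_links false equations_ok)
  (emittable_links true escapes_ok)) => e _.
by rewrite -gate_escapes_map -gate_equations_map /gate_bits; case: (e PsiLeft).
Qed.

Lemma emittable_chain_atoms : emittable loop_counters (fun e =>
  enc_links (enc (total_vars (e Scale) (e InputLen))) true (chain_atoms (e Scale) (e InputLen))).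
Proof.
pose link := chain_atom (ctr_var Scale) ([:: Scale; Link], 0) ([:: Scale; Link], 1).
have em_link : emittable [:: Pos] (fun e => enc_links (enc (total_vars (e Scale) (e InputLen)))
    true [:: latom_map (inst e) link]).
  exact: (emittable_links true (l := [:: link])).
have em := emittable_for (idle := [:: Pos]) (v := Link) (lim := ctr_var InputLen) isT isT em_link.
apply: emittable_ext em => e _.
rewrite /chain_atoms /enc_links -map_comp; congr flatten; apply: eq_map => i.
by rewrite /= cats0 /latom_map /lpoly_map /lmon_map /= /inst /= upd_same.
Qed.

Lemma emittable_head_bits :
  emittable loop_counters (fun e => head_bits enc (e Scale) (e InputLen) (e PsiLeft) (e Fresh)).
Proof.
pose phi := phi_head (ctr_var Scale) delta_var (next_var (ctr_var Fresh)) (ctr_var Fresh).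
pose psi := [:: psi_head (next_var (ctr_var Fresh)) (ctr_var Fresh)].
have em l disj : all (latom_avoids Pos) l -> emittable loop_counters (fun e =>
    enc_links (enc (total_vars (e Scale) (e InputLen))) disj (map (latom_map (inst e)) l)).
  by move=> ok; exact: loop_counters_widen (emittable_links disj ok).
apply: emittable_ext (emittable_if_pos PsiLeft (em psi false isT)
  (emittable_cat (em phi true isT) emittable_chain_atoms)) => e _.
by rewrite -enc_links_cat /head_bits; case: (e PsiLeft).
Qed.

Lemma emittable_last_bits :
  emittable [:: Pos] (fun e => last_bits enc (e Scale) (e InputLen) (e PsiLeft)).
Proof.
apply: (emittable_cat (emittable_const _ [:: false])).
have em_phi := enc_printable (a := phi_last (ctr_var Scale)) isT.
have em_psi := enc_printable (a := psi_last) isT.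
apply: emittable_ext (emittable_if_pos PsiLeft em_psi em_phi) => e _.
by rewrite inst_total; case: (0 < e PsiLeft).
Qed.

End PrintedAtoms.

(** * State transformations computable in polynomial time *)

Definition realizable (f : state -> state) : Prop :=
  exists p t, poly_bounded t /\ forall N x, zero_on loop_counters (num x) -> bounded N x ->
    [/\ runs p (contents x) (t N) true (contents (f x)), bounded (t N) (f x) &
        zero_on loop_counters (num (f x))].

Definition emit (bits : (counter -> nat) -> seq bool) (x : state) : state :=
  put (bits (num x)) x.

Definition set_unread (u : seq bool) (x : state) : state :=
  State (num x) u (pending x) (written x).

Definition if_read (f g : state -> state) (x : state) : state :=
  (if head false (unread x) then f else g) (set_unread (behead (unread x)) x).

Definition if_counter (c : counter) (f g : state -> state) (x : state) : state :=
  (if 0 < num x c then f else g) x.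

Definition if_pending (f g : state -> state) (x : state) : state :=
  (if pending x != [::] then f else g) x.

Definition incr (c : counter) (x : state) : state := set_num c (num x c).+1 x.

Definition decr (c : counter) (x : state) : state := set_num c (num x c).-1 x.

Definition reset (c : counter) : state -> state := set_num c 0.

Definition add_to (c d : counter) (x : state) : state := set_num d (num x c + num x d) x.

Definition read_number (c : counter) (x : state) : state :=
  let n := index false (unread x) in
  set_num c (n + num x c) (set_unread (drop n.+1 (unread x)) x).

Definition push_pending (c : counter) (x : state) : state :=
  State (num x) (unread x) (num x c :: pending x) (written x).

Definition pop_pending (c : counter) (x : state) : state :=
  set_num c (head 0 (pending x) + num x c)
    (State (num x) (unread x) (behead (pending x)) (written x)).

Lemma realizable_id : realizable id.
Proof.
exists (tret true), (fun N => N + 1); split=> [|N x zx bx]; first by prove_poly_bounded.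
split=> //; last by apply: bounded_le bx _; exact: leq_addr.
by apply: runs_le (runs_ret _ _ _) _; exact: leq_addl.
Qed.

Lemma realizable_comp f g : realizable f -> realizable g -> realizable (f \; g).
Proof.
move=> [p [t [pt run]]] [p' [t' [pt' run']]].
exists (TSeq p p'), (fun N => t N + t' (t N)); split=> [|N x zx bx].
  by have := poly_bounded_comp pt' pt; prove_poly_bounded.
have [run_f bf zf] := run N x zx bx; have [run_g bg zg] := run' _ _ zf bf.
split=> //; first exact: runs_seq run_f run_g.
by apply: bounded_le bg _; exact: leq_addl.
Qed.

Lemma realizable_emit bits : emittable loop_counters bits -> realizable (emit bits).
Proof.
move=> [p [t [pt run]]]; exists p, (fun N => t N + N); split; first by prove_poly_bounded.
move=> N x zx bx; split=> //.
- by apply: runs_le (run N x zx bx) _; exact: leq_addr.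
- by apply: bounded_le (bounded_put _ bx) _; exact: leq_addl.
Qed.

Lemma realizable_if (q : tprog) (r : state -> bool) (h f g : state -> state) :
  (forall x, runs q (contents x) 1 (r x) (contents (h x))) ->
  (forall N x, bounded N x -> bounded N (h x)) -> (forall x, num (h x) = num x) ->
  realizable f -> realizable g -> realizable (fun x => (if r x then f else g) (h x)).
Proof.
move=> run_q bound_h num_h [p [t [pt run]]] [p' [t' [pt' run']]].
exists (TIf q p p'), (fun N => 1 + (t N + t' N)); split=> [|N x zx /bound_h bx].
  by prove_poly_bounded.
rewrite -num_h in zx; have run_qx := run_q x; case: (r x) run_qx => run_qx.
- have [run_f bf zf] := run N _ zx bx; split=> //; last by apply: bounded_le bf _; lia.
  by apply: runs_if run_qx _; apply: runs_le run_f _; rewrite leq_addr.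
- have [run_g bg zg] := run' N _ zx bx; split=> //; last by apply: bounded_le bg _; lia.
  by apply: runs_if run_qx _; apply: runs_le run_g _; rewrite leq_addl.
Qed.

Lemma realizable_if_read f g : realizable f -> realizable g -> realizable (if_read f g).
Proof.
apply: (realizable_if (q := pop Input)) => // [x|N x [num_le u_le p_le]].
  by apply: runs_eq (runs_pop _ _ _) _ => -[].
by split=> //; rewrite /= size_behead (leq_trans (leq_pred _)).
Qed.

Lemma realizable_if_counter c f g : realizable f -> realizable g -> realizable (if_counter c f g).
Proof.
apply: (realizable_if (q := nonempty (Ctr c)) (h := id)) => // x.
have -> : (0 < num x c) = (contents x (Ctr c) != [::]).
  by rewrite -size_eq0 size_nseq lt0n.
exact: runs_nonempty.
Qed.

Lemma realizable_if_pending f g : realizable f -> realizable g -> realizable (if_pending f g).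
Proof.
apply: (realizable_if (q := nonempty Pending) (h := id)) => // x.
have -> : (pending x != [::]) = (contents x Pending != [::]).
  by rewrite -!size_eq0 size_pending; case: (pending x).
exact: runs_nonempty.
Qed.

Lemma realizable_incr c : c \notin loop_counters -> realizable (incr c).
Proof.
move=> c_idle; exists (push (Ctr c) true), (fun N => N + 1); split=> [|N x zx bx].
  by prove_poly_bounded.
split; [|apply: bounded_set_num|exact: zero_on_set_num].
- by apply: runs_le (runs_push_counter _ _) _; rewrite leq_addl.
- by apply: bounded_le bx _; rewrite leq_addr.
- by rewrite addn1 ltnS; case: bx.
Qed.

Lemma realizable_decr c : c \notin loop_counters -> realizable (decr c).
Proof.
move=> c_idle; exists (TSeq (pop (Ctr c)) (tret true)), (fun N => N + 2); split=> [|N x zx bx].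
  by prove_poly_bounded.
split; [|apply: bounded_set_num|exact: zero_on_set_num].
- apply: runs_le (runs_seq (runs_pop _ _ _) (runs_eq (runs_ret _ _ _) _)) _ => [r|]; last first.
    by rewrite leq_addl.
  by rewrite -contents_set_num /=; case: (num x c).
- by apply: bounded_le bx _; rewrite leq_addr.
- by case: bx => /(_ c); lia.
Qed.

Lemma realizable_reset c : c \notin loop_counters -> realizable (reset c).
Proof.
move=> c_idle; exists (clear (Ctr c)), (fun N => N + (N + 1) * 4); split=> [|N x zx bx].
  by prove_poly_bounded.
split; [|apply: bounded_set_num|exact: zero_on_set_num] => //.
- by apply: runs_le (runs_clear_counter _ _) _; case: bx => /(_ c); lia.
- by apply: bounded_le bx _; rewrite leq_addr.
Qed.

Lemma realizable_add_to c d : c != d -> d \notin loop_counters -> realizable (add_to c d).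
Proof.
move=> ne_cd d_idle; exists (copy (Ctr c) Tmp [:: Ctr d]), (fun N => (N + N) + (N + 1) * 11).
split=> [|N x zx bx]; first by prove_poly_bounded.
have [num_le _ _] := bx; split; [|apply: bounded_set_num|exact: zero_on_set_num].
- have uniq_cd : uniq [:: Tmp; Ctr c; Ctr d] by rewrite /= inE andbT.
  apply: runs_le (runs_eq (runs_copy _ uniq_cd _) _) _ => // [r|].
    rewrite -contents_set_num /pushed /upd inE; case: eqP => // ->.
    by rewrite /= nseqD.
  by rewrite /= size_nseq; have := num_le c; lia.
- by apply: bounded_le bx _; lia.
- by have := num_le c; have := num_le d; lia.
Qed.

Lemma realizable_read_number c : c \notin loop_counters -> realizable (read_number c).
Proof.
move=> c_idle; exists (read_unary Input (Ctr c)), (fun N => N + 2 * (N + 1)).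
split=> [|N x zx bx]; first by prove_poly_bounded.
have [num_le u_le p_le] := bx; have le_i := index_size false (unread x).
split; [|apply: bounded_set_num|exact: zero_on_set_num].
- have run := runs_read_unary Output (j := Input) (dst := Ctr c) (contents x) isT.
  apply: runs_le (runs_eq run _) _ => [r|]; last by rewrite /=; lia.
  by rewrite -contents_set_num /upd; case: eqP => // _; rewrite /= ?nseqD; case: r.
- apply: (@bounded_le N); last by rewrite leq_addr.
  by split=> //; rewrite /= size_drop (leq_trans (leq_subr _ _)).
- have := num_le c; have := leq_trans le_i u_le; set i := index _ _; lia.
Qed.

Lemma realizable_push_pending c : realizable (push_pending c).
Proof.
exists (TSeq (push Pending false) (copy c Tmp [:: Pending])), (fun N => N + N + (N + 3) * 11).
split=> [|N x zx bx]; first by prove_poly_bounded.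
have [num_le u_le p_le] := bx; split=> //.
- have run_push := runs_push Output Pending false (contents x); set m := upd _ _ _ in run_push.
  have run_copy := @runs_copy _ Output c Tmp [:: Pending] m isT erefl.
  apply: runs_le (runs_eq (runs_seq run_push run_copy) _) _ => [r|]; last first.
    by rewrite /= size_nseq; have := num_le c; lia.
  by rewrite /pushed inE; case: r => //=; rewrite /enc_unary -catA.
- have le_c := num_le c; apply: (@bounded_le (N + N + 1)); last lia.
  by split=> [d|/=|]; [have /= := num_le d| |rewrite /pending_size /= in p_le *]; lia.
Qed.

Lemma realizable_pop_pending c : c \notin loop_counters -> realizable (pop_pending c).
Proof.
move=> c_idle; exists (read_unary Pending (Ctr c)), (fun N => (N + N) + 2 * (N + 1)).
split=> [|N x zx bx]; first by prove_poly_bounded.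
have [num_le u_le p_le] := bx.
have [head_le behead_le] :
    head 0 (pending x) <= N /\ pending_size (behead (pending x)) <= N.
  by case: (pending x) p_le => //= n P; rewrite /pending_size /=; lia.
split; [|apply: bounded_set_num|exact: zero_on_set_num].
- have run := runs_read_unary Output (j := Pending) (dst := Ctr c) (contents x) isT.
  apply: runs_le (runs_eq run _) _ => [r|]; last by rewrite size_pending; lia.
  rewrite -contents_set_num /=; case: (pending x) => [|n P]; last first.
    by rewrite /= index_enc_unary drop_enc_unary nseqD /upd; case: eqP => // _; case: r.
  by rewrite /upd; case: eqP => // _; case: r.
- by apply: (@bounded_le N); [split | lia].
- by have := num_le c; lia.
Qed.

(** * The program *)

Local Notation drain := (Stack.drain Output).
Local Notation while_nonempty := (Stack.while_nonempty Output).

Create HintDb realizable discriminated.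

#[local] Hint Constants Opaque : realizable.

#[local] Hint Resolve realizable_id realizable_comp realizable_emit realizable_if_read
  realizable_if_counter realizable_if_pending realizable_incr realizable_decr realizable_reset
  realizable_add_to realizable_read_number realizable_push_pending realizable_pop_pending
  emittable_const : realizable.

#[local] Hint Extern 0 (is_true _) => exact isT : realizable.

Section Program.

Variable enc : nat -> latom nat -> seq bool.

Hypothesis enc_printable : printable enc.

Definition emit_gate (g : gate tvar) : state -> state :=
  emit (fun e => gate_bits enc (e Scale) (e InputLen) (e PsiLeft) (gate_map (inst e) g)).

Definition emit_head : state -> state :=
  emit (fun e => head_bits enc (e Scale) (e InputLen) (e PsiLeft) (e Fresh)).

Definition emit_last : state -> state :=
  emit (fun e => last_bits enc (e Scale) (e InputLen) (e PsiLeft)).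

Definition push_wire : state -> state := push_pending Fresh \; incr Fresh.

Definition read_term : state -> state :=
  let: (s, z, x) := (ctr_var Scale, ctr_var Node, ctr_var Fresh) in
  if_read
    (if_read (emit_gate (mul_gate s z (next_var x) x)) (emit_gate (add_gate z (next_var x) x)) \;
     push_wire \; push_wire)
    (if_read
      (if_read (emit_gate (neg_gate z x) \; push_wire \; incr Digits)
        (if_read (push_pending Node \; incr Digits) (emit_gate (zero_gate z))))
      (read_number Index \; emit_gate (var_gate s z (ctr_var Index)) \; reset Index)).

Definition read_digit : state -> state :=
  let: (s, z, x) := (ctr_var Scale, ctr_var Node, ctr_var Fresh) in
  if_read
    (if_read (emit_gate (digit_gate s true z x)) (emit_gate (digit_gate s false z x)) \; push_wire)
    (emit_gate (zero_gate z) \; reset Digits).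

Definition read_formula : state -> state :=
  if_read
    (emit (fun=> [:: true]) \;
     if_read (emit (fun=> [:: true])) (emit (fun=> [:: false])) \;
     if_counter PsiLeft (incr PsiLeft) id)
    (if_read id id \; emit_head \; push_wire \; push_wire).

Definition finish : state -> state := if_pending id (emit_last \; decr PsiLeft).

Definition token : state -> state :=
  if_pending (pop_pending Node \; if_counter Digits read_digit read_term \; reset Node \; finish)
    read_formula.

Lemma realizable_emit_gate g : gate_avoids Pos g -> realizable (emit_gate g).
Proof.
move=> ok; apply: realizable_emit.
exact: loop_counters_widen (emittable_gate_bits enc_printable ok).
Qed.

Lemma realizable_token : realizable token.
Proof.
have last : realizable emit_last.
  by apply: realizable_emit; exact: loop_counters_widen (emittable_last_bits enc_printable).
have head : realizable emit_head by apply: realizable_emit; exact: emittable_head_bits.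
rewrite /token /finish /read_formula /read_term /read_digit /push_wire.
by auto 20 using realizable_emit_gate with realizable nocore.
Qed.

Definition state_of (s L : nat) (t : pass) : state :=
  State (fun c => match c with
    | Scale => s | InputLen => L | Fresh => p_fresh t | PsiLeft => p_psi t
    | Digits => p_digits t : nat | Node | Index | Pos | Link => 0
    end) (p_unread t) (p_pending t) (p_written t).

Definition state_at (s L c : nat) (t : pass) : state := set_num Node c (state_of s L t).

Lemma read_term_step s L c t : p_digits t = false ->
  read_term (state_at s L c t) = state_at s L c (term_step enc s L c t).
Proof.
case: t => u f P d q w /= ->.
by case: u => [|[] [|[] [|[] [|[] u]]]]; apply: state_ext => [[]|||] //=; rewrite ?drop0 ?addn0.
Qed.

Lemma read_digit_step s L c t : p_digits t = true ->
  read_digit (state_at s L c t) = state_at s L c (digit_step enc s L c t).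
Proof.
case: t => u f P d q w /= ->.
by case: u => [|[] [|[] u]]; apply: state_ext => [[]|||] //=; rewrite ?drop0.
Qed.

Lemma read_formula_step s L t :
  read_formula (state_of s L t) = state_of s L (formula_step enc s L t).
Proof.
case: t => u f P d [|q] w.
all: by case: u => [|[] [|[] u]]; apply: state_ext => [[]|||] //=; rewrite ?drop0 -?catA.
Qed.

Lemma finish_step s L t : finish (state_of s L t) = state_of s L (finish_atom enc s L t).
Proof. by case: t => u f [|c P] d q w //; apply: state_ext => [[]|||]. Qed.

Lemma token_step s L t : p_unread t != [::] ->
  token (state_of s L t) = state_of s L (step enc s L t).
Proof.
case: t => u f [|c P] d q w ne_u; rewrite /token /if_pending /=.
  by rewrite read_formula_step; case: u ne_u.
set t := Pass u f P d q w.
have -> : pop_pending Node (state_of s L (Pass u f (c :: P) d q w)) = state_at s L c t.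
  by apply: state_ext => [[]|||] //=; rewrite addn0.
have -> : if_counter Digits read_digit read_term (state_at s L c t) =
    state_at s L c ((if d then digit_step enc s L else term_step enc s L) c t).
  rewrite /if_counter [num _ _]/= /t.
  by case: (d); [exact: read_digit_step | exact: read_term_step].
have reset_at t' : reset Node (state_at s L c t') = state_of s L t'.
  by rewrite /reset set_num_set_num; apply: state_ext => [[]|||].
by rewrite reset_at finish_step; case: u ne_u @t.
Qed.

Definition load : tprog :=
  TSeq (drain Output [:: Input; Left])
    (while_nonempty Left (TSeq (pop Left) (push InputLen true))).

Definition loaded (w : seq bool) : state := State (upd (fun=> 0) InputLen (size w)) w [::] [::].

Lemma runs_load w :
  runs load (input_memory Output w) ((size w).+1 * 10) true (contents (loaded w)).
Proof.
pose M k := upd (contents (State (upd (fun=> 0) InputLen k) w [::] [::])) Left (drop k w).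
have run_drain : runs (drain Output [:: Input; Left]) (input_memory Output w)
    ((size w).+1 * 6) true (M 0).
  have := runs_drain Output (input_memory Output w) (ds := [:: Input; Left]) (j := Output) isT isT.
  rewrite /input_memory eqxx size_rev revK => run; apply: runs_eq run _ => r.
  by rewrite /M drop0 /pushed /upd; case: r => [[]||||||] //=; rewrite cats0.
have run_count : runs (while_nonempty Left (TSeq (pop Left) (push InputLen true))) (M 0)
    ((size w).+1 * 4) true (M (size w)).
  apply: runs_while_nonempty => [k lt_k|]; last by rewrite /M upd_same drop_size.
  have leftE : M k Left = nth false w k :: drop k.+1 w by rewrite /M upd_same (drop_nth false).
  split; first by rewrite leftE.
  have run := runs_seq (runs_pop Output Left (M k)) (runs_push Output InputLen true _).
  exists true; apply: runs_eq run _ => r.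
  by rewrite leftE /M /upd; case: r => [[]||||||].
apply: runs_le (runs_seq run_drain (runs_eq run_count _)) _ => [r|]; last by rewrite -mulnDr.
by rewrite /M drop_size /upd; case: r.
Qed.

Definition read_tag : state -> state :=
  if_read (emit (fun=> [:: true]) \; incr PsiLeft)
    (emit (fun=> [:: false]) \; if_read (emit (fun=> [:: true])) (emit (fun=> [:: false]))).

Definition read_dimension (a : tvar) : state -> state :=
  read_number Index \; emit (fun e => enc_unary (inst e a)) \; add_to Index Scale \; reset Index.

Definition init : state -> state :=
  read_tag \; read_dimension (ctr_var Index) \;
  read_dimension ([:: Index; InputLen; InputLen], 1) \;
  add_to Scale Fresh \; add_to InputLen Fresh \; incr Fresh.

Lemma realizable_init : realizable init.
Proof.
have var a : emittable loop_counters (fun e => enc_unary (inst e a)) by exact: emittable_enc_var.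
by rewrite /init /read_tag /read_dimension; auto 20 with realizable nocore.
Qed.

Lemma init_start w : init (loaded w) = state_of (exists_dim w + forall_dim w) (size w) (start w).
Proof.
rewrite /init /=.
have -> : read_tag (loaded w) = State (fun c => match c with
  | InputLen => size w | PsiLeft => head false w | _ => 0 end) (after_tag w) [::] (header_tag w).
  by case: w => [|[] [|[] w]]; apply: state_ext => [[]|||] //=; rewrite /after_tag /= ?drop0.
apply: state_ext => [[]|||] //=.
- by rewrite /upd /= !addn0 addnC.
- by rewrite /upd /= !addn0 addnC [in RHS](addnC (exists_dim w)).
- rewrite -catA !addn0; congr (_ ++ (_ ++ enc_unary _)).
  by rewrite -[LHS]/(1 + forall_dim w + size w + size w); lia.
Qed.

Lemma bounded_state_of s L B t : pass_bounded s L B t ->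
  bounded ((2 * B + 3) * B.+1) (state_of s L t).
Proof.
case=> total fresh psi pend; have le_B : B <= (2 * B + 3) * B.+1 by nia.
rewrite /total_vars in total; split=> [c||] /=; first last.
- by apply: leq_trans pend; exact: leq_addr.
- lia.
- by apply: leq_trans le_B; case: c; case: (p_digits t) => /=; lia.
Qed.

Lemma runs_pass w p (t : nat -> nat) (s := exists_dim w + forall_dim w)
    (N := (2 * (5 * size w + 2) + 3) * (5 * size w + 2).+1) :
  (forall x, zero_on loop_counters (num x) -> bounded N x ->
    runs p (contents x) (t N) true (contents (token x))) ->
  runs (while_nonempty Input p) (contents (state_of s (size w) (start w)))
    ((size w).+1 * (t N).+2) true
    (contents (state_of s (size w) (iter (size w) (step enc s (size w)) (start w)))).
Proof.
move=> run; pose pass_at k := iter k (step enc s (size w)) (start w).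
pose done k := p_unread (pass_at k) == [::].
have [_ _ _ _ le_u] := header_sizes w.
have done_w : done (size w) by apply/eqP; exact: iter_step_end (start_bounded w) le_u.
have [n done_n min_n] := ex_minnP (ex_intro done _ done_w).
have le_n := min_n _ done_w.
have -> : iter (size w) (step enc s (size w)) (start w) = pass_at n.
  by rewrite -{1}(subnK le_n) iterD iter_step_done //; exact/eqP.
apply: (@runs_le _ _ _ _ (n.+1 * (t N).+2)); last by rewrite leq_mul2r ltnS le_n orbT.
pose M k := contents (state_of s (size w) (pass_at k)).
apply: (@runs_while_nonempty _ _ _ _ M) => [k lt_k|]; last exact/eqP.
have not_done : p_unread (pass_at k) != [::].
  by apply/negP => /min_n; rewrite leqNgt lt_k.
split=> //; exists true; rewrite /M [pass_at k.+1]/= -token_step //.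
apply: run; first exact: zero_on_loop_counters.
exact: bounded_state_of (iter_step_bounded _ _ (start_bounded w)).
Qed.

Theorem translate_poly_time : poly_time_computable (translate enc).
Proof.
have [p_init [t_init [pt_init run_init]]] := realizable_init.
have [p [t [pt run_token]]] := realizable_token.
pose N n := (2 * (5 * n + 2) + 3) * (5 * n + 2 + 1).
pose time n := (n + 1) * 10 + (t_init n + (n + 1) * (t (N n) + 2)).
have pN : poly_bounded N by rewrite /N; prove_poly_bounded.
apply: (@stack_program_poly_time _ Output (TSeq load (TSeq p_init (while_nonempty Input p))) time).
  by have ptN := poly_bounded_comp pt pN; rewrite /time; prove_poly_bounded.
move=> w; set s := exists_dim w + forall_dim w.
have bounded_loaded : bounded (size w) (loaded w).
  by split=> // c; rewrite /= /upd; case: eqP.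
have zero_loaded : zero_on loop_counters (num (loaded w)) by exact: zero_on_loop_counters.
have [run_start _ _] := run_init _ _ zero_loaded bounded_loaded.
rewrite init_start in run_start.
have run_pass := @runs_pass w p t (fun x zx bx => let: And3 r _ _ := run_token _ x zx bx in r).
have run := runs_seq (runs_load w) (runs_seq run_start run_pass).
exists true; eexists; split; first apply: runs_le run _; last exact: revK.
by rewrite /time /N !addn1 !addn2.
Qed.

End Program.

Theorem mainTheorem12 :
  forall C : cls,
    (exists g : seq bool -> seq bool, poly_time_computable g /\
       forall s : sentence tatom, in_class tatom_ok C s ->
         exists s' : sentence tatom,
           in_class tatom_ok C s' /\
           sentence_atoms_all (tatom_deg_le (nvars s') 4) s' /\
           g (enc_sentence enc_tatom s) = enc_sentence enc_tatom s' /\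
           (sentence_true tatom_holds s' <-> sentence_true tatom_holds s))
    /\
    (exists g : seq bool -> seq bool, poly_time_computable g /\
       forall s : sentence tatom, in_class tatom_ok C s ->
         exists s' : sentence satom,
           in_class satom_ok C s' /\
           g (enc_sentence enc_tatom s) = enc_sentence enc_satom s' /\
           (sentence_true satom_holds s' <-> sentence_true tatom_holds s)).
Proof.
move=> C; split.
- exists (translate (fun=> enc_tatom \o latom_tatom)).
  split=> [|s ok_s]; first exact: translate_poly_time printable_tatom.
  have [ok_s' deg_s' true_s'] := red_tatom_correct ok_s (sentence_wires_le s).
  exists (red_tatom (size (enc_sentence enc_tatom s)) s).
  by rewrite translate_sentence enc_sentence_map.
- exists (translate (fun hi => enc_satom \o latom_satom hi)).
  split=> [|s ok_s]; first exact: translate_poly_time printable_satom.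
  have [ok_s' true_s'] := red_satom_correct ok_s (sentence_wires_le s).
  exists (red_satom (size (enc_sentence enc_tatom s)) s).
  by rewrite translate_sentence enc_sentence_map.
Qed.
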